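(* Let $N>2$, $k\ge2$, let $f_1$ and $\alpha_*$ satisfy $(H_1)$–$(H_4)$ below, and let $f_2,\dots,f_k$ be positive continuous functions on $[\alpha_*,\gamma)$, $\alpha_*<\gamma\le\infty$. Then there exist constants $\epsilon_i>0$, $i=1,\dots,k-1$, $A_i>0$, $i=2,\dots,k$, and $\alpha_i$, $i=1,\dots,k-1$, with $\alpha_1=\alpha_*+\epsilon_1$... more precisely with $\alpha_*<\alpha_{i-1}+\epsilon_{i-1}<\alpha_i$, such that the problem $$\Delta u+f(u)=0\ \text{in }\mathbb R^N,\qquad \lim_{|x|\to\infty}u(x)=0,$$ with $$f=f_1\chi_{[0,\alpha_1]}+\sum_{i=2}^{k}L_{i-1}\chi_{[\alpha_{i-1},\alpha_{i-1}+\epsilon_{i-1}]}+\sum_{i=2}^{k-1}A_i^2f_i\chi_{[\alpha_{i-1}+\epsilon_{i-1},\alpha_i]}+A_k^2f_k\chi_{[\alpha_{k-1}+\epsilon_{k-1},\gamma)}$$ (extended oddly, and understood as a continuous function) has at least $k$ ground state solutions.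
   Context: $\chi_I$ is the indicator of the interval $I$. $L_1$ is the affine function joining $(\alpha_1,f_1(\alpha_1))$ to $(\alpha_1+\epsilon_1,A_2^2f_2(\alpha_1+\epsilon_1))$, and for $i\ge3$, $L_{i-1}$ is the affine function joining $(\alpha_{i-1},A_{i-1}^2f_{i-1}(\alpha_{i-1}))$ to $(\alpha_{i-1}+\epsilon_{i-1},A_i^2f_i(\alpha_{i-1}+\epsilon_{i-1}))$. A ground state is a nonnegative, nontrivial solution (compactly supported ones allowed). Hypotheses: $(H_1)$ $f_1\in C[0,\infty)\cap C^1(0,\infty)$, $f_1(0)=0$, there is $b\ge0$ with $f_1(s)>0$ for $s>b$, $f_1(s)\le0$ on $[0,b]$, and $f_1<0$ on $(0,\epsilon_0)$ for some $\epsilon_0>0$; with $F_1(s)=\int_0^sf_1$, there is a unique finite $\beta\ge b$ with $F_1(\beta)=0$. $(H_2)$ $(F_1/f_1)'(s)>(N-2)/(2N)$ for all $s>\beta$. $(H_3)$ $f_1(s)/(s-b)$ is increasing for $s>b$. $(H_4)$ the solution of $u''+\frac{N-1}{r}u'+f_1(u)=0$, $u(0)=\alpha_*$, $u'(0)=0$ is a ground state. *)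

(* Defs.v *)
From HB Require Import structures.
From mathcomp Require Import all_boot all_order all_algebra.
From mathcomp Require Import all_classical all_reals all_analysis.
Set Implicit Arguments. Unset Strict Implicit. Unset Printing Implicit Defensive.
Import Order.TTheory GRing.Theory Num.Theory.
Import numFieldNormedType.Exports.
Local Open Scope classical_set_scope.
Local Open Scope ring_scope.

Section Defs.
Variable R : realType.

Definition partial (N : nat) (i : 'I_N) (u : 'rV[R]_N -> R) : 'rV[R]_N -> R :=
  fun x => 'D_(delta_mx 0 i) u x.

Definition laplacian (N : nat) (u : 'rV[R]_N -> R) : 'rV[R]_N -> R :=
  fun x => \sum_(i < N) partial i (partial i u) x.

(* Ground state of  Delta u + f(u) = 0 in R^N, u(x) -> 0 as |x| -> oo,
   for a nonlinearity f defined on (-gamma, gamma): a nonnegative,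
   nontrivial classical (twice differentiable) solution with values in
   the domain [0, gamma) of f. *)
Definition pde_ground_state (N : nat) (f : R -> R) (gamma : \bar R)
  (u : 'rV[R]_N -> R) : Prop :=
  (forall x, differentiable u x) /\
  (forall (i : 'I_N) x, differentiable (partial i u) x) /\
  (forall x, laplacian u x + f (u x) = 0) /\
  (forall x, 0 <= u x /\ ((u x)%:E < gamma)%E) /\
  (exists x, u x != 0) /\
  (forall e : R, 0 < e -> exists M : R, forall x, M < `|x| -> `|u x| < e).

(* Radial problem  v'' + (N-1)/r v' + g(v) = 0, v(0) = a, v'(0) = 0,
   whose solution is a ground state (nonnegative, nontrivial, decaying;
   compactly supported solutions allowed).  Only the values of v on
   [0, +oo) matter. *)
Definition radial_ivp_ground_state (N : nat) (g : R -> R) (a : R)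
  (v : R -> R) : Prop :=
  (forall r, 0 <= r -> derivable v r 1) /\
  (forall r, 0 < r -> derivable (derive1 v) r 1) /\
  v 0 = a /\ derive1 v 0 = 0 /\
  (forall r, 0 < r ->
      derive1 (derive1 v) r + (N%:R - 1) / r * derive1 v r + g (v r) = 0) /\
  (forall r, 0 <= r -> 0 <= v r) /\
  (exists r, 0 <= r /\ v r != 0) /\
  (v x @[x --> +oo] --> 0).

Definition primF (f1 : R -> R) (s : R) : R :=
  Rintegral lebesgue_measure `[0, s] f1.

Definition H1 (f1 : R -> R) (b beta : R) : Prop :=
  {within `[0, +oo[, continuous f1} /\
  (forall s, 0 < s -> derivable f1 s 1) /\
  {within `]0, +oo[, continuous (derive1 f1)} /\
  f1 0 = 0 /\ 0 <= b /\
  (forall s, b < s -> 0 < f1 s) /\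
  (forall s, 0 <= s <= b -> f1 s <= 0) /\
  (exists2 e0, 0 < e0 & forall s, 0 < s < e0 -> f1 s < 0) /\
  (b <= beta /\ primF f1 beta = 0 /\
   forall s, b <= s -> primF f1 s = 0 -> s = beta).

Definition H2 (N : nat) (f1 : R -> R) (beta : R) : Prop :=
  forall s, beta < s ->
    derivable (fun t => primF f1 t / f1 t) s 1 /\
    (N%:R - 2) / (2 * N%:R) < derive1 (fun t => primF f1 t / f1 t) s.

Definition H3 (f1 : R -> R) (b : R) : Prop :=
  forall s t, b < s -> s < t -> f1 s / (s - b) < f1 t / (t - b).

Definition H4 (N : nat) (f1 : R -> R) (astar : R) : Prop :=
  exists v : R -> R, radial_ivp_ground_state N f1 astar v.

(* The nonlinearity of Theorem 4.4.  Indices: f i, A i for i = 2..k,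
   alpha i, eps i for i = 1..k-1. *)
Section Nonlinearity.
Variables (k : nat) (f1 : R -> R) (f : nat -> R -> R) (A alpha eps : nat -> R).

Definition Lleft (j : nat) : R :=
  if j == 1%N then f1 (alpha 1) else A j ^+ 2 * f j (alpha j).

Definition Laff (j : nat) (s : R) : R :=
  Lleft j + (s - alpha j) *
    ((A j.+1 ^+ 2 * f j.+1 (alpha j + eps j) - Lleft j) / eps j).

Fixpoint fseg (fuel i : nat) (s : R) : R :=
  match fuel with
  | 0%N => A k ^+ 2 * f k s
  | fuel'.+1 =>
      if s <= alpha i.-1 + eps i.-1 then Laff i.-1 s
      else if (i < k)%N then
        (if s <= alpha i then A i ^+ 2 * f i s else fseg fuel' i.+1 s)
      else A k ^+ 2 * f k s
  end.

Definition fpos (s : R) : R :=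
  if s <= alpha 1 then f1 s else fseg k 2 s.

Definition fnl (s : R) : R := if 0 <= s then fpos s else - fpos (- s).

End Nonlinearity.
End Defs.

(* Main.v *)
Require Import Defs.
From HB Require Import structures.
From mathcomp Require Import all_boot all_order all_algebra.
From mathcomp Require Import all_classical all_reals all_analysis.
From mathcomp Require Import ring lra.
Import Order.TTheory GRing.Theory Num.Theory.
Import numFieldNormedType.Exports.
Set Implicit Arguments. Unset Strict Implicit. Unset Printing Implicit Defensive.
Local Open Scope classical_set_scope.
Local Open Scope ring_scope.

(** A radial solution [u] with [u 0 = a], [v = - u'], has the energy
    [v ^+ 2 / 2 + F u], which decreases in [r]. Call [a] crossing if [u] becomes
    negative and losing if the energy does; both are open conditions on [a], and a
    start value which is neither gives a ground state. So there is a ground state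
    between a crossing and a losing start value.

    An affine ramp added to the nonlinearity above a level [a] makes its upper end
    - losing, if it is steep and the start value [a - kappa * d] was losing, where [d]
      is the width: the solution then falls from [a + d] to about [a - kappa * d] within
      a tiny radius and arrives there with negligible speed, so it behaves like the
      solution starting at that level; [kappa > 0] depends on the dimension only;
    - crossing, if its upper value is small: the descent along the ramp then takes so
      long that friction is negligible afterwards, and energy is almost conserved.
    Changing the nonlinearity above [a] does not affect start values up to [a].
    Alternating the two kinds of ramps, each new ramp separates a losing from a crossing
    start value by a new ground state; the first ramp, placed around the given ground
    state, leaves two of them below its upper end. *)

(** * Calculus on the line *)

Section Calculus.
Variable R : realType.
Implicit Types (f g df : R -> R) (a b x y e r l : R).

Lemma deriv_add f g x a b : is_derive x 1 f a -> is_derive x 1 g b ->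
  is_derive x 1 (fun t : R => f t + g t) (a + b).
Proof. exact: is_deriveD. Qed.

Lemma deriv_sub f g x a b : is_derive x 1 f a -> is_derive x 1 g b ->
  is_derive x 1 (fun t : R => f t - g t) (a - b).
Proof. exact: is_deriveB. Qed.

Lemma deriv_opp f x a : is_derive x 1 f a -> is_derive x 1 (fun t : R => - f t) (- a).
Proof. exact: is_deriveN. Qed.

Lemma deriv_mul f g x a b : is_derive x 1 f a -> is_derive x 1 g b ->
  is_derive x 1 (fun t : R => f t * g t) (a * g x + f x * b).
Proof.
move=> fa gb; apply: (is_derive_eq (is_deriveM fa gb)).
by rewrite /GRing.scale /= addrC [X in X + _]mulrC.
Qed.

Lemma deriv_cst c x : is_derive x 1 (fun _ : R => c) (0 : R).
Proof. exact: is_derive_cst. Qed.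

Lemma deriv_id x : is_derive x 1 (fun t : R => t) (1 : R).
Proof. exact: is_derive_id. Qed.

Lemma deriv_mull c f x a : is_derive x 1 f a ->
  is_derive x 1 (fun t : R => c * f t) (c * a).
Proof.
by move=> fa; apply: (is_derive_eq (deriv_mul (deriv_cst c x) fa)); rewrite mul0r add0r.
Qed.

Lemma deriv_comp f g x a b : is_derive (g x) 1 f a -> is_derive x 1 g b ->
  is_derive x 1 (fun t : R => f (g t)) (a * b).
Proof. exact: is_derive1_comp. Qed.

Lemma deriv_expr m x : is_derive x 1 (fun t : R => t ^+ m) (m%:R * x ^+ m.-1).
Proof.
elim: m => [|m IH]; first by rewrite mul0r; exact: deriv_cst.
under [X in is_derive _ _ X]eq_fun do rewrite exprS.
apply: (is_derive_eq (deriv_mul (deriv_id x) IH)).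
case: m {IH} => [|m]; first by rewrite /= expr0; ring.
by rewrite /= !exprS -[m.+2]addn1 natrD; ring.
Qed.

Lemma deriv_inv f x a : f x != 0 -> is_derive x 1 f a ->
  is_derive x 1 (fun t : R => (f t)^-1) (- a / f x ^+ 2).
Proof.
move=> fx0 fa; have h : is_derive x 1 (fun t : R => (f t)^-1) (- f x ^- 2 *: a).
  exact: is_deriveV.
by apply: (is_derive_eq h); rewrite /GRing.scale /= mulNr mulNr mulrC.
Qed.

Lemma deriv_cont f x a : is_derive x 1 f a -> {for x, continuous f}.
Proof. by move=> [fa _]; exact/differentiable_continuous/derivable1_diffP. Qed.

Lemma mean_value f df a b : a < b ->
  (forall x, a <= x <= b -> is_derive x 1 f (df x)) ->
  exists2 c, a < c < b & f b - f a = df c * (b - a).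
Proof.
move=> ab fd; have [||c cab ->] := @MVT _ f df a b ab.
- by move=> x /[!in_itv]/= /andP[ax xb]; apply: fd; rewrite !ltW.
- apply/derivable_within_continuous => x /[!in_itv]/= xab.
  by have [] := fd _ xab.
- by exists c => //; move: cab; rewrite in_itv.
Qed.

Lemma nondecr_of_deriv f df a b : a <= b ->
  (forall x, a <= x <= b -> is_derive x 1 f (df x)) ->
  (forall x, a < x < b -> 0 <= df x) -> f a <= f b.
Proof.
rewrite le_eqVlt => /predU1P[-> //|ab] fd df0.
have [c cab e] := mean_value ab fd.
by rewrite -subr_ge0 e mulr_ge0 ?df0// subr_ge0 ltW.
Qed.

Lemma incr_of_deriv f df a b : a < b ->
  (forall x, a <= x <= b -> is_derive x 1 f (df x)) ->
  (forall x, a < x < b -> 0 < df x) -> f a < f b.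
Proof.
move=> ab fd df0; have [c cab e] := mean_value ab fd.
by rewrite -subr_gt0 e mulr_gt0 ?df0// subr_gt0.
Qed.

Lemma nonincr_of_deriv f df a b : a <= b ->
  (forall x, a <= x <= b -> is_derive x 1 f (df x)) ->
  (forall x, a < x < b -> df x <= 0) -> f b <= f a.
Proof.
move=> ab fd df0; rewrite -lerN2.
apply: (@nondecr_of_deriv (fun t : R => - f t) (fun t : R => - df t)) => // x xab.
- exact/deriv_opp/fd.
- by rewrite oppr_ge0; exact: df0.
Qed.

Lemma lim0P f l : f x @[x --> 0^'+] --> l <->
  forall e, 0 < e -> exists2 d : R, 0 < d & forall r, 0 < r < d -> `|f r - l| < e.
Proof.
split=> [/cvgrPdist_lt fl e e0|fl].
  have := fl e e0; rewrite near_withinE => -[d /= d0 dP].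
  exists d => // r /andP[r0 rd]; rewrite distrC; apply: dP => //.
  by rewrite /ball_ /= sub0r normrN gtr0_norm.
apply/cvgrPdist_lt => e e0; have [d d0 dP] := fl e e0.
near=> s; rewrite distrC; apply: dP; apply/andP; split; near: s.
- exact: nbhs_right_gt.
- exact: nbhs_right_lt.
Unshelve. all: by end_near. Qed.

Lemma lim0_ge f l C r : 0 < r -> f x @[x --> 0^'+] --> l ->
  (forall s, 0 < s < r -> C <= f s) -> C <= l.
Proof.
move=> r0 /lim0P fl fC; rewrite leNgt; apply/negP => lC.
have [d d0 dP] := fl (C - l) ltac:(lra).
pose s := Num.min d r / 2.
have m0 : 0 < Num.min d r by rewrite lt_min d0 r0.
have [md mr] : Num.min d r <= d /\ Num.min d r <= r by rewrite !ge_min !lexx orbT.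
have := fC s ltac:(rewrite /s; apply/andP; split; lra).
have := dP s ltac:(rewrite /s; apply/andP; split; lra).
by rewrite ltr_norml => /andP[_]; lra.
Qed.

Lemma lim0_le f l C r : 0 < r -> f x @[x --> 0^'+] --> l ->
  (forall s, 0 < s < r -> f s <= C) -> l <= C.
Proof.
move=> r0 fl fC; rewrite -lerN2.
apply: (@lim0_ge (fun t : R => - f t) _ _ r) => //; first exact: cvgN.
by move=> s /fC; rewrite lerN2.
Qed.

Lemma lim0_expr m : (x ^+ m.+1 : R) @[x --> 0^'+] --> (0 : R).
Proof.
have := deriv_cont (deriv_expr m.+1 0).
by rewrite /prop_for /continuous_at expr0n /= => /cvg_at_right_filter.
Qed.

Lemma first_zero f a b : a < b -> (forall x, a <= x <= b -> {for x, continuous f}) ->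
  0 < f a -> f b <= 0 ->
  exists2 c, a < c <= b & f c = 0 /\ forall x, a <= x < c -> 0 < f x.
Proof.
move=> ab fc fa fb.
pose S := [set x | a <= x <= b /\ f x <= 0].
have Sb : S b by split=> //; rewrite lexx ltW.
have Slb : lbound S a by move=> x [/andP[]].
have Sinf : has_inf S by split; [exists b|exists a].
pose c := inf S.
have ac : a <= c by exact: (lb_le_inf Sinf.1 Slb).
have cb : c <= b by exact: (ge_inf Sinf.2 Sb).
have below x : a <= x < c -> 0 < f x.
  move=> /andP[ax xc]; rewrite ltNge; apply/negP => fx.
  have : S x by split=> //; rewrite ax /= (le_trans (ltW xc) cb).
  by move=> /(ge_inf Sinf.2); rewrite leNgt xc.
have fcc : {for c, continuous f} by apply: fc; rewrite ac cb.
have fc_le : f c <= 0.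
  rewrite leNgt; apply/negP => fc0.
  have := fcc; move=> /cvgrPdist_lt /(_ _ fc0) [d /= d0 dP].
  have [x Sx xcd] := inf_adherent d0 Sinf.
  have cx : c <= x by exact: (ge_inf Sinf.2 Sx).
  have := dP x; rewrite /ball_ /= distrC ger0_norm ?subr_ge0// ltrBlDl => /(_ xcd).
  case: Sx => _ fx0 h; have := ler_norm (f c - f x); lra.
have ac' : a < c.
  by rewrite lt_neqAle ac andbT; apply/eqP => e; move: fc_le; rewrite -e leNgt fa.
exists c; first by rewrite ac' cb.
split=> //; apply/eqP; rewrite eq_le fc_le /= leNgt; apply/negP => fc0.
have := fcc; move=> /cvgrPdist_lt /(_ (- f c)); rewrite oppr_gt0 => /(_ fc0) [d /= d0 dP].
pose x := Num.max a (c - d / 2).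
have xc : x < c by rewrite gt_max ac' /=; lra.
have ax : a <= x by rewrite le_max lexx.
have cdx : c - d / 2 <= x by rewrite le_max lexx orbT.
have fx := below x; rewrite ax xc in fx.
have {}fx := fx isT.
have := dP x; rewrite /ball_ /= ger0_norm; last by lra.
have lt: c - x < d by lra.
move=> /(_ lt); have := ler_norm (- (f c - f x)); rewrite normrN; lra.
Qed.

Lemma deriv_eq_near f g x e a : 0 < e -> (forall y, `|y - x| < e -> f y = g y) ->
  is_derive x 1 f a -> is_derive x 1 g a.
Proof.
move=> e0 fg; apply: near_eq_is_derive.
by exists e => //= y; rewrite /ball_ /= distrC => /fg.
Qed.

Lemma deriv_unique f x a b : is_derive x 1 f a -> is_derive x 1 f b -> a = b.
Proof. by move=> [_ <-] [_ <-]. Qed.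

Lemma deriv_epsP f x a : is_derive x 1 f a <->
  forall e, 0 < e -> exists2 d : R, 0 < d & forall y, `|y - x| < d ->
    `|f y - f x - (y - x) * a| <= e * `|y - x|.
Proof.
rewrite is_derive1_caratheodory; split=> [[g [fg gc gx]] e e0|H].
  have /cvgrPdist_le/(_ e e0)[d /= d0 dP] := gc.
  exists d => // y yx; rewrite fg -gx -[X in X - _]mulrC -mulrBr normrM mulrC.
  rewrite ler_wpM2r// distrC; apply: dP.
  by rewrite /ball_ /= distrC.
exists (fun z => if z == x then a else (f z - f x) / (z - x)); split.
- move=> z; case: eqP => [->|/eqP zx]; first by rewrite !subrr mulr0.
  by rewrite divfK// subr_eq0.
- apply/cvgrPdist_le => e e0; have [d d0 dP] := H e e0.
  rewrite eqxx; exists d => //= y; rewrite /ball_ /= distrC => yd.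
  case: eqP => [_|/eqP yx]; first by rewrite subrr normr0 ltW.
  have yx0 : y - x != 0 by rewrite subr_eq0.
  have -> : a - (f y - f x) / (y - x) = - ((f y - f x - (y - x) * a) / (y - x)).
    by field.
  by rewrite normrN normrM normfV ler_pdivrMr ?normr_gt0// dP.
- by rewrite eqxx.
Qed.

End Calculus.

(** * The radial initial value problem *)

Section Radial.
Variables (R : realType) (n : nat).
Hypothesis n_gt0 : (0 < n)%N.
Implicit Types (g F u v : R -> R) (a b beta r t s x y e d M B C : R).

Record sol g a u v : Prop := Sol {
  sol_u : forall r, 0 < r -> is_derive r 1 u (- v r);
  sol_v : forall r, 0 < r -> is_derive r 1 v (g (u r) - n%:R * v r / r);
  sol_u0 : u x @[x --> 0^'+] --> a;
  sol_v0 : v x @[x --> 0^'+] --> (0 : R) }.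

Definition energy F u v r := v r ^+ 2 / 2 + F (u r).

Lemma flux_deriv c v r : 0 < r -> is_derive r 1 v (c - n%:R * v r / r) ->
  is_derive r 1 (fun t : R => t ^+ n * v t) (r ^+ n * c).
Proof.
move=> r0 dv; apply: (is_derive_eq (deriv_mul (deriv_expr n r) dv)).
have -> : r ^+ n = r * r ^+ n.-1 by rewrite -exprS prednK.
by field; rewrite gt_eqF.
Qed.

Lemma flux_lim g a u v : sol g a u v -> (x ^+ n * v x) @[x --> 0^'+] --> (0 : R).
Proof.
move=> s.
have h : (x ^+ n * v x) @[x --> 0^'+] --> (0 * 0 : R).
  apply: cvgM; last exact: sol_v0 s.
  by rewrite -(prednK n_gt0); exact: lim0_expr.
by rewrite mulr0 in h.
Qed.

Lemma flux_le g a u v B r : sol g a u v -> 0 < r ->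
  (forall t, 0 < t < r -> g (u t) <= B) -> v r <= B * r / n.+1%:R.
Proof.
move=> s r0 gB.
pose f t := t ^+ n * v t - B / n.+1%:R * t ^+ n.+1.
have fd (t : R) : 0 < t -> is_derive t 1 f (t ^+ n * (g (u t) - B)).
  move=> t0; apply: (is_derive_eq (deriv_sub (flux_deriv t0 (sol_v s t0))
    (deriv_mull _ (deriv_expr n.+1 t)))).
  by rewrite /=; field; rewrite addrC natr1 pnatr_eq0.
have fl : f x @[x --> 0^'+] --> (0 - B / n.+1%:R * 0).
  apply: cvgB; first exact: flux_lim s.
  by apply: cvgMr; exact: lim0_expr.
rewrite mulr0 subr0 in fl.
have fr : f r <= 0.
  apply: (lim0_ge r0 fl) => t /andP[t0 tr].
  apply: (nonincr_of_deriv (ltW tr)) => x /andP[tx xr].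
    by apply: fd; exact: lt_le_trans t0 tx.
  have x0 : 0 < x by exact: lt_trans t0 tx.
  apply: mulr_ge0_le0; first by rewrite exprn_ge0// ltW.
  by rewrite subr_le0 gB// x0.
move: fr; rewrite /f subr_le0 exprS.
have -> : B / n.+1%:R * (r * r ^+ n) = r ^+ n * (B * r / n.+1%:R) by ring.
by rewrite ler_pM2l// exprn_gt0.
Qed.

Lemma sol_oppr g a u v : sol g a u v ->
  sol (fun s => - g (- s)) (- a) (fun t : R => - u t) (fun t : R => - v t).
Proof.
move=> s; split=> [r r0|r r0||].
- exact (deriv_opp (sol_u s r0)).
- apply: (is_derive_eq (deriv_opp (sol_v s r0))).
  by rewrite opprK; ring.
- by apply: cvgN; exact: sol_u0 s.
- by rewrite -[X in _ --> X]oppr0; apply: cvgN; exact: sol_v0 s.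
Qed.

Lemma flux_ge g a u v B r : sol g a u v -> 0 < r ->
  (forall t, 0 < t < r -> B <= g (u t)) -> B * r / n.+1%:R <= v r.
Proof.
move=> s r0 gB; rewrite -lerN2.
rewrite (_ : - (B * r / _) = (- B) * r / n.+1%:R); last by ring.
by apply: (flux_le (sol_oppr s) r0) => t tr; rewrite opprK lerN2 gB.
Qed.

Lemma flux_pos g a u v r : sol g a u v -> 0 < r ->
  (forall t, 0 < t < r -> 0 < g (u t)) -> 0 < v r.
Proof.
move=> s r0 gB.
have r20 : 0 < r / 2 by lra.
have h : 0 <= v (r / 2).
  have := @flux_ge g a u v 0 _ s r20; rewrite !mul0r; apply.
  by move=> t /andP[t0 tr]; rewrite ltW// gB// t0; lra.
have : (r / 2) ^+ n * v (r / 2) < r ^+ n * v r.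
  apply: (@incr_of_deriv _ (fun t : R => t ^+ n * v t) (fun t : R => t ^+ n * g (u t))); first lra.
  - move=> x /andP[x0 _]; have {}x0 : 0 < x by lra.
    exact: flux_deriv x0 (sol_v s x0).
  - move=> x /andP[x0 xr]; rewrite mulr_gt0 ?exprn_gt0 ?gB//; [lra|].
    by apply/andP; split=> //; lra.
move=> h2; have : 0 < r ^+ n * v r.
  by apply: le_lt_trans h2; rewrite mulr_ge0// exprn_ge0// ltW.
by rewrite pmulr_rgt0// exprn_gt0.
Qed.

Lemma speed_bound g a u v M r : sol g a u v -> (forall s, `|g s| <= M) -> 0 < r ->
  `|v r| <= M * r / n.+1%:R.
Proof.
move=> s gM r0; rewrite ler_norml; apply/andP; split.
- rewrite (_ : - (M * r / _) = (- M) * r / n.+1%:R); last by ring.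
  by apply: (flux_ge s r0) => t _; have := gM (u t); rewrite ler_norml => /andP[].
- by apply: (flux_le s r0) => t _; have := gM (u t); rewrite ler_norml => /andP[].
Qed.

Lemma value_nonincr g a u v r r' : sol g a u v -> 0 < r -> r <= r' ->
  (forall t, r < t < r' -> 0 <= v t) -> u r' <= u r.
Proof.
move=> s r0 rr' v0; apply: (@nonincr_of_deriv _ u (fun t : R => - v t)) => //.
- by move=> x /andP[rx _]; apply: sol_u s _ _; exact: lt_le_trans r0 rx.
- by move=> x xr; rewrite oppr_le0 v0.
Qed.

Lemma value_le_init g a u v r : sol g a u v -> 0 < r ->
  (forall t, 0 < t < r -> 0 <= v t) -> u r <= a.
Proof.
move=> s r0 v0; apply: (lim0_ge r0 (sol_u0 s)) => t /andP[t0 tr].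
apply: (value_nonincr s t0 (ltW tr)) => x /andP[tx xr].
by apply: v0; rewrite xr (lt_trans t0 tx).
Qed.

Lemma value_bound g a u v M r : sol g a u v -> (forall s, `|g s| <= M) -> 0 < r ->
  `|u r - a| <= M * r ^+ 2.
Proof.
move=> s gM r0.
have M0 : 0 <= M by exact: le_trans (normr_ge0 _) (gM 0).
have key t : 0 < t < r -> `|u r - u t| <= M * r ^+ 2.
  move=> /andP[t0 tr].
  have [x xtr|c /andP[tc cr] ->] := @mean_value _ u (fun t : R => - v t) _ _ tr.
    by apply: sol_u s _ _; case/andP: xtr => tx _; exact: lt_le_trans t0 tx.
  rewrite normrM normrN (gtr0_norm (_ : 0 < r - t)) ?subr_gt0//.
  have c0 : 0 < c by exact: lt_trans tc.
  have h := speed_bound s gM c0.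
  rewrite expr2 mulrA; apply: ler_pM => //; first by rewrite subr_ge0 ltW.
    apply: (le_trans h); rewrite ler_pdivrMr ?ltr0n//.
    rewrite -mulrA ler_wpM2l//.
    by apply: (le_trans (ltW cr)); apply: ler_peMr; [exact: ltW|rewrite ler1n].
  by lra.
have l : `|u r - u x| @[x --> 0^'+] --> `|u r - a|.
  by apply: cvg_norm; apply: cvgB; [exact: cvg_cst|exact: sol_u0 s].
exact: (lim0_le r0 l).
Qed.

Section Energy.
Variables (g F : R -> R).
Hypothesis F_prim : forall s, is_derive s 1 F (g s).

Lemma energy_deriv a u v r : sol g a u v -> 0 < r ->
  is_derive r 1 (energy F u v) (- (n%:R * v r ^+ 2 / r)).
Proof.
move=> s r0.
have d1 := deriv_mul (sol_v s r0) (sol_v s r0).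
have d2 := deriv_comp (F_prim (u r)) (sol_u s r0).
have d := deriv_add (deriv_mull (1 / 2) d1) d2.
have -> : energy F u v = (fun t : R => 1 / 2 * (v t * v t) + F (u t)).
  by apply/funext => t; rewrite /energy; ring.
by apply: (is_derive_eq d); field; rewrite gt_eqF.
Qed.

Lemma energy_nonincr a u v r r' : sol g a u v -> 0 < r -> r <= r' ->
  energy F u v r' <= energy F u v r.
Proof.
move=> s r0 rr'; apply: (nonincr_of_deriv rr') => x /andP[rx _].
  by apply: (energy_deriv s); exact: lt_le_trans rx.
have x0 : 0 < x by exact: lt_trans rx.
rewrite oppr_le0; apply: divr_ge0; last exact: ltW.
by apply: mulr_ge0 => //; exact: sqr_ge0.
Qed.

Lemma energy_lim a u v : sol g a u v -> energy F u v x @[x --> 0^'+] --> F a.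
Proof.
move=> s; suff : energy F u v x @[x --> 0^'+] --> 0 + F a by rewrite add0r.
apply: cvgD.
  have : (v x * v x * 2^-1) @[x --> 0^'+] --> (0 * 0 * 2^-1 : R).
    by apply: cvgMl; apply: cvgM; exact: sol_v0 s.
  by rewrite !mul0r; under eq_fun do rewrite -expr2.
apply: continuous_cvg; last exact: sol_u0 s.
exact: deriv_cont (F_prim a).
Qed.

Lemma energy_le a u v r : sol g a u v -> 0 < r -> energy F u v r <= F a.
Proof.
move=> s r0; apply: (lim0_ge r0 (energy_lim s)) => t /andP[t0 tr].
by apply: (energy_nonincr s) => //; exact: ltW.
Qed.

End Energy.

Lemma potential_le_energy F u v r : F (u r) <= energy F u v r.
Proof. by rewrite lerDr divr_ge0// sqr_ge0. Qed.

Lemma no_uniform_speed g a u v d r1 : sol g a u v -> 0 < d -> 0 < r1 ->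
  (forall r, 0 < r -> 0 <= u r) -> ~ (forall r, r1 <= r -> d <= v r).
Proof.
move=> s d0 r10 u0 vd.
pose r := r1 + (u r1 + 1) / d.
have r1r : r1 < r.
  by rewrite ltrDl divr_gt0//; have := u0 r1 r10; lra.
have [x xr|c /andP[tc cr] e] := @mean_value _ u (fun t : R => - v t) _ _ r1r.
  by apply: sol_u s _ _; case/andP: xr => ? _; exact: lt_le_trans r10 _.
have ur : u r - u r1 <= - (u r1 + 1).
  have -> : u r - u r1 = - (v c * ((u r1 + 1) / d)) by rewrite e /r; ring.
  rewrite lerN2 mulrA ler_pdivlMr// mulrC ler_wpM2r ?vd ?ltW//.
  by have := u0 r1 r10; lra.
have := u0 r (lt_trans r10 r1r); lra.
Qed.

End Radial.

Section Shape.
Variables (R : realType) (n : nat).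
Hypothesis n_gt0 : (0 < n)%N.
Implicit Types (g F u v : R -> R) (a b beta r t s x y e d M B C : R).

Record shape g F b beta : Prop := Shape {
  shape_cont : continuous g;
  shape_le0 : forall s, s <= 0 -> g s = 0;
  shape_leb : forall s, s <= b -> g s <= 0;
  shape_gtb : forall s, b < s -> 0 < g s;
  shape_prim : forall s, is_derive s 1 F (g s);
  shape_F_le0 : forall s, s <= 0 -> F s = 0;
  shape_F_lt : forall s, 0 < s < beta -> F s < 0;
  shape_F_beta : F beta = 0;
  shape_b_gt0 : 0 < b;
  shape_b_beta : b < beta }.

Variables (g F : R -> R) (b beta : R).
Hypothesis gF : shape g F b beta.

Lemma potential_incr s t : b <= s -> s < t -> F s < F t.
Proof.
move=> bs st; apply: (incr_of_deriv st) => x /andP[sx xt].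
  exact: shape_prim gF x.
by apply: (shape_gtb gF); exact: le_lt_trans bs sx.
Qed.

Lemma potential_gt s : beta < s -> 0 < F s.
Proof.
move=> bs; rewrite -(shape_F_beta gF); apply: potential_incr => //.
exact: ltW (shape_b_beta gF).
Qed.

Lemma potential_le s : s <= beta -> F s <= 0.
Proof.
rewrite le_eqVlt => /predU1P[->|sb]; first by rewrite (shape_F_beta gF).
case: (leP s 0) => s0; first by rewrite (shape_F_le0 gF).
by apply/ltW/(shape_F_lt gF); rewrite s0 sb.
Qed.

Lemma sol_le a u v r : sol n g a u v -> b <= a -> 0 < r -> u r <= a.
Proof.
move=> s ba r0; rewrite leNgt; apply/negP => aur.
have h1 := potential_incr ba aur.
have h2 := energy_le (shape_prim gF) s r0.
have h3 := potential_le_energy F u v r.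
lra.
Qed.

Lemma speed_pos_init a u v : sol n g a u v -> b < a ->
  exists2 d : R, 0 < d & forall r, 0 < r < d -> 0 < v r.
Proof.
move=> s ba; have /lim0P/(_ (a - b)) := sol_u0 s.
rewrite subr_gt0 => /(_ ba)[d d0 dP]; exists d => // r /andP[r0 rd].
apply: (flux_pos n_gt0 s r0) => t /andP[t0 tr]; apply: (shape_gtb gF).
have := dP t; rewrite t0 (lt_trans tr rd) => /(_ isT).
by rewrite ltr_norml => /andP[]; lra.
Qed.

(* While [u > b] the flux [r^n v] increases, so a first zero of [v] can only
   occur at a level [<= b], where the energy is nonpositive. *)
Lemma turning_point a u v r1 : sol n g a u v -> b < a -> 0 < r1 -> v r1 <= 0 ->
  exists2 r0 : R, 0 < r0 <= r1 &
    [/\ v r0 = 0, forall t, 0 < t < r0 -> 0 < v t & u r0 <= b].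
Proof.
move=> s ba r10 vr1; have [d d0 dP] := speed_pos_init s ba.
have dr1 : d <= r1.
  rewrite leNgt; apply/negP => r1d; have := dP r1.
  by rewrite r10 r1d => /(_ isT); lra.
have [||||r0 /andP[dr0 r0r1] [vr0 vpos]] := @first_zero _ v (d / 2) r1.
- lra.
- move=> x /andP[dx _]; apply: deriv_cont (sol_v s _); lra.
- by apply: dP; apply/andP; split; lra.
- exact: vr1.
have r00 : 0 < r0 by lra.
exists r0; first by rewrite r00.
have pos t : 0 < t < r0 -> 0 < v t.
  move=> /andP[t0 tr]; case: (ltP t d) => td; first by apply: dP; rewrite t0.
  by apply: vpos; rewrite tr andbT; lra.
split=> //; rewrite leNgt; apply/negP => bu.
have : 0 < v r0.
  apply: (flux_pos n_gt0 s r00) => t /andP[t0 tr]; apply: (shape_gtb gF).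
  apply: lt_le_trans bu _; apply: (value_nonincr s t0 (ltW tr)) => x /andP[tx xr].
  by apply/ltW/pos; rewrite xr (lt_trans t0 tx).
by rewrite vr0 ltxx.
Qed.

Lemma energy_le0_after a u v r1 r : sol n g a u v -> b < a -> 0 < r1 ->
  v r1 <= 0 -> r1 <= r -> energy F u v r <= 0.
Proof.
move=> s ba r10 vr1 r1r.
have [r0 /andP[r00 r0r1] [vr0 _ ur0]] := turning_point s ba r10 vr1.
apply: le_trans (energy_nonincr (shape_prim gF) s r00 (le_trans r0r1 r1r)) _.
rewrite /energy vr0 expr0n mul0r add0r; apply: potential_le.
exact: le_trans ur0 (ltW (shape_b_beta gF)).
Qed.

Lemma energy_le0_beta u v r : energy F u v r <= 0 -> u r <= beta.
Proof.
move=> E0; rewrite leNgt; apply/negP => /potential_gt.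
have := potential_le_energy F u v r; lra.
Qed.

Lemma value_stays a c u v r1 r2 : sol n g a u v -> b < a -> beta <= c ->
  0 < r1 -> u r1 <= c -> r1 <= r2 -> u r2 <= c.
Proof.
move=> s ba bc r10 uc r12.
have [[r /andP[r0 rr2] vr]|vpos] := pselect (exists2 r : R, 0 < r <= r2 & v r <= 0).
  apply: le_trans bc; apply: (@energy_le0_beta u v).
  exact: energy_le0_after s ba r0 vr rr2.
apply: le_trans uc; apply: (value_nonincr s r10 r12) => t /andP[tr1 tr2].
rewrite leNgt; apply/negP => vt; apply: vpos.
by exists t; [rewrite (lt_trans r10 tr1) ltW|rewrite ltW].
Qed.

Lemma neg_persist a u v T r : sol n g a u v -> 0 < a -> 0 < T -> u T < 0 ->
  T <= r -> u r < 0.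
Proof.
move=> s a0 T0 uT.
have [x0 x0P upos] : exists2 x : R, 0 < x < T & 0 < u x.
  have /lim0P/(_ a a0)[d d0 dP] := sol_u0 s.
  have [md mT] : Num.min d T <= d /\ Num.min d T <= T by rewrite !ge_min !lexx orbT.
  have m0 : 0 < Num.min d T by rewrite lt_min d0 T0.
  exists (Num.min d T / 2); first by apply/andP; split; lra.
  have := dP (Num.min d T / 2) ltac:(apply/andP; split; lra).
  by rewrite ltr_norml => /andP[]; lra.
have ucont x : 0 < x -> {for x, continuous u}.
  by move=> x0'; exact: deriv_cont (sol_u s x0').
have [||||c /andP[c0 cT] [uc cneg]] :=
  @first_zero _ (fun t : R => - u (T - t)) 0 (T - x0).
- by rewrite subr_gt0; case/andP: x0P.
- move=> x /andP[x0' xT].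
  have p : 0 < T - x by case/andP: x0P; lra.
  have dT : is_derive x 1 (fun t : R => T - t) (0 - 1).
    exact: (deriv_sub (deriv_cst T x) (deriv_id x)).
  exact: deriv_cont (deriv_opp (@deriv_comp _ u (fun t : R => T - t) _ _ _ (sol_u s p) dT)).
- by rewrite subr0 oppr_gt0.
- by rewrite opprB addrC subrK oppr_le0 ltW.
have Tc0 : 0 < T - c by case/andP: x0P; lra.
have TcT : T - c < T by lra.
have [x xr|xi /andP[cxi xiT] e] := @mean_value _ u (fun t : R => - v t) _ _ TcT.
  by apply: sol_u s _ _; case/andP: xr => h _; exact: lt_le_trans h.
have vxi : 0 < v xi.
  have e2 : u T = - v xi * c by move: e uc; lra.
  by move: uT; rewrite e2 mulNr oppr_lt0 pmulr_lgt0.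
have xi0 : 0 < xi by lra.
have uneg t : T - c < t <= T -> u t < 0.
  move=> /andP[t1 t2]; have := cneg (T - t) ltac:(apply/andP; split; lra).
  by rewrite opprB addrC subrK oppr_gt0.
move=> Tr; rewrite ltNge; apply/negP => ur.
have Tr' : T < r.
  rewrite lt_neqAle Tr andbT; apply/eqP => er; move: ur; rewrite -er; lra.
have [||||r2 /andP[Tr2 r2r] [ur2 r2neg]] := @first_zero _ (fun t : R => - u t) T r.
- exact: Tr'.
- move=> x /andP[Tx _]; apply: deriv_cont (deriv_opp (sol_u s _)).
  exact: lt_le_trans Tx.
- by rewrite oppr_gt0.
- by rewrite oppr_le0.
have vpos t : xi <= t < r2 -> 0 <= v t.
  move=> /andP[xit tr2]; have t0 : 0 < t by exact: lt_le_trans xit.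
  have : xi ^+ n * v xi <= t ^+ n * v t.
    apply: (@nondecr_of_deriv _ (fun t : R => t ^+ n * v t) (fun x : R => x ^+ n * g (u x))) => //.
      move=> x /andP[xx _]; have x0' := lt_le_trans xi0 xx.
      exact: flux_deriv (sol_v s x0').
    move=> x /andP[xx xt]; rewrite (shape_le0 gF) ?mulr0// ltW//.
    case: (leP x T) => xT; first by apply: uneg; rewrite xT andbT; lra.
    by rewrite -oppr_gt0; apply: r2neg; apply/andP; split; lra.
  move=> h; have : 0 <= t ^+ n * v t.
    by apply: le_trans h; rewrite mulr_ge0 ?exprn_ge0// ltW.
  by rewrite pmulr_rge0// exprn_gt0.
have : u r2 <= u T.
  apply: (value_nonincr s T0 (ltW Tr2)) => t /andP[Tt tr2]; apply: vpos.
  by rewrite tr2 andbT; lra.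
lra.
Qed.

Lemma energy_ge0_crossing a u v T r : sol n g a u v -> 0 < a -> 0 < T -> u T < 0 ->
  0 < r -> 0 <= energy F u v r.
Proof.
move=> s a0 T0 uT r0.
have base x : u x <= 0 -> 0 <= energy F u v x.
  by move=> ux; rewrite /energy (shape_F_le0 gF ux) addr0 divr_ge0// sqr_ge0.
case: (leP (u r) 0) => [/base //|ur].
case: (leP T r) => [Tr|rT]; first by have := neg_persist s a0 T0 uT Tr; lra.
have [||||c /andP[rc cT] [uc _]] := @first_zero _ u r T => //.
- by move=> x /andP[rx _]; apply: deriv_cont (sol_u s _); exact: lt_le_trans rx.
- exact: ltW.
apply: le_trans (energy_nonincr (shape_prim gF) s r0 (ltW rc)).
by apply: base; rewrite uc.
Qed.

Lemma reaches_below_beta a u v : sol n g a u v ->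
  b < a -> (forall r, 0 < r -> 0 < v r) -> (forall r, 0 < r -> 0 <= u r) ->
  exists2 r : R, 0 < r & u r < beta.
Proof.
move=> s ba vpos upos; apply: contrapT => H.
have ub r : 0 < r -> beta <= u r.
  by move=> r0; rewrite leNgt; apply/negP => ur; apply: H; exists r.
have ba' : beta <= a by have := sol_le s (ltW ba) ltr01; have := ub _ ltr01; lra.
have [|m /[!in_itv]/= /andP[m1 m2] mP] := @EVT_min _ g beta a ba'.
  by apply: continuous_subspaceT; exact: shape_cont gF.
have gm : 0 < g m by apply: (shape_gtb gF); have := shape_b_beta gF; lra.
have vlow r : 1 <= r -> g m / n.+1%:R <= v r.
  move=> r1; have r0 : 0 < r by lra.
  have h : g m * r / n.+1%:R <= v r.
    apply: (flux_ge n_gt0 s r0) => t /andP[t0 tr]; apply: mP.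
    by rewrite in_itv /= ub// (sol_le s (ltW ba)).
  by apply: le_trans h; rewrite mulrAC ler_peMr// divr_ge0// ltW.
exact: (no_uniform_speed s (divr_gt0 gm (ltr0Sn R n)) ltr01 upos vlow).
Qed.

Lemma good_decays a u v : sol n g a u v -> b < a ->
  (forall r, 0 < r -> 0 <= u r) -> (forall r, 0 < r -> 0 <= energy F u v r) ->
  (forall r, 0 < r -> 0 <= v r) /\
  (forall e, 0 < e -> exists2 r1 : R, 0 < r1 & forall r, r1 <= r -> u r < e).
Proof.
move=> s ba upos Epos.
have [[r1 r10 vr1]|H] := pselect (exists2 r : R, 0 < r & v r <= 0).
  have [r0 /andP[r00 r0r1] [vr0 vpos ur0]] := turning_point s ba r10 vr1.
  have Ez r : r0 <= r -> energy F u v r = 0.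
    move=> rr; apply/eqP; rewrite eq_le Epos ?andbT; last exact: lt_le_trans rr.
    by apply: (energy_le0_after s ba r00) => //; rewrite vr0.
  have u0 : u r0 = 0.
    have := Ez r0 (lexx _); rewrite /energy vr0 expr0n mul0r add0r => F0.
    have := upos r0 r00; rewrite le_eqVlt => /predU1P[//|up].
    have := @shape_F_lt _ _ _ _ gF (u r0); rewrite up => /(_ _) h.
    by have := h ltac:(have := shape_b_beta gF; lra); lra.
  have v0 r : r0 < r -> v r = 0.
    move=> rr; have rpos := lt_trans r00 rr.
    have d1 := energy_deriv (shape_prim gF) s rpos.
    have d2 : is_derive r 1 (energy F u v) (0 : R).
      apply: (@deriv_eq_near _ (fun=> 0) _ _ (r - r0)); first by rewrite subr_gt0.
        by move=> y; rewrite ltr_norml => /andP[h _]; rewrite Ez//; lra.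
    have /eqP := deriv_unique d1 d2.
    rewrite oppr_eq0 mulf_eq0 invr_eq0 (gt_eqF rpos) orbF mulf_eq0 pnatr_eq0.
    by rewrite gtn_eqF//= expf_eq0/= => /eqP.
  have vnn r : 0 < r -> 0 <= v r.
    move=> rpos; case: (ltgtP r r0) => [rr|/v0->//|->]; last by rewrite vr0.
    by apply/ltW/vpos; rewrite rpos.
  split=> // e e0; exists r0 => // r rr; apply: le_lt_trans e0.
  rewrite -u0; apply: (value_nonincr s r00 rr) => t /andP[tr0 _].
  by apply: vnn; exact: lt_trans tr0.
have vpos r : 0 < r -> 0 < v r.
  by move=> r0; rewrite ltNge; apply/negP => vr; apply: H; exists r.
split=> [r /vpos/ltW//|e e0]; apply: contrapT => K.
have ue r : 0 < r -> e <= u r.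
  move=> r0; rewrite leNgt; apply/negP => ure; apply: K; exists r => // r' rr'.
  apply: le_lt_trans ure; apply: (value_nonincr s r0 rr') => t /andP[tr _].
  by apply/ltW/vpos; exact: lt_trans tr.
have [r1 r10 ur1] := reaches_below_beta s ba vpos upos.
have [|m /[!in_itv]/= /andP[m1 m2] mP] := @EVT_max _ F e (u r1) (ue _ r10).
  apply: continuous_subspaceT => x; exact: deriv_cont (shape_prim gF x).
have Fm : F m < 0.
  by apply: (shape_F_lt gF); rewrite (lt_le_trans e0 m1) (le_lt_trans m2 ur1).
have d0 : 0 < Num.min 1 (- (2 * F m)) by rewrite lt_min ltr01/=; lra.
apply: (no_uniform_speed s d0 r10 upos) => r rr.
have rpos := lt_le_trans r10 rr.
have Fu : F (u r) <= F m.
  apply: mP; rewrite in_itv /= ue//=.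
  apply: (value_nonincr s r10 rr) => t /andP[tr _].
  by apply/ltW/vpos; exact: lt_trans tr.
have := Epos r rpos; rewrite /energy => Er.
rewrite ge_min; case: (leP 1 (v r)) => //= v1.
have := vpos r rpos; nra.
Qed.

End Shape.

(** * Existence and compactness of solutions *)

Section Ultra.
Variables (R : realType) (U : set_system nat).
Context {UF : UltraFilter U}.
Hypothesis U_infty : forall m, \forall k \near U, (m <= k)%N.
Implicit Types (x y : nat -> R) (C l : R).

Lemma ultra_bounded_cvg x C : (\forall k \near U, `|x k| <= C) ->
  exists l : R, x k @[k --> U] --> l.
Proof.
move=> xC.
have [|l [_ lcl]] := @segment_compact R (- C) C (x k @[k --> U]) _.
  by near=> k; rewrite /= in_itv /= -ler_norml; near: k.
exists l => V Vl; have [//|] := in_ultra_setVsetC (x @^-1` V) UF.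
move=> nV; have /(_ (~` V) V)[] := lcl => //.
by move=> z [].
Unshelve. all: by end_near. Qed.

Lemma ultra_inv : ((k.+1%:R)^-1 : R) @[k --> U] --> (0 : R).
Proof.
apply/cvgrPdist_lt => e e0.
near=> k; rewrite sub0r normrN ger0_norm ?invr_ge0//.
rewrite invf_plt ?posrE ?ltr0n//.
have : (Num.trunc e^-1 < k.+1)%N by rewrite ltnS; near: k; exact: U_infty.
by rewrite truncn_lt_nat ?invr_ge0 ?ltW.
Unshelve. all: by end_near. Qed.

End Ultra.

Section Compactness.
Variables (R : realType) (n : nat) (U : set_system nat).
Hypothesis n_gt0 : (0 < n)%N.
Context {UF : UltraFilter U}.
Implicit Types (g u v : R -> R) (a r e C M : R).

Lemma limit_of_approx g a (u_ p_ : nat -> R -> R) C M :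
  continuous g ->
  (forall r e, 0 < r -> 0 < e -> \forall k \near U, `|u_ k r - a| <= C * r ^+ 2 + e) ->
  (forall r e, 0 < r -> 0 < e -> \forall k \near U, `|p_ k r| <= M * r ^+ n.+1 + e) ->
  (forall r e, 0 < r -> 0 < e -> exists2 d : R, 0 < d & forall r', 0 < r' ->
     `|r' - r| < d -> forall e', 0 < e' -> \forall k \near U,
     `|u_ k r' - u_ k r + (r' - r) * (p_ k r / r ^+ n)| <= e * `|r' - r| + e') ->
  (forall r e, 0 < r -> 0 < e -> exists2 d : R, 0 < d & forall r', 0 < r' ->
     `|r' - r| < d -> forall e', 0 < e' -> \forall k \near U,
     `|p_ k r' - p_ k r - (r' - r) * (r ^+ n * g (u_ k r))| <= e * `|r' - r| + e') ->
  exists u v, sol n g a u v /\ forall r, 0 < r ->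
    (u_ k r @[k --> U] --> u r) /\ (p_ k r / r ^+ n @[k --> U] --> v r).
Proof.
move=> gc Hu Hp Hdu Hdp.
have uE r : exists l : R, 0 < r -> u_ k r @[k --> U] --> l.
  case: (ltP 0 r) => r0; last by exists 0.
  have [|l lP] := @ultra_bounded_cvg R U _ (u_ ^~ r) (`|a| + (C * r ^+ 2 + 1)).
    apply: filterS (Hu r 1 r0 ltr01) => k uk.
    by rewrite -[u_ k r](addrNK a) addrC (le_trans (ler_normD _ _))// lerD2l.
  by exists l.
have pE r : exists l : R, 0 < r -> p_ k r @[k --> U] --> l.
  case: (ltP 0 r) => r0; last by exists 0.
  have [|l lP] := @ultra_bounded_cvg R U _ (p_ ^~ r) (M * r ^+ n.+1 + 1).
    exact: Hp.
  by exists l.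
have [u uP] := choice uE; have [p pP] := choice pE.
have slack (x y : R) : (forall e, 0 < e -> x <= y + e) -> x <= y.
  by move=> h; apply/ler_addgt0Pr.
have pb r : 0 < r -> `|p r| <= M * r ^+ n.+1.
  move=> r0; apply: slack => e e0; apply: cvgr_to_le (Hp r e r0 e0).
  by apply: cvg_norm; exact: pP.
have ub r : 0 < r -> `|u r - a| <= C * r ^+ 2.
  move=> r0; apply: slack => e e0; apply: cvgr_to_le (Hu r e r0 e0).
  by apply: cvg_norm; apply: cvgB; [exact: uP|exact: cvg_cst].
have rn0 r : 0 < r -> r ^+ n != 0 by move=> r0; rewrite expf_neq0// gt_eqF.
pose v r := p r / r ^+ n.
have vP r : 0 < r -> p_ k r / r ^+ n @[k --> U] --> v r.
  by move=> r0; apply: cvgMl; exact: pP.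
have du r : 0 < r -> is_derive r 1 u (- v r).
  move=> r0; apply/deriv_epsP => e e0.
  have [d d0 dP] := Hdu r e r0 e0.
  have [md mr] : Num.min d r <= d /\ Num.min d r <= r by rewrite !ge_min !lexx orbT.
  exists (Num.min d r); first by rewrite lt_min d0 r0.
  move=> r' rr'; have r'0 : 0 < r' by move: rr'; rewrite ltr_norml => /andP[]; lra.
  apply: slack => e' e'0; rewrite mulrN opprK.
  apply: cvgr_to_le (dP r' r'0 (lt_le_trans rr' md) e' e'0).
  apply: cvg_norm; apply: cvgD; first by apply: cvgB; exact: uP.
  by apply: cvgMr; exact: vP.
have dp r : 0 < r -> is_derive r 1 p (r ^+ n * g (u r)).
  move=> r0; apply/deriv_epsP => e e0.
  have [d d0 dP] := Hdp r e r0 e0.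
  have [md mr] : Num.min d r <= d /\ Num.min d r <= r by rewrite !ge_min !lexx orbT.
  exists (Num.min d r); first by rewrite lt_min d0 r0.
  move=> r' rr'; have r'0 : 0 < r' by move: rr'; rewrite ltr_norml => /andP[]; lra.
  apply: slack => e' e'0.
  apply: cvgr_to_le (dP r' r'0 (lt_le_trans rr' md) e' e'0).
  apply: cvg_norm; apply: cvgB; first by apply: cvgB; exact: pP.
  apply: cvgMr; apply: cvgMr; apply: continuous_cvg; first exact: gc.
  exact: uP.
have dv r : 0 < r -> is_derive r 1 v (g (u r) - n%:R * v r / r).
  move=> r0; have h := deriv_mul (dp r r0) (@deriv_inv _ (fun t : R => t ^+ n) _ _ (rn0 r r0) (deriv_expr n r)).
  apply: (is_derive_eq h); rewrite /v.
  have -> : r ^+ n = r * r ^+ n.-1 by rewrite -exprS prednK.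
  by field; rewrite expf_neq0 gt_eqF.
exists u, v; split=> [|r r0]; last by split; [exact: uP|exact: vP].
have lim_small (f : R -> R) (l K : R) (m : nat) : (0 < m)%N ->
    (forall r, 0 < r -> `|f r - l| <= K * r ^+ m) -> f (x : R) @[x --> 0^'+] --> l.
  move=> m0 fK; apply/lim0P => e e0.
  have K0 : 0 <= K.
    by have := fK 1 ltr01; rewrite expr1n mulr1; apply: le_trans.
  have := @lim0_expr R m.-1; rewrite prednK// => /lim0P/(_ (e / (K + 1))).
  rewrite divr_gt0// => [/(_ isT)[d d0 dP]|]; last lra.
  exists d => // r /[dup] rd /andP[r0 _]; apply: le_lt_trans (fK r r0) _.
  have := dP r rd; rewrite subr0 ger0_norm ?exprn_ge0 ?ltW// ltr_pdivlMr; last lra.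
  have : 0 <= r ^+ m by rewrite exprn_ge0// ltW.
  nra.
split=> //; first exact: lim_small ub.
apply: (lim_small v 0 M 1%N) => // r r0.
rewrite subr0 expr1 /v normrM normfV (gtr0_norm (exprn_gt0 n r0)).
rewrite ler_pdivrMr ?exprn_gt0// -mulrA -exprS; exact: pb.
Qed.

End Compactness.

Section Continuity2.
Variable R : realType.
Implicit Types (f g : R -> R) (r s t e d l x y : R).

Definition cont2 (phi : R -> R -> R) r l := forall e, 0 < e ->
  exists2 d : R, 0 < d & forall t s, `|t - r| < d -> `|s - l| < d ->
    `|phi t s - phi r l| < e.

Lemma cont2_of (phi : R -> R -> R) r l :
  {for (r, l), continuous (fun z : R * R => phi z.1 z.2)} -> cont2 phi r l.
Proof.
move=> /cvgrPdist_lt c e e0; have := c e e0.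
move=> [[A B] /= [/nbhs_ballP[d1 /= d10 dA] /nbhs_ballP[d2 /= d20 dB]] AB].
have [m1 m2] : Num.min d1 d2 <= d1 /\ Num.min d1 d2 <= d2 by rewrite !ge_min !lexx orbT.
exists (Num.min d1 d2); first by rewrite lt_min d10 d20.
move=> t s tr sl; rewrite distrC; apply: (AB (t, s)); split=> /=.
- by apply: dA; rewrite /ball /= distrC; exact: lt_le_trans m1.
- by apply: dB; rewrite /ball /= distrC; exact: lt_le_trans m2.
Qed.

Lemma cont2_flux g n r l : continuous g -> cont2 (fun t s => t ^+ n * g s) r l.
Proof.
move=> gc; apply: cont2_of; apply: cvgM.
- apply: (@cvg_comp _ _ _ fst (fun t : R => t ^+ n)); first exact: cvg_fst.
  exact: (deriv_cont (deriv_expr n r)).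
- by apply: (@cvg_comp _ _ _ snd g); [exact: cvg_snd|exact: gc].
Qed.

Lemma cont2_speed n r l : 0 < r -> cont2 (fun t s => - (s / t ^+ n)) r l.
Proof.
move=> r0; apply: cont2_of; apply: cvgN; apply: cvgM; first exact: cvg_snd.
apply: cvgV; first by rewrite /= expf_neq0// gt_eqF.
apply: (@cvg_comp _ _ _ fst (fun t : R => t ^+ n)); first exact: cvg_fst.
exact: (deriv_cont (deriv_expr n r)).
Qed.

Lemma mean_value_near f (df : R -> R) r d y :
  (forall x, `|x - r| < d -> is_derive x 1 f (df x)) -> `|y - r| < d ->
  exists2 c : R, `|c - r| <= `|y - r| & f y - f r = df c * (y - r).
Proof.
move=> fd yd; case: (ltgtP y r) => [yr|ry|->]; last first.
- by exists r => //; rewrite !subrr mulr0.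
- move: yd; rewrite (gtr0_norm (_ : 0 < y - r)) ?subr_gt0// => yd.
  have [x /andP[rx xy]|c /andP[rc cy] e] := @mean_value _ f df r y ry.
    by apply: fd; rewrite ger0_norm; lra.
  by exists c => //; rewrite ger0_norm; lra.
- move: yd; rewrite (ltr0_norm (_ : y - r < 0)) ?subr_lt0// => yd.
  have [x /andP[yx xr]|c /andP[yc cr] e] := @mean_value _ f df y r yr.
    by apply: fd; rewrite ler0_norm; lra.
  by exists c; [rewrite ler0_norm; lra|lra].
Qed.

Lemma half_ball r x : `|x - r| < r / 2 -> [/\ 0 < x, r / 2 < x & x <= 2 * r].
Proof. by rewrite ltr_norml => /andP[h1 h2]; split; lra. Qed.

End Continuity2.

Section LimitSol.
Variables (R : realType) (n : nat) (U : set_system nat).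
Hypothesis n_gt0 : (0 < n)%N.
Context {UF : UltraFilter U}.
Implicit Types (g u v : R -> R) (a r e C M : R).

Lemma limit_sol g (g_ u_ v_ : nat -> R -> R) a (rho e_ : nat -> R) C M :
  continuous g -> (forall k, 0 <= rho k) ->
  rho k @[k --> U] --> (0 : R) -> e_ k @[k --> U] --> (0 : R) ->
  (forall e, 0 < e -> \forall k \near U, forall s, `|g_ k s - g s| <= e) ->
  (forall k r, rho k < r -> is_derive r 1 (u_ k) (- v_ k r)) ->
  (forall k r, rho k < r ->
     is_derive r 1 (v_ k) (g_ k (u_ k r) - n%:R * v_ k r / r)) ->
  (forall k r, rho k < r -> `|g_ k (u_ k r)| <= M) ->
  (forall k r, rho k < r -> `|u_ k r - a| <= C * r ^+ 2 + e_ k) ->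
  (forall k r, rho k < r -> r ^+ n * `|v_ k r| <= M * r ^+ n.+1 + e_ k) ->
  exists u v, sol n g a u v /\ forall r, 0 < r ->
    (u_ k r @[k --> U] --> u r) /\ (v_ k r @[k --> U] --> v r).
Proof.
move=> gc rho0 rhoU eU gU du dv gM ub vb.
have rhoE r : 0 < r -> \forall k \near U, rho k < r by move=> r0; exact: cvgr_lt rhoU _ r0.
have eE e : 0 < e -> \forall k \near U, e_ k < e by move=> e0; exact: cvgr_lt eU _ e0.
pose p_ k r := r ^+ n * v_ k r.
have vpE k r : 0 < r -> p_ k r / r ^+ n = v_ k r.
  by move=> r0; rewrite /p_ mulrC mulKf// expf_neq0// gt_eqF.
have M0 : 0 <= M.
  have [k kr] : exists k, rho k < 1 by apply: (@filter_ex _ U); exact: rhoE.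
  exact: le_trans (normr_ge0 _) (gM k 1 kr).
pose V r := (M * (2 * r) ^+ n.+1 + 1) / (r / 2) ^+ n.
have near_bounds r : 0 < r -> \forall k \near U,
    [/\ rho k < r / 2 & forall t, `|t - r| < r / 2 -> `|v_ k t| <= V r].
  move=> r0; have r20 : 0 < r / 2 by lra.
  near=> k; have rk : rho k < r / 2 by near: k; exact: rhoE.
  split=> // t; rewrite ltr_norml => /andP[t1 t2].
  have t0 : 0 < t by lra.
  have h := vb k t ltac:(lra).
  have ek : e_ k < 1 by near: k; exact: eE.
  rewrite /V ler_pdivlMr ?exprn_gt0// mulrC.
  have h1 : (r / 2) ^+ n * `|v_ k t| <= t ^+ n * `|v_ k t|.
    by rewrite ler_wpM2r// lerXn2r ?nnegrE; clear -r0 t0 t1 t2; lra.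
  have h2 : M * t ^+ n.+1 <= M * (2 * r) ^+ n.+1.
    by rewrite ler_wpM2l// lerXn2r ?nnegrE; clear -r0 t0 t1 t2; lra.
  lra.
have V0 r : 0 < r -> 0 <= V r.
  move=> r0; rewrite /V divr_ge0// ?exprn_ge0//; last lra.
  by rewrite addr_ge0// mulr_ge0// exprn_ge0//; lra.
have [||||u [v [s lim]]] := @limit_of_approx R n U n_gt0 UF g a u_ p_ C M gc.
- move=> r e r0 e0; near=> k.
  have ek : e_ k < e by near: k; exact: eE.
  have rk : rho k < r by near: k; exact: rhoE.
  by apply: le_trans (ub k r rk) _; rewrite lerD2l ltW.
- move=> r e r0 e0; near=> k.
  have ek : e_ k < e by near: k; exact: eE.
  have rk : rho k < r by near: k; exact: rhoE.
  rewrite /p_ normrM (gtr0_norm (exprn_gt0 n r0)).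
  by apply: le_trans (vb k r rk) _; rewrite lerD2l ltW.
- move=> r e r0 e0.
  pose W := M + n%:R * V r / (r / 2).
  have W0 : 0 <= W.
    apply: addr_ge0 => //; apply: divr_ge0; last lra.
    by apply: mulr_ge0 => //; exact: V0.
  have [md mr] : Num.min (e / (W + 1)) (r / 2) <= e / (W + 1) /\
      Num.min (e / (W + 1)) (r / 2) <= r / 2 by rewrite !ge_min !lexx orbT.
  exists (Num.min (e / (W + 1)) (r / 2)).
    by rewrite lt_min !divr_gt0//; lra.
  move=> r' r'0 rr' e' e'0; near=> k.
  have [rk Vk] : [/\ rho k < r / 2 & forall t, `|t - r| < r / 2 -> `|v_ k t| <= V r].
    by near: k; exact: near_bounds.
  have dom t : `|t - r| < r / 2 -> rho k < t by move=> /half_ball[_ h _]; exact: lt_trans h.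
  have rr2 : `|r' - r| < r / 2 by exact: lt_le_trans mr.
  have [|c c1 ->] := @mean_value_near _ (u_ k) (fun t : R => - v_ k t) r (r / 2) r' _ rr2.
    by move=> x /dom; exact: du.
  have c2 := le_lt_trans c1 rr2.
  have [|c' c'1 e1] := @mean_value_near _ (v_ k) (fun t : R => g_ k (u_ k t) - n%:R * v_ k t / t) r (r / 2) c _ c2.
    by move=> x /dom; exact: dv.
  have c'2 := le_lt_trans c'1 c2.
  rewrite vpE//.
  have -> : - v_ k c * (r' - r) + (r' - r) * v_ k r = - (v_ k c - v_ k r) * (r' - r) by ring.
  rewrite e1 normrM normrN normrM.
  set D := `|_ - _ / c'|.
  have DW : D <= W.
    apply: le_trans (ler_normB _ _) _; apply: lerD; first exact/gM/dom.
    have [c'p /ltW c'0 _] := half_ball c'2.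
    rewrite normrM normfV (gtr0_norm c'p) normrM ger0_norm//.
    apply: ler_pM.
    - exact: mulr_ge0.
    - by rewrite invr_ge0 ltW.
    - by apply: ler_wpM2l => //; exact: Vk.
    - by rewrite lef_pV2 ?posrE// divr_gt0.
  have c3 : `|c - r| <= e / (W + 1) by apply: le_trans c1 _; exact: le_trans (ltW rr') md.
  have : D * `|c - r| <= e.
    apply: (@le_trans _ _ (W * (e / (W + 1)))); first by apply: ler_pM => //; exact: normr_ge0.
    by rewrite mulrA ler_pdivrMr ?ltr_wpDl// mulrC ler_wpM2l ?lerDl// ltW.
  by move=> h; apply: ler_wpDr; [exact: ltW|exact: ler_wpM2r].
- move=> r e r0 e0.
  have [l lP] : exists l : R, u_ k r @[k --> U] --> l.
    apply: (@ultra_bounded_cvg R U _ _ (`|a| + (C * r ^+ 2 + 1))).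
    near=> k; have rk : rho k < r by near: k; exact: rhoE.
    have ek : e_ k < 1 by near: k; exact: eE.
    have := ub k r rk; have := ler_normD (u_ k r - a) a; rewrite subrK; lra.
  have [d d0 dP] := @cont2_flux R g n r l gc (e / 4) ltac:(lra).
  pose d1 := Num.min (d / (2 * (V r + 1))) (Num.min d (r / 2)).
  have V1 : 0 < V r + 1 by have := V0 r r0; lra.
  have [m1 m2 m3] : [/\ d1 <= d / (2 * (V r + 1)), d1 <= d & d1 <= r / 2].
    by rewrite /d1 !ge_min !lexx !orbT.
  exists d1; first by rewrite /d1 !lt_min !divr_gt0// ?mulr_gt0//= d0.
  move=> r' r'0 rr' e' e'0; near=> k.
  have [rk Vk] : [/\ rho k < r / 2 & forall t, `|t - r| < r / 2 -> `|v_ k t| <= V r].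
    by near: k; exact: near_bounds.
  have dom t : `|t - r| < r / 2 -> rho k < t by move=> /half_ball[_ h _]; exact: lt_trans h.
  have rr2 : `|r' - r| < r / 2 by exact: lt_le_trans m3.
  have [|c c1 ->] := @mean_value_near _ (p_ k) (fun t : R => t ^+ n * g_ k (u_ k t)) r (r / 2) r' _ rr2.
    move=> x xr; have [x0 _ _] := half_ball xr.
    by apply: flux_deriv => //; exact/dv/dom.
  have c2 := le_lt_trans c1 rr2.
  have [c0 _ cr] := half_ball c2.
  have [|c' c'1 e1] := @mean_value_near _ (u_ k) (fun t : R => - v_ k t) r (r / 2) c _ c2.
    by move=> x /dom; exact: du.
  have c'2 := le_lt_trans c'1 c2.
  have ukl : `|u_ k r - l| < d / 2.
    by near: k; move/cvgrPdistC_lt : lP; apply; lra.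
  have ucr : `|u_ k c - u_ k r| <= d / 2.
    rewrite e1 normrM normrN.
    have h1 := Vk _ c'2.
    have h2 : `|c - r| <= d / (2 * (V r + 1)).
      by apply: le_trans c1 _; exact: le_trans (ltW rr') m1.
    apply: (@le_trans _ _ ((V r + 1) * (d / (2 * (V r + 1))))).
      apply: ler_pM => //; clear -h1; lra.
    rewrite le_eqVlt; apply/orP; left; apply/eqP; field.
    by rewrite gt_eqF.
  have q1 : `|c ^+ n * g (u_ k c) - r ^+ n * g l| < e / 4.
    apply: dP; first by apply: (le_lt_trans c1); exact: (lt_le_trans rr' m2).
    have := ler_normD (u_ k c - u_ k r) (u_ k r - l).
    rewrite addrA subrK; clear -ucr ukl; lra.
  have q2 : `|r ^+ n * g (u_ k r) - r ^+ n * g l| < e / 4.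
    apply: dP; first by rewrite subrr normr0.
    clear -ukl d0; lra.
  have q3 : `|c ^+ n * (g_ k (u_ k c) - g (u_ k c))| <= e / 2.
    rewrite normrM (ger0_norm (_ : 0 <= c ^+ n)) ?exprn_ge0 ?(ltW c0)//.
    have : `|g_ k (u_ k c) - g (u_ k c)| <= e / 2 / ((2 * r) ^+ n).
      have : forall s, `|g_ k s - g s| <= e / 2 / ((2 * r) ^+ n).
        near: k; apply: gU; rewrite !divr_gt0// exprn_gt0//; lra.
      exact.
    move=> h; apply: (@le_trans _ _ ((2 * r) ^+ n * (e / 2 / ((2 * r) ^+ n)))).
      apply: ler_pM => //; first by rewrite exprn_ge0// ltW.
      by rewrite lerXn2r// ?nnegrE; clear -cr c0 r0; lra.
    by rewrite mulrC divfK// expf_neq0// gt_eqF// mulr_gt0.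
  rewrite -[X in X - _]mulrC -mulrBr normrM mulrC.
  set x := _ - _; have : `|x| <= e.
    have -> : x = c ^+ n * (g_ k (u_ k c) - g (u_ k c)) +
       ((c ^+ n * g (u_ k c) - r ^+ n * g l) - (r ^+ n * g (u_ k r) - r ^+ n * g l)).
      by rewrite /x; ring.
    apply: le_trans (ler_normD _ _) _.
    have := ler_normB (c ^+ n * g (u_ k c) - r ^+ n * g l) (r ^+ n * g (u_ k r) - r ^+ n * g l).
    clear -q1 q2 q3; lra.
  by move=> h; apply: ler_wpDr; [exact: ltW|exact: ler_wpM2r].
exists u, v; split=> // r r0; have [uP vP] := lim r r0; split=> //.
by under eq_fun do rewrite -vpE//.
Unshelve. all: by end_near. Qed.

End LimitSol.

Section Telescope.
Variable R : realType.

Lemma telescope_bound (X : nat -> R) (c E : R) i m :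
  (forall l, (i <= l < i + m)%N -> `|X l.+1 - X l - c| <= E) ->
  `|X (i + m)%N - X i - m%:R * c| <= m%:R * E.
Proof.
elim: m => [|m IH] H; first by rewrite addn0 subrr !mul0r subr0 normr0.
have -> : X (i + m.+1)%N - X i - m.+1%:R * c =
    (X (i + m)%N - X i - m%:R * c) + (X (i + m).+1 - X (i + m)%N - c).
  by rewrite addnS -[m.+1]addn1 natrD; ring.
apply: le_trans (ler_normD _ _) _; rewrite -[m.+1]addn1 natrD mulrDl mul1r.
apply: lerD.
- by apply: IH => l /andP[il lm]; apply: H; rewrite il addnS ltnS ltnW.
- by apply: H; rewrite leq_addr addnS ltnS leqnn.
Qed.

Definition grid (h r : R) := Num.truncn (r / h).

Lemma grid_le h r : 0 < h -> 0 <= r -> (grid h r)%:R * h <= r.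
Proof.
move=> h0 r0; have rh : 0 <= r / h by rewrite divr_ge0// ltW.
by rewrite -ler_pdivlMr//; case/andP: (truncn_itv rh).
Qed.

Lemma grid_gt h r : 0 < h -> 0 <= r -> r < (grid h r).+1%:R * h.
Proof.
move=> h0 r0; have rh : 0 <= r / h by rewrite divr_ge0// ltW.
by rewrite -ltr_pdivrMr//; case/andP: (truncn_itv rh).
Qed.

Lemma grid_mono h r r' : 0 < h -> r <= r' -> (grid h r <= grid h r')%N.
Proof. by move=> h0 rr; apply: le_truncn; rewrite ler_pM2r// invr_gt0. Qed.

Lemma grid_increment (phi : R -> R -> R) (X Y : nat -> R) (sh : nat -> nat)
    (h r1 r2 T L G e d y : R) :
  0 < h -> 0 <= r1 <= r2 -> r2 <= T -> (forall l, (l <= sh l <= l.+1)%N) ->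
  0 <= L -> 0 <= e ->
  (forall l, l.+1%:R * h <= T -> `|Y l.+1 - Y l| <= h * L) ->
  (forall l, X l.+1 - X l = h * phi (l.+1%:R * h) (Y (sh l))) ->
  (r2 - r1 + h) * L <= d ->
  (y = Y (grid h r1) \/ y = Y (grid h r2)) ->
  (forall t s, r1 <= t <= r2 -> `|s - y| <= d -> `|phi t s - G| <= e) ->
  `|X (grid h r2) - X (grid h r1) - (r2 - r1) * G| <= (r2 - r1) * e + h * (e + `|G|).
Proof.
move=> h0 /andP[r10 r12] r2T shl L0 e0 YL Xphi dL yE phiG.
have r20 := le_trans r10 r12.
have := grid_le h0 r10; have := grid_gt h0 r10.
have := grid_le h0 r20; have := grid_gt h0 r20.
have := grid_mono h0 r12; move: yE.
set i := grid h r1; set j := grid h r2 => yE ij.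
move=> j1 j2 i1 i2; rewrite -natr1 mulrDl mul1r in j1; rewrite -natr1 mulrDl mul1r in i1.
have jE : j = (i + (j - i))%N by rewrite subnKC.
have jR : j%:R = i%:R + (j - i)%:R :> R by rewrite -natrD -jE.
move: jR; set m := (j - i)%N => jR.
have mh : m%:R * h <= r2 - r1 + h by move: j2; rewrite jR mulrDl; lra.
have mh2 : `|m%:R * h - (r2 - r1)| <= h.
  by move: j1 j2; rewrite jR mulrDl ler_norml => *; apply/andP; split; lra.
have Ydiff p q : (i <= p)%N -> (p <= q)%N -> (q <= j)%N -> `|Y q - Y p| <= d.
  move=> ip pq qj; have := @telescope_bound Y 0 (h * L) p (q - p)%N.
  rewrite subnKC// mulr0 subr0 => /(_ _)/le_trans-> //.
    move=> l /andP[pl lq]; rewrite subr0; apply: YL.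
    apply: le_trans r2T; apply: le_trans j2; rewrite ler_pM2r// ler_nat.
    exact: leq_trans lq qj.
  apply: le_trans dL; rewrite mulrA ler_wpM2r//.
  apply: le_trans mh; rewrite ler_pM2r// ler_nat /m; exact: leq_sub.
have Xstep l : (i <= l < i + m)%N -> `|X l.+1 - X l - h * G| <= h * e.
  rewrite -jE => /andP[il lj]; rewrite Xphi -mulrBr normrM gtr0_norm// ler_pM2l//.
  apply: phiG.
    apply/andP; split.
      apply: (@le_trans _ _ (i.+1%:R * h)); first by rewrite -natr1; lra.
      by rewrite ler_pM2r// ler_nat.
    by apply: le_trans j2; rewrite ler_pM2r// ler_nat.
  have [s1 s2] := andP (shl l).
  have si : (i <= sh l)%N by exact: leq_trans il s1.
  have sj : (sh l <= j)%N by exact: leq_trans s2 lj.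
  by case: yE => ->; [|rewrite distrC]; exact: Ydiff.
have := telescope_bound Xstep; rewrite -jE => H.
have -> : X j - X i - (r2 - r1) * G =
    (X j - X i - m%:R * (h * G)) + (m%:R * h - (r2 - r1)) * G by ring.
apply: le_trans (ler_normD _ _) _; rewrite normrM.
apply: (@le_trans _ _ ((r2 - r1 + h) * e + h * `|G|)); last by lra.
apply: lerD; last by rewrite ler_wpM2r.
by apply: le_trans H _; rewrite mulrA ler_wpM2r.
Qed.

End Telescope.

Section Euler.
Variables (R : realType) (n : nat) (g : R -> R) (M : R).
Hypothesis g_cont : continuous g.
Hypothesis g_bound : forall s, `|g s| <= M.
Implicit Types (h a r : R).

(* The flux is advanced first, so that the division by the radius happens at a
   nonzero grid point. *)
Fixpoint euler h a (j : nat) : R * R :=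
  if j is j'.+1 then
    let q := euler h a j' in
    let p := q.2 + h * ((j'.+1%:R * h) ^+ n * g q.1) in
    (q.1 - h * (p / (j'.+1%:R * h) ^+ n), p)
  else (a, 0).

Let M_ge0 : 0 <= M. Proof. exact: le_trans (normr_ge0 _) (g_bound 0). Qed.

Lemma euler_flux_step h a j : (euler h a j.+1).2 - (euler h a j).2 =
  h * ((j.+1%:R * h) ^+ n * g (euler h a j).1).
Proof. by rewrite /= addrC addKr. Qed.

Lemma euler_value_step h a j : (euler h a j.+1).1 - (euler h a j).1 =
  h * - ((euler h a j.+1).2 / (j.+1%:R * h) ^+ n).
Proof. by rewrite /=; ring. Qed.

Lemma euler_flux_step_bound h a j : 0 < h ->
  `|(euler h a j.+1).2 - (euler h a j).2| <= h * ((j.+1%:R * h) ^+ n * M).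
Proof.
move=> h0; have p : 0 <= (j.+1%:R * h) ^+ n by rewrite exprn_ge0// mulr_ge0// ltW.
rewrite euler_flux_step normrM gtr0_norm// ler_pM2l// normrM ger0_norm//.
by rewrite ler_wpM2l.
Qed.

Lemma euler_flux_bound h a j : 0 < h -> `|(euler h a j).2| <= M * (j%:R * h) ^+ n.+1.
Proof.
move=> h0; elim: j => [|j IH].
  by rewrite mul0r expr0n mulr0 normr0.
have := euler_flux_step_bound a j h0.
have := ler_normD ((euler h a j.+1).2 - (euler h a j).2) (euler h a j).2.
rewrite subrK => /le_trans-/(_ (M * (j.+1%:R * h) ^+ n.+1)) H H2; apply: H.
have H3 : M * (j%:R * h) ^+ n.+1 <= M * ((j.+1%:R * h) ^+ n * (j%:R * h)).
  rewrite ler_wpM2l// exprSr ler_wpM2r ?mulr_ge0 ?(ltW h0)//.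
  by rewrite lerXn2r ?nnegrE ?mulr_ge0 ?(ltW h0)// ler_pM2r// ler_nat.
have -> : M * (j.+1%:R * h) ^+ n.+1 =
    h * ((j.+1%:R * h) ^+ n * M) + M * ((j.+1%:R * h) ^+ n * (j%:R * h)).
  by rewrite exprSr -[j.+1]addn1 natrD; ring.
by apply: lerD => //; apply: le_trans H3.
Qed.

Lemma euler_value_step_bound h a j : 0 < h ->
  `|(euler h a j.+1).1 - (euler h a j).1| <= h * (M * (j.+1%:R * h)).
Proof.
move=> h0; have p : 0 < j.+1%:R * h by rewrite mulr_gt0.
rewrite euler_value_step normrM gtr0_norm// ler_pM2l// normrN normrM normfV.
rewrite (gtr0_norm (exprn_gt0 n p)) ler_pdivrMr ?exprn_gt0// -mulrA -exprS.
exact: euler_flux_bound.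
Qed.

Lemma euler_value_bound h a j : 0 < h -> `|(euler h a j).1 - a| <= M * (j%:R * h) ^+ 2.
Proof.
move=> h0; elim: j => [|j IH].
  by rewrite subrr normr0 mul0r expr0n mulr0.
have := euler_value_step_bound a j h0.
have := ler_normD ((euler h a j.+1).1 - (euler h a j).1) ((euler h a j).1 - a).
rewrite addrA subrK => H H2; apply: le_trans H _.
apply: (@le_trans _ _ (h * (M * (j.+1%:R * h)) + M * (j%:R * h) ^+ 2)).
  exact: lerD.
rewrite -subr_ge0.
have -> : M * (j.+1%:R * h) ^+ 2 - (h * (M * (j.+1%:R * h)) + M * (j%:R * h) ^+ 2)
    = M * (h ^+ 2 * j%:R) by rewrite -[j.+1]addn1 natrD; ring.
by apply: mulr_ge0 => //; apply: mulr_ge0 => //; exact: sqr_ge0.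
Qed.

Lemma euler_cont h j :
  continuous (fun a => (euler h a j).1) /\ continuous (fun a => (euler h a j).2).
Proof.
elim: j => [|j [IH1 IH2]]; first by split=> a /=; [exact: cvg_id|exact: cvg_cst].
have c2 : continuous (fun a => (euler h a j.+1).2).
  move=> a /=; apply: cvgD; first exact: IH2.
  apply: cvgMr; apply: cvgMr; apply: continuous_cvg; last exact: IH1.
  exact: g_cont.
split=> // a; change ((fun a => (euler h a j).1 - h * ((euler h a j.+1).2 / (j.+1%:R * h) ^+ n))
  x @[x --> a] --> (euler h a j).1 - h * ((euler h a j.+1).2 / (j.+1%:R * h) ^+ n)).
apply: cvgB; first exact: IH1.
by apply: cvgMr; apply: cvgMl; exact: c2.
Qed.

End Euler.

Section EulerLimit.
Variables (R : realType) (n : nat) (U : set_system nat).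
Hypothesis n_gt0 : (0 < n)%N.
Context {UF : UltraFilter U}.
Hypothesis U_infty : forall m, \forall k \near U, (m <= k)%N.
Variables (g : R -> R) (M : R).
Hypothesis g_cont : continuous g.
Hypothesis g_bound : forall s, `|g s| <= M.
Implicit Types (u v : R -> R) (a r e d : R).

Let h_ (k : nat) : R := k.+1%:R^-1.

Let h_gt0 k : 0 < h_ k. Proof. by rewrite invr_gt0. Qed.

Let h_small e : 0 < e -> \forall k \near U, h_ k < e.
Proof. by move=> e0; exact: cvgr_lt (ultra_inv U_infty) _ e0. Qed.

Let h_le e : 0 < e -> \forall k \near U, h_ k <= e.
Proof. by move=> e0; apply: filterS (h_small e0) => k /ltW. Qed.

Lemma grid_increment_near (phi : R -> R -> R) (X Y : nat -> nat -> R)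
    (sh : nat -> nat) r e (y0 : R) :
  0 < r -> 0 < e -> cont2 phi r y0 -> (forall l, (l <= sh l <= l.+1)%N) ->
  (forall T, exists2 L : R, 0 <= L & forall k l, l.+1%:R * h_ k <= T ->
     `|Y k l.+1 - Y k l| <= h_ k * L) ->
  (forall k l, X k l.+1 - X k l = h_ k * phi (l.+1%:R * h_ k) (Y k (sh l))) ->
  Y k (grid (h_ k) r) @[k --> U] --> y0 ->
  exists2 d : R, 0 < d & forall r', 0 < r' -> `|r' - r| < d ->
    forall e', 0 < e' -> \forall k \near U,
    `|X k (grid (h_ k) r') - X k (grid (h_ k) r)
      - (r' - r) * phi r (Y k (grid (h_ k) r))| <= e * `|r' - r| + e'.
Proof.
move=> r0 e0 phic shl /(_ (2 * r))[L L0 YL] Xphi Yy0.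
have e20 : 0 < e / 2 by rewrite divr_gt0.
have [d d0 dP] := phic (e / 2) e20.
pose d1 := Num.min (Num.min d r) (d / (4 * (L + 1))).
have L1 : 0 < L + 1 by rewrite ltr_wpDl.
have [m1 m2 m3] : [/\ d1 <= d, d1 <= r & d1 <= d / (4 * (L + 1))].
  by rewrite /d1 !ge_min !lexx !orbT.
exists d1; first by rewrite /d1 !lt_min d0 r0 divr_gt0// mulr_gt0.
have Pp : 0 < e + (`|phi r y0| + e) by apply: addr_gt0 => //; exact: ltr_wpDl.
move=> r' r'0 rr' e' e'0; near=> k.
have hk := h_gt0 k.
have hL : h_ k <= d / (4 * (L + 1)).
  by near: k; apply: h_le; rewrite divr_gt0// mulr_gt0.
have hG : h_ k * (e + (`|phi r y0| + e)) <= e'.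
  rewrite -ler_pdivlMr//.
  by near: k; apply: h_le; exact: divr_gt0.
have yk : `|Y k (grid (h_ k) r) - y0| < d / 2.
  by near: k; move/cvgrPdistC_lt : Yy0; apply; rewrite divr_gt0.
set y := Y k _ in yk *.
have q : `|phi r y - phi r y0| < e / 2.
  apply: dP; first by rewrite subrr normr0.
  by apply: (lt_le_trans yk); clear -d0 n_gt0 UF U_infty g_cont g_bound h_le h_gt0; lra.
have Gle : `|phi r y| <= `|phi r y0| + e.
  have := ler_normD (phi r y - phi r y0) (phi r y0); rewrite subrK.
  clear -q e0 n_gt0 UF U_infty g_cont g_bound h_le h_gt0; lra.
have key t s : `|t - r| <= `|r' - r| -> `|s - y| <= d / 2 -> `|phi t s - phi r y| <= e.
  move=> tr sy.
  have h1 : `|phi t s - phi r y0| < e / 2.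
    apply: dP; first by apply: le_lt_trans tr _; exact: lt_le_trans m1.
    have := ler_normD (s - y) (y - y0); rewrite addrA subrK.
    clear -sy yk n_gt0 UF U_infty g_cont g_bound h_le h_gt0; lra.
  have := ler_normB (phi t s - phi r y0) (phi r y - phi r y0).
  have -> : phi t s - phi r y0 - (phi r y - phi r y0) = phi t s - phi r y by ring.
  clear -q h1 n_gt0 UF U_infty g_cont g_bound h_le h_gt0; lra.
have dist_ok : (`|r' - r| + h_ k) * L <= d / 2.
  have h1 : `|r' - r| + h_ k <= 2 * (d / (4 * (L + 1))).
    have := lt_le_trans rr' m3; clear -hL n_gt0 UF U_infty g_cont g_bound h_le h_gt0; lra.
  apply: (@le_trans _ _ (2 * (d / (4 * (L + 1))) * (L + 1))).
    apply: ler_pM => //; last by clear -n_gt0 UF U_infty g_cont g_bound h_le h_gt0; lra.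
    by apply: addr_ge0 => //; exact: ltW.
  rewrite le_eqVlt; apply/orP; left; apply/eqP; field.
  by rewrite gt_eqF.
have fin (x : R) : x <= `|r' - r| * e + h_ k * (e + `|phi r y|) -> x <= e * `|r' - r| + e'.
  move=> xle; apply: le_trans xle _; rewrite mulrC lerD2l.
  by apply: le_trans hG; rewrite ler_pM2l// lerD2l.
have rT : r <= 2 * r by clear -r0 n_gt0 UF U_infty g_cont g_bound h_le h_gt0; lra.
apply: fin.
case: (leP r r') => rr.
- have nr : `|r' - r| = r' - r by rewrite ger0_norm// subr_ge0.
  rewrite nr in key dist_ok rr' *.
  apply: (@grid_increment R phi _ (Y k) sh _ _ _ (2 * r) L _ _ (d / 2) y) => //.
  + by rewrite ltW.
  + by have := lt_le_trans rr' m2; clear -n_gt0 UF U_infty g_cont g_bound h_le h_gt0; lra.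
  + exact: ltW.
  + exact: YL.
  + by left.
  + move=> t s /andP[t1 t2] sy; apply: key => //.
    by rewrite ger0_norm ?subr_ge0// lerD2r.
- have nr : `|r' - r| = r - r' by rewrite ltr0_norm ?subr_lt0// opprB.
  rewrite nr in key dist_ok rr' *.
  have -> : X k (grid (h_ k) r') - X k (grid (h_ k) r) - (r' - r) * phi r y =
    - (X k (grid (h_ k) r) - X k (grid (h_ k) r') - (r - r') * phi r y) by ring.
  rewrite normrN.
  apply: (@grid_increment R phi _ (Y k) sh _ _ _ (2 * r) L _ _ (d / 2) y) => //.
  + by rewrite !ltW.
  + exact: ltW.
  + exact: YL.
  + by right.
  + move=> t s /andP[t1 t2] sy; apply: key => //.
    by rewrite distrC ger0_norm ?subr_ge0// lerD2l lerN2.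
Unshelve. all: by end_near. Qed.

Definition euler_value k a r := (euler n g (h_ k) a (grid (h_ k) r)).1.
Definition euler_flux k a r := (euler n g (h_ k) a (grid (h_ k) r)).2.

Lemma euler_limit (a_ : nat -> R) a : a_ k @[k --> U] --> a ->
  exists u v, sol n g a u v /\ forall r, 0 < r ->
    (euler_value k (a_ k) r @[k --> U] --> u r) /\ (euler_flux k (a_ k) r / r ^+ n @[k --> U] --> v r).
Proof.
move=> aU.
have M0 : 0 <= M by exact: le_trans (normr_ge0 _) (g_bound 0).
have gl k r : 0 < r -> 0 <= (grid (h_ k) r)%:R * h_ k <= r.
  by move=> r0; rewrite mulr_ge0 ?(ltW (h_gt0 k))//= grid_le// ltW.
have ub k r : 0 < r -> `|euler_value k (a_ k) r - a_ k| <= M * r ^+ 2.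
  move=> r0; have /andP[g1 g2] := gl k r r0.
  apply: le_trans (euler_value_bound n g_bound _ _ (h_gt0 k)) _.
  by rewrite ler_wpM2l// lerXn2r// nnegrE ltW.
have pb k r : 0 < r -> `|euler_flux k (a_ k) r| <= M * r ^+ n.+1.
  move=> r0; have /andP[g1 g2] := gl k r r0.
  apply: le_trans (euler_flux_bound n g_bound _ _ (h_gt0 k)) _.
  by rewrite ler_wpM2l// lerXn2r// nnegrE ltW.
have ua k e : 0 < e -> `|a_ k - a| < e -> forall r, 0 < r -> `|euler_value k (a_ k) r - a| <= M * r ^+ 2 + e.
  move=> e0 ae r r0; have := ub k r r0.
  have := ler_normD (euler_value k (a_ k) r - a_ k) (a_ k - a); rewrite addrA subrK.
  clear -ae n_gt0 UF U_infty g_cont g_bound h_le h_gt0; lra.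
have aE e : 0 < e -> \forall k \near U, `|a_ k - a| < e.
  by move=> e0; move/cvgrPdistC_lt : aU; apply.
apply: (@limit_of_approx R n U n_gt0 UF g a (fun k => euler_value k (a_ k)) (fun k => euler_flux k (a_ k)) M M g_cont).
- by move=> r e r0 e0; apply: filterS (aE e e0) => k ae; exact: ua.
- move=> r e r0 e0; near=> k.
  by apply: le_trans (pb k r r0) _; rewrite lerDl ltW.
- move=> r e r0 e0.
  have [l lP] : exists l : R, euler_flux k (a_ k) r @[k --> U] --> l.
    apply: (@ultra_bounded_cvg R U _ _ (M * r ^+ n.+1)).
    by near=> k; exact: pb.
  have [||||d d0 dP] := @grid_increment_near (fun t s => - (s / t ^+ n))
    (fun k l => (euler n g (h_ k) (a_ k) l).1)
    (fun k l => (euler n g (h_ k) (a_ k) l).2) (fun l => l.+1) r e l r0 e0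
    (cont2_speed n l r0).
  + by move=> l'; rewrite leqnSn leqnn.
  + move=> T; exists (`|T| ^+ n * M); first by rewrite mulr_ge0// exprn_ge0.
    move=> k l' lT; apply: le_trans (euler_flux_step_bound n g_bound _ _ (h_gt0 k)) _.
    rewrite ler_pM2l// ler_wpM2r// lerXn2r// ?nnegrE//.
      by rewrite mulr_ge0// ltW.
    by apply: le_trans lT _; exact: ler_norm.
  + by move=> k l'; exact: euler_value_step.
  + exact: lP.
  exists d => // r' r'0 rr' e' e'0; have := dP r' r'0 rr' e' e'0.
  by apply: filterS => k; rewrite mulrN opprK.
- move=> r e r0 e0.
  have [l lP] : exists l : R, euler_value k (a_ k) r @[k --> U] --> l.
    apply: (@ultra_bounded_cvg R U _ _ (`|a| + (M * r ^+ 2 + 1))).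
    near=> k.
    have ae : `|a_ k - a| < 1 by near: k; exact: aE.
    have := ua k 1 ltr01 ae r r0; have := ler_normD (euler_value k (a_ k) r - a) a.
    rewrite subrK; clear -n_gt0 UF U_infty g_cont g_bound h_le h_gt0; lra.
  apply: (@grid_increment_near (fun t s => t ^+ n * g s)
    (fun k l => (euler n g (h_ k) (a_ k) l).2)
    (fun k l => (euler n g (h_ k) (a_ k) l).1) id r e l r0 e0
    (cont2_flux n r l g_cont)).
  + by move=> l'; rewrite leqnSn leqnn.
  + move=> T; exists (M * `|T|); first by rewrite mulr_ge0.
    move=> k l' lT; apply: le_trans (euler_value_step_bound n g_bound _ _ (h_gt0 k)) _.
    rewrite ler_pM2l// ler_wpM2l//.
    by apply: le_trans lT _; exact: ler_norm.
  + by move=> k l'; exact: euler_flux_step.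
  + exact: lP.
Unshelve. all: by end_near. Qed.

End EulerLimit.

(** * Shooting from an interval of start values *)

Section Types.
Variables (R : realType) (n : nat).
Hypothesis n_gt0 : (0 < n)%N.
Implicit Types (g F u v : R -> R) (a b beta r x T M : R).

Definition crosses g a := forall u v, sol n g a u v -> exists2 r : R, 0 < r & u r < 0.

Definition loses_energy g F a :=
  forall u v, sol n g a u v -> exists2 r : R, 0 < r & energy F u v r < 0.

Definition good_sol g F a u v := sol n g a u v /\
  forall r, 0 < r -> 0 <= u r /\ 0 <= energy F u v r.

Definition has_good g F a := exists u v, good_sol g F a u v.

Lemma crosses_not_good g F a : crosses g a -> ~ has_good g F a.
Proof.
by move=> c [u [v [s H]]]; have [r r0] := c u v s; have [] := H r r0; lra.
Qed.

Lemma loses_energy_not_good g F a : loses_energy g F a -> ~ has_good g F a.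
Proof.
by move=> c [u [v [s H]]]; have [r r0] := c u v s; have [] := H r r0; lra.
Qed.

Lemma ultra_above : exists2 U : set_system nat, UltraFilter U &
  forall m, \forall k \near U, (m <= k)%N.
Proof.
have [U [UF UO]] := ultraFilterLemma (eventually_filter).
by exists U => // m; apply: UO; exists m.
Qed.

Section Limits.
Variables (U : set_system nat).
Context {UF : UltraFilter U}.

Lemma energy_cvg F (u_ v_ : nat -> R) (u v : R -> R) r : continuous F ->
  u_ k @[k --> U] --> u r -> v_ k @[k --> U] --> v r ->
  (v_ k ^+ 2 / 2 + F (u_ k)) @[k --> U] --> energy F u v r.
Proof.
move=> Fc uU vU; apply: cvgD; last by apply: continuous_cvg => //; exact: Fc.
by apply: cvgMl; apply: cvgM.
Qed.

Lemma limit_sol_from0 g M (a_ : nat -> R) a (u_ v_ : nat -> R -> R) :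
  continuous g -> (forall s, `|g s| <= M) ->
  (forall k, sol n g (a_ k) (u_ k) (v_ k)) -> a_ k @[k --> U] --> a ->
  exists u v, sol n g a u v /\ forall r, 0 < r ->
    (u_ k r @[k --> U] --> u r) /\ (v_ k r @[k --> U] --> v r).
Proof.
move=> gc gM s aU.
have M0 : 0 <= M by exact: le_trans (normr_ge0 _) (gM 0).
apply: (@limit_sol R n U n_gt0 UF g (fun=> g) u_ v_ a (fun=> 0)
  (fun k => `|a_ k - a|) M M gc) => //.
- exact: cvg_cst.
- rewrite -[X in _ --> X](normr0 R); apply: cvg_norm.
  by rewrite -(subrr a); apply: cvgB => //; exact: cvg_cst.
- by move=> e e0; near=> k => t; rewrite subrr normr0 ltW.
- by move=> k r /= r0; exact: (sol_u (s k) r0).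
- by move=> k r /= r0; exact: (sol_v (s k) r0).
- move=> k r r0; have := value_bound n_gt0 (s k) gM r0.
  have := ler_normD (u_ k r - a_ k) (a_ k - a); rewrite addrA subrK; lra.
- move=> k r r0; have h := speed_bound n_gt0 (s k) gM r0.
  apply: (@le_trans _ _ (r ^+ n * (M * r))); last first.
    have -> : r ^+ n * (M * r) = M * r ^+ n.+1 by rewrite exprSr; ring.
    by rewrite lerDl.
  rewrite ler_pM2l ?exprn_gt0//; apply: le_trans h _.
  rewrite ler_pdivrMr ?ltr0n// ler_peMr ?ler1n// mulr_ge0// ltW//.
Unshelve. all: by end_near. Qed.

End Limits.

Section Open.
Variables (g F : R -> R) (M : R).
Hypothesis g_cont : continuous g.
Hypothesis g_bound : forall s, `|g s| <= M.
Hypothesis F_cont : continuous F.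

Lemma harmonic_cvg (U : set_system nat) (a_ : nat -> R) a : UltraFilter U ->
  (forall m, \forall k \near U, (m <= k)%N) ->
  (forall k, `|a_ k - a| < k.+1%:R^-1) -> a_ k @[k --> U] --> a.
Proof.
move=> UF Uoo ha; apply/cvgrPdistC_lt => e e0; near=> k.
apply: lt_trans (ha k) _; near: k.
exact: cvgr_lt (ultra_inv Uoo) _ e0.
Unshelve. all: by end_near. Qed.

Lemma crosses_open a :
  (forall e, 0 < e -> exists2 x : R, `|x - a| < e & ~ crosses g x) -> ~ crosses g a.
Proof.
move=> H Na.
have [U UF Uoo] := ultra_above.
have /choice[x xP] : forall k : nat, exists x : R, `|x - a| < k.+1%:R^-1 /\ ~ crosses g x.
  by move=> k; have [|x x1 x2] := H k.+1%:R^-1; [rewrite invr_gt0|exists x].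
have /choice[uv uvP] : forall k, exists uv : (R -> R) * (R -> R), sol n g (x k) uv.1 uv.2 /\
    forall r, 0 < r -> 0 <= uv.1 r.
  move=> k; apply: contrapT => K; have [_] := xP k; apply=> u v s.
  apply: contrapT => K2; apply: K; exists (u, v); split=> //= r r0.
  by rewrite leNgt; apply/negP => ur; apply: K2; exists r.
have [|u [v [s lim]]] := @limit_sol_from0 U UF g M x a (fun k => (uv k).1)
  (fun k => (uv k).2) g_cont g_bound (fun k => (uvP k).1).
  by apply: harmonic_cvg => // k; exact: (xP k).1.
have [r r0 ur] := Na u v s; have [uU _] := lim r r0.
suff : 0 <= u r by lra.
by apply: (cvgr_to_ge uU); near=> k; exact: (uvP k).2.
Unshelve. all: by end_near. Qed.

Lemma loses_energy_open a :
  (forall e, 0 < e -> exists2 x : R, `|x - a| < e & ~ loses_energy g F x) ->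
  ~ loses_energy g F a.
Proof.
move=> H Na.
have [U UF Uoo] := ultra_above.
have /choice[x xP] : forall k : nat, exists x : R,
    `|x - a| < k.+1%:R^-1 /\ ~ loses_energy g F x.
  by move=> k; have [|x x1 x2] := H k.+1%:R^-1; [rewrite invr_gt0|exists x].
have /choice[uv uvP] : forall k, exists uv : (R -> R) * (R -> R), sol n g (x k) uv.1 uv.2 /\
    forall r, 0 < r -> 0 <= energy F uv.1 uv.2 r.
  move=> k; apply: contrapT => K; have [_] := xP k; apply=> u v s.
  apply: contrapT => K2; apply: K; exists (u, v); split=> //= r r0.
  by rewrite leNgt; apply/negP => ur; apply: K2; exists r.
have [|u [v [s lim]]] := @limit_sol_from0 U UF g M x a (fun k => (uv k).1)
  (fun k => (uv k).2) g_cont g_bound (fun k => (uvP k).1).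
  by apply: harmonic_cvg => // k; exact: (xP k).1.
have [r r0 ur] := Na u v s; have [uU vU] := lim r r0.
suff : 0 <= energy F u v r by lra.
apply: (cvgr_to_ge (energy_cvg F_cont uU vU)).
by near=> k; exact: (uvP k).2.
Unshelve. all: by end_near. Qed.

Lemma sol_exists a : exists u v, sol n g a u v.
Proof.
have [U UF Uoo] := ultra_above.
have [|u [v [s _]]] := @euler_limit R n U n_gt0 UF Uoo g M g_cont g_bound (fun=> a) a.
  exact: cvg_cst.
by exists u, v.
Qed.

End Open.

Section Between.
Variables (g F : R -> R) (b beta M : R).
Hypothesis gF : shape g F b beta.
Hypothesis g_bound : forall s, `|g s| <= M.

Let F_cont : continuous F.
Proof. by move=> s; exact: deriv_cont (shape_prim gF s). Qed.

Lemma decided_time lo hi : b < lo -> lo <= hi ->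
  (forall x, lo <= x <= hi -> ~ has_good g F x) ->
  exists2 T : R, 0 < T & forall x u v, lo <= x <= hi -> sol n g x u v ->
    u T < 0 \/ energy F u v T < 0.
Proof.
move=> blo lohi ngood; apply: contrapT => H.
have b0 := shape_b_gt0 gF.
have [U UF Uoo] := ultra_above.
have /choice[w wP] : forall k : nat, exists w : R * ((R -> R) * (R -> R)),
    [/\ lo <= w.1 <= hi, sol n g w.1 w.2.1 w.2.2, 0 <= w.2.1 k.+1%:R
      & 0 <= energy F w.2.1 w.2.2 k.+1%:R].
  move=> k; apply: contrapT => K; apply: H; exists k.+1%:R => // x u v xI s.
  apply: contrapT => /not_orP[/negP h1 /negP h2]; apply: K; exists (x, (u, v)).
  by split=> //=; rewrite leNgt.
have [x xU] : exists x : R, (w k).1 @[k --> U] --> x.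
  apply: (@ultra_bounded_cvg R U _ _ (`|lo| + `|hi|)); near=> k.
  have [/andP[h1 h2] _ _ _] := wP k.
  have := ler_norm hi; have := ler_norm (- lo); rewrite normrN.
  by have := normr_ge0 hi; have := normr_ge0 lo; rewrite ler_norml => *; apply/andP; split; lra.
have [u [v [s lim]]] := @limit_sol_from0 U UF g M (fun k => (w k).1) x
  (fun k => (w k).2.1) (fun k => (w k).2.2) (shape_cont gF) g_bound
  (fun k => let: And4 _ s _ _ := wP k in s) xU.
apply: (ngood x).
  apply/andP; split.
  - by apply: (cvgr_to_ge xU); near=> k; have [/andP[]] := wP k.
  - by apply: (cvgr_to_le xU); near=> k; have [/andP[]] := wP k.
exists u, v; split=> // r r0; have [uU vU] := lim r r0.
have big : \forall k \near U, r <= k.+1%:R.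
  near=> k; apply: le_trans (ltW (truncnS_gt r)) _; rewrite ler_nat ltnS.
  by near: k; exact: Uoo.
split.
- apply: (cvgr_to_ge uU); near=> k; have [/andP[h1 _] sk uk _] := wP k.
  rewrite leNgt; apply/negP => ur.
  have rk : r <= k.+1%:R by near: k.
  have := neg_persist n_gt0 gF sk _ r0 ur rk.
  by move=> /(_ _)/wrap[|]; lra.
- apply: (cvgr_to_ge (energy_cvg F_cont uU vU)); near=> k.
  have [_ sk _ Ek] := wP k.
  have rk : r <= k.+1%:R by near: k.
  exact: (le_trans Ek (energy_nonincr (shape_prim gF) sk r0 rk)).
Unshelve. all: by end_near. Qed.

(* A continuous Euler approximation cannot jump from "below zero" to "negative
   energy" at a time when every exact solution is in exactly one of these states. *)
Lemma good_between x0 x1 : b < x0 -> b < x1 ->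
  crosses g x0 -> loses_energy g F x1 ->
  exists2 x : R, Num.min x0 x1 < x < Num.max x0 x1 & has_good g F x.
Proof.
move=> bx0 bx1 Nx0 Px1.
have b0 := shape_b_gt0 gF.
set lo := Num.min x0 x1; set hi := Num.max x0 x1.
have lohi : lo <= hi by rewrite /lo /hi ge_min le_max lexx.
have blo : b < lo by rewrite /lo lt_min bx0 bx1.
have x0I : lo <= x0 <= hi by rewrite /lo /hi ge_min le_max lexx.
have x1I : lo <= x1 <= hi by rewrite /lo /hi ge_min le_max lexx !orbT.
apply: contrapT => K.
have ngood x : lo <= x <= hi -> ~ has_good g F x.
  move=> /andP[lx xh] gx; apply: K; exists x => //.
  rewrite !lt_neqAle lx xh !andbT; apply/andP; split; apply/eqP => e.
  - move: gx; rewrite -e /lo minElt; case: ifP => _.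
      exact: crosses_not_good.
    exact: loses_energy_not_good.
  - move: gx; rewrite e /hi maxElt; case: ifP => _.
      exact: loses_energy_not_good.
    exact: crosses_not_good.
have [T T0 dec] := decided_time blo lohi ngood.
have excl x u v r t : lo <= x <= hi -> sol n g x u v -> 0 < r -> 0 < t ->
    u r < 0 -> energy F u v t < 0 -> False.
  move=> /andP[lx _] s r0 t0 ur Et.
  by have := energy_ge0_crossing n_gt0 gF s ltac:(lra) r0 ur t0; lra.
have [U UF Uoo] := ultra_above.
pose uT k x := @euler_value R n g k x T.
pose vT k x := @euler_flux R n g k x T / T ^+ n.
pose ET k x := vT k x ^+ 2 / 2 + F (uT k x).
pose psi k x := Num.max 0 (- uT k x) - Num.max 0 (- ET k x).
have psi_cont k : continuous (psi k).
  have [c1 c2] := @euler_cont R n g (shape_cont gF) k.+1%:R^-1 (grid k.+1%:R^-1 T).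
  have cu : continuous (uT k) by exact: c1.
  have cv : continuous (vT k) by move=> x; apply: cvgMl; exact: c2.
  have cE : continuous (ET k).
    move=> x; apply: cvgD; last by apply: continuous_cvg; [exact: F_cont|exact: cu].
    by apply: cvgMl; apply: cvgM; exact: cv.
  move=> x; apply: cvgB.
  - by apply: (@cvg_comp _ _ _ (uT k) (fun t : R => Num.max 0 (- t)));
      [exact: cu|apply: continuous_max; [exact: cvg_cst|apply: cvgN; exact: cvg_id]].
  - by apply: (@cvg_comp _ _ _ (ET k) (fun t : R => Num.max 0 (- t)));
      [exact: cE|apply: continuous_max; [exact: cvg_cst|apply: cvgN; exact: cvg_id]].
have lim_psi (a_ : nat -> R) a : lo <= a <= hi -> a_ k @[k --> U] --> a ->
    exists u v, sol n g a u v /\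
      psi k (a_ k) @[k --> U] --> Num.max 0 (- u T) - Num.max 0 (- energy F u v T).
  move=> aI aU.
  have [u [v [s lim]]] := @euler_limit R n U n_gt0 UF Uoo g M (shape_cont gF) g_bound a_ a aU.
  have [uU vU] := lim T T0; exists u, v; split=> //.
  have EU := energy_cvg F_cont uU vU.
  have mc : continuous (fun t : R => Num.max 0 (- t)).
    by move=> t; apply: continuous_max; [exact: cvg_cst|apply: cvgN; exact: cvg_id].
  apply: cvgB.
  - apply: (@cvg_comp _ _ _ (fun k => uT k (a_ k)) (fun t : R => Num.max 0 (- t)) _ _ _ uU).
    exact: mc.
  - apply: (@cvg_comp _ _ _ (fun k => ET k (a_ k)) (fun t : R => Num.max 0 (- t)) _ _ _ (EU UF)).
    exact: mc.
have max0E (t : R) : t < 0 -> Num.max 0 (- t) = - t by move=> t0; apply: max_r; lra.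
have max0E' (t : R) : 0 <= t -> Num.max 0 (- t) = 0 by move=> t0; apply: max_l; lra.
have s0 : \forall k \near U, 0 <= psi k x0.
  have [//|neg] := in_ultra_setVsetC [set k | 0 <= psi k x0] UF.
  have [|u [v [s lim]]] := lim_psi (fun=> x0) x0 x0I; first exact: cvg_cst.
  have le0 : Num.max 0 (- u T) - Num.max 0 (- energy F u v T) <= 0.
    by apply: (cvgr_to_le lim); apply: filterS neg => k /= /negP; rewrite -ltNge => /ltW.
  have [r r0 ur] := Nx0 u v s.
  have ET0 : 0 <= energy F u v T.
    by rewrite leNgt; apply/negP => /(excl _ _ _ _ _ x0I s r0 T0 ur).
  have [uT0|] := dec x0 u v x0I s; last by lra.
  by move: le0; rewrite (max0E _ uT0) (max0E' _ ET0); lra.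
have s1 : \forall k \near U, psi k x1 <= 0.
  have [//|neg] := in_ultra_setVsetC [set k | psi k x1 <= 0] UF.
  have [|u [v [s lim]]] := lim_psi (fun=> x1) x1 x1I; first exact: cvg_cst.
  have ge0 : 0 <= Num.max 0 (- u T) - Num.max 0 (- energy F u v T).
    by apply: (cvgr_to_ge lim); apply: filterS neg => k /= /negP; rewrite -ltNge => /ltW.
  have [r r0 Er] := Px1 u v s.
  have uT0 : 0 <= u T.
    by rewrite leNgt; apply/negP => uT0; exact: (excl _ _ _ _ _ x1I s T0 r0 uT0 Er).
  have [|ET0] := dec x1 u v x1I s; first by lra.
  by move: ge0; rewrite (max0E _ ET0) (max0E' _ uT0); lra.
have /choice[z zP] : forall k, exists z : R, 0 <= psi k x0 -> psi k x1 <= 0 ->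
    lo <= z <= hi /\ psi k z = 0.
  move=> k; have [p0|p0] := leP 0 (psi k x0); last by exists 0; lra.
  have [p1|p1] := leP (psi k x1) 0; last by exists 0; lra.
  have [||z] := @IVT R (psi k) lo hi 0 lohi.
  - exact: continuous_subspaceT.
  - rewrite ge_min le_max /lo /hi minElt maxElt.
    by case: ifP => _; rewrite p0 p1 ?orbT.
  - by rewrite in_itv /= => zI pz; exists z.
have zU : \forall k \near U, lo <= z k <= hi /\ psi k (z k) = 0.
  by near=> k; apply: zP; near: k.
have [x xU] : exists x : R, z k @[k --> U] --> x.
  apply: (@ultra_bounded_cvg R U _ _ (`|lo| + `|hi|)).
  apply: filterS zU => k [/andP[h1 h2] _].
  have := ler_norm hi; have := ler_norm (- lo); rewrite normrN.
  by have := normr_ge0 hi; have := normr_ge0 lo; rewrite ler_norml => *; apply/andP; split; lra.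
have xI : lo <= x <= hi.
  apply/andP; split.
  - by apply: (cvgr_to_ge xU); apply: filterS zU => k [/andP[]].
  - by apply: (cvgr_to_le xU); apply: filterS zU => k [/andP[]].
have [u [v [s lim]]] := lim_psi z x xI xU.
have eq0 : Num.max 0 (- u T) - Num.max 0 (- energy F u v T) = 0.
  apply/eqP; rewrite eq_le; apply/andP; split.
  - by apply: (cvgr_to_le lim); apply: filterS zU => k [_ ->].
  - by apply: (cvgr_to_ge lim); apply: filterS zU => k [_ ->].
case: (ltP (u T) 0) => uT0; case: (ltP (energy F u v T) 0) => ET0.
- exact: (excl _ _ _ _ _ xI s T0 T0 uT0 ET0).
- by move: eq0; rewrite (max0E _ uT0) (max0E' _ ET0); lra.
- by move: eq0; rewrite (max0E _ ET0) (max0E' _ uT0); lra.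
- by have [] := dec x u v xI s; lra.
Unshelve. all: by end_near. Qed.

End Between.
End Types.

(** * Uniqueness while the solution is positive *)

Section MoreCalculus.
Variable R : realType.
Implicit Types (f h : R -> R) (c d t x y a : R).

Lemma eq_of_eq_left f h c : 0 < c -> {for c, continuous f} -> {for c, continuous h} ->
  (forall t, 0 < t < c -> f t = h t) -> f c = h c.
Proof.
move=> c0 fc hc fh; apply: (@cvg_unique _ _ (f x @[x --> c^'-])).
- exact: Rhausdorff.
- exact: cvg_at_left_filter fc.
- apply: cvg_trans (cvg_at_left_filter hc); apply: near_eq_cvg.
  by near=> t; apply/esym/fh/andP; split; near: t; [exact: nbhs_left_gt|exact: nbhs_left_lt].
Unshelve. all: by end_near. Qed.

End MoreCalculus.

Section Uniqueness.
Variables (R : realType) (n : nat).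
Implicit Types (g F u v : R -> R) (a b beta r t x y e d L : R).

Lemma sol_unique g a u1 v1 u2 v2 L (r0 : R) :
  sol n g a u1 v1 -> sol n g a u2 v2 -> 0 <= L ->
  (forall t, 0 < t < r0 -> `|g (u1 t) - g (u2 t)| <= L * `|u1 t - u2 t|) ->
  forall t, 0 < t < r0 -> u1 t = u2 t /\ v1 t = v2 t.
Proof.
move=> s1 s2 L0 gL.
pose z t := u1 t - u2 t; pose w t := v1 t - v2 t.
pose H t := (z t * z t + w t * w t) * expR (- (1 + L) * t).
have dz t : 0 < t -> is_derive t 1 z (- v1 t - - v2 t).
  by move=> t0; exact (deriv_sub (sol_u s1 t0) (sol_u s2 t0)).
have dw t : 0 < t -> is_derive t 1 w
    ((g (u1 t) - n%:R * v1 t / t) - (g (u2 t) - n%:R * v2 t / t)).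
  by move=> t0; exact (deriv_sub (sol_v s1 t0) (sol_v s2 t0)).
have dexp t : is_derive t 1 (fun t : R => expR (- (1 + L) * t))
    (expR (- (1 + L) * t) * (- (1 + L) * 1)).
  exact (@deriv_comp R expR (fun t : R => - (1 + L) * t) t _ _
    (is_derive_expR _) (deriv_mull _ (deriv_id t))).
pose dH t := (2 * z t * - w t + 2 * w t * ((g (u1 t) - g (u2 t)) - n%:R * w t / t)
   - (1 + L) * (z t * z t + w t * w t)) * expR (- (1 + L) * t).
have HdH t : 0 < t -> is_derive t 1 H (dH t).
  move=> t0; have := deriv_mul (deriv_add (deriv_mul (dz t t0) (dz t t0))
    (deriv_mul (dw t t0) (dw t t0))) (dexp t).
  move=> h; apply: (is_derive_eq h); rewrite /dH /w /z; field.
  by rewrite gt_eqF.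
have dH_le0 t : 0 < t < r0 -> dH t <= 0.
  move=> /[dup] tI /andP[t0 tr]; rewrite /dH.
  apply: mulr_le0_ge0; last exact: expR_ge0.
  have h1 : 0 <= n%:R * w t ^+ 2 / t.
    by apply: divr_ge0; [apply: mulr_ge0 => //; exact: sqr_ge0|exact: ltW].
  have h2 := gL t tI; rewrite -/(z t) in h2.
  have h3 : w t * (g (u1 t) - g (u2 t)) <= `|w t| * (L * `|z t|).
    apply: le_trans (ler_norm _) _; rewrite normrM.
    by rewrite ler_wpM2l.
  have h4 : - (z t * w t) <= `|z t| * `|w t|.
    by apply: le_trans (ler_norm _) _; rewrite normrN normrM.
  have h5 : 2 * (`|z t| * `|w t|) <= z t * z t + w t * w t.
    rewrite -!expr2 -(real_normK (num_real (z t))) -(real_normK (num_real (w t))).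
    rewrite -subr_ge0 (_ : _ - _ = (`|z t| - `|w t|) ^+ 2); last by ring.
    exact: sqr_ge0.
  have h6 : 0 <= (1 + L) * ((z t * z t + w t * w t) - 2 * (`|z t| * `|w t|)).
    by rewrite mulr_ge0 ?subr_ge0// addr_ge0.
  move: h1 h3 h4 h6; clear.
  have -> : 2 * z t * - w t + 2 * w t * ((g (u1 t) - g (u2 t)) - n%:R * w t / t)
     - (1 + L) * (z t * z t + w t * w t) =
    2 * (- (z t * w t)) + 2 * (w t * (g (u1 t) - g (u2 t))) - 2 * (n%:R * w t ^+ 2 / t)
     - (1 + L) * (z t * z t + w t * w t) by ring.
  set p := - _; set q := w t * (_ - _); set s := _ / t.
  have -> : `|w t| * (L * `|z t|) = L * (`|z t| * `|w t|) by ring.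
  lra.
have Hlim : H x @[x --> 0^'+] --> (0 : R).
  have zl : z x @[x --> 0^'+] --> (a - a) by apply: cvgB; [exact: sol_u0 s1|exact: sol_u0 s2].
  have wl : w x @[x --> 0^'+] --> (0 - 0 : R) by apply: cvgB; [exact: sol_v0 s1|exact: sol_v0 s2].
  have el : expR (- (1 + L) * x) @[x --> 0^'+] --> expR (- (1 + L) * 0).
    by apply: cvg_at_right_filter; exact: (deriv_cont (dexp 0)).
  have : H x @[x --> 0^'+] -->
      ((a - a) * (a - a) + (0 - 0) * (0 - 0)) * expR (- (1 + L) * 0).
    by apply: cvgM; [apply: cvgD; exact: cvgM|exact: el].
  by rewrite !subrr !mulr0 addr0 mul0r.
move=> t /andP[t0 tr].
have Ht : H t <= 0.
  apply: (lim0_ge t0 Hlim) => x /andP[x0 xt].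
  apply: (nonincr_of_deriv (ltW xt)) => y /andP[xy yt].
    by apply: HdH; exact: lt_le_trans xy.
  by apply: dH_le0; rewrite (lt_trans x0 xy) (lt_trans yt tr).
have : z t * z t + w t * w t <= 0 by move: Ht; rewrite /H pmulr_lle0// expR_gt0.
rewrite -!expr2 => zw.
have zz := sqr_ge0 (z t); have ww := sqr_ge0 (w t).
have /eqP : z t ^+ 2 = 0 by lra.
have /eqP : w t ^+ 2 = 0 by lra.
by rewrite !sqrf_eq0 !subr_eq0 => /eqP -> /eqP ->.
Qed.

Section Trichotomy.
Hypothesis n_gt0 : (0 < n)%N.
Variables (g F : R -> R) (b beta M : R).
Hypothesis gF : shape g F b beta.
Hypothesis g_bound : forall s, `|g s| <= M.

Lemma energy_const_speed0 a u v (r1 r2 r : R) : sol n g a u v -> 0 < r1 ->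
  energy F u v r1 = energy F u v r2 -> r1 < r < r2 -> v r = 0.
Proof.
move=> s r10 E12 /andP[r1r rr2].
have r0 : 0 < r by exact: lt_trans r1r.
have Ec y : r1 <= y <= r2 -> energy F u v r1 = energy F u v y.
  move=> /andP[ry yr]; apply/eqP; rewrite eq_le; apply/andP; split.
    rewrite E12; apply: (energy_nonincr (shape_prim gF) s _ yr).
    exact: lt_le_trans ry.
  exact: (energy_nonincr (shape_prim gF) s r10 ry).
have d1 := energy_deriv (shape_prim gF) s r0.
have d2 : is_derive r 1 (energy F u v) (0 : R).
  have m0 : 0 < Num.min (r - r1) (r2 - r) by rewrite lt_min !subr_gt0 r1r rr2.
  apply: (deriv_eq_near (f := fun=> energy F u v r1) m0).
  move=> y; rewrite lt_min !ltr_norml => /andP[/andP[h1 h2] /andP[h3 h4]].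
  by apply: Ec; apply/andP; split; lra.
have /eqP := deriv_unique d1 d2.
rewrite oppr_eq0 mulf_eq0 invr_eq0 (gt_eqF r0) orbF mulf_eq0 pnatr_eq0.
by rewrite gtn_eqF//= expf_eq0/= => /eqP.
Qed.

Variable a : R.
Hypothesis b_lt_a : b < a.
Hypothesis g_lip : forall d, 0 < d -> exists2 L : R, 0 <= L &
  forall x y, d <= x <= a -> d <= y <= a -> `|g x - g y| <= L * `|x - y|.

Lemma crossing_transfer u1 v1 u2 v2 (r : R) : sol n g a u1 v1 -> sol n g a u2 v2 ->
  0 < r -> u1 r < 0 -> exists2 t : R, 0 < t & u2 t < 0.
Proof.
move=> s1 s2 r0 ur; apply: contrapT => N.
have u2p t : 0 < t -> 0 <= u2 t.
  by move=> t0; rewrite leNgt; apply/negP => ut; apply: N; exists t.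
have a0 : 0 < a by exact: lt_trans (shape_b_gt0 gF) b_lt_a.
have a20 : 0 < a / 2 by lra.
have /lim0P/(_ _ a20)[d1 d10 d1P] := sol_u0 s1.
have /lim0P/(_ _ a20)[d2 d20 d2P] := sol_u0 s2.
pose d := Num.min d1 d2.
have d0 : 0 < d by rewrite lt_min d10 d20.
have [dd1 dd2] : d <= d1 /\ d <= d2 by rewrite /d !ge_min !lexx orbT.
have early t : 0 < t < d -> a / 2 <= u1 t /\ a / 2 <= u2 t.
  move=> /andP[t0 td].
  have := d1P t; rewrite t0 (lt_le_trans td dd1) ltr_norml => /(_ isT)/andP[h1 _].
  have := d2P t; rewrite t0 (lt_le_trans td dd2) ltr_norml => /(_ isT)/andP[h2 _].
  by split; lra.
pose m t := Num.min (u1 t) (u2 t).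
have mc t : 0 < t -> {for t, continuous m}.
  move=> t0; apply: continuous_min; first exact: (deriv_cont (sol_u s1 t0)).
  exact: (deriv_cont (sol_u s2 t0)).
have d2r : d / 2 < r.
  rewrite ltNge; apply/negP => rd; have [|] := early r; last lra.
  by rewrite r0; lra.
have d2I : 0 < d / 2 < d by apply/andP; split; lra.
have [||||c /andP[dc cr] [mc0 mpos]] := @first_zero R m (d / 2) r.
- exact: d2r.
- by move=> x /andP[dx _]; apply: mc; lra.
- by have [e1 e2] := early _ d2I; rewrite lt_min; apply/andP; split; lra.
- by rewrite ge_min ltW.
have c0 : 0 < c by lra.
have agree t : 0 < t < c -> u1 t = u2 t /\ v1 t = v2 t.
  move=> /andP[t0 tc].
  pose t' := (t + c) / 2.
  have tt' : t < t' by rewrite /t'; lra.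
  have t'c : t' < c by rewrite /t'; lra.
  pose lo := Num.min (d / 2) t'.
  have lo0 : 0 < lo by rewrite lt_min (lt_trans t0 tt') divr_gt0.
  have [lod lot] : lo <= d / 2 /\ lo <= t' by rewrite /lo !ge_min !lexx orbT.
  have [|x /[!in_itv]/= /andP[x1 x2] xP] := @EVT_min R m lo t' lot.
    apply: continuous_in_subspaceT => y /[!inE]/= /[!in_itv]/= /andP[y1 _].
    by apply: mc; exact: lt_le_trans y1.
  have mpos' y : 0 < y < c -> 0 < m y.
    move=> /andP[y0 yc]; case: (ltP y d) => yd.
      by have [|e1 e2] := early y; [rewrite y0|rewrite lt_min !(lt_le_trans a20)].
    by apply: mpos; rewrite yc andbT; lra.
  have mx : 0 < m x by apply: mpos'; rewrite (lt_le_trans lo0 x1) (le_lt_trans x2 t'c).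
  pose dl := Num.min (m x) (a / 2).
  have dl0 : 0 < dl by rewrite lt_min mx a20.
  have [dlm dla] : dl <= m x /\ dl <= a / 2 by split; rewrite /dl ge_min lexx ?orbT.
  have [L L0 LP] := g_lip dl0.
  have range y : 0 < y < t' -> dl <= u1 y <= a /\ dl <= u2 y <= a.
    move=> /andP[y0 yt].
    rewrite (sol_le gF s1 (ltW b_lt_a) y0) (sol_le gF s2 (ltW b_lt_a) y0) !andbT.
    case: (ltP y (d / 2)) => yd.
      have [|e1 e2] := early y; first by rewrite y0 (lt_trans yd (andP d2I).2).
      by split; exact: (le_trans dla).
    have : m x <= m y.
      by apply: xP; rewrite in_itv /= (le_trans lod yd) ltW.
    by rewrite le_min => /andP[h1 h2]; split; exact: (le_trans dlm).
  apply: (sol_unique s1 s2 L0 (r0 := t')); last by rewrite t0.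
  by move=> y /range[h1 h2]; exact: LP.
have u12 : u1 c = u2 c /\ v1 c = v2 c.
  split.
  - apply: (eq_of_eq_left c0); [exact: (deriv_cont (sol_u s1 c0))|exact: (deriv_cont (sol_u s2 c0))|].
    by move=> t /agree[].
  - apply: (eq_of_eq_left c0); [exact: (deriv_cont (sol_v s1 c0))|exact: (deriv_cont (sol_v s2 c0))|].
    by move=> t /agree[].
have [uc vc] := u12.
have u1c : u1 c = 0 by move: mc0; rewrite /m uc minxx.
have v2c : v2 c = 0.
  have c2I y : y \in `]0, (2 * c)[ -> 0 < y by rewrite in_itv => /andP[].
  have := @derive1_at_min _ u2 0 (2 * c) c (mulr_ge0 (ler0n _ 2) (ltW c0)).
  move=> /(_ (fun y yI => @ex_derive _ _ _ _ _ _ _ (sol_u s2 (c2I y yI)))) h.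
  apply/eqP; rewrite -oppr_eq0; apply/eqP/(deriv_unique (sol_u s2 c0)); apply: h.
    by rewrite in_itv /= c0 ltr_pMl// ltr1n.
  by move=> y /c2I y0; rewrite -uc u1c; exact: u2p.
have cr' : c < r by rewrite lt_neqAle cr andbT; apply/eqP => e; move: ur; rewrite -e u1c ltxx.
have Ec : energy F u1 v1 c = 0.
  by rewrite /energy vc v2c u1c expr0n mul0r add0r (shape_F_le0 gF).
have Er : energy F u1 v1 r = 0.
  apply/eqP; rewrite eq_le -{1}Ec (energy_nonincr (shape_prim gF) s1 c0 cr)/=.
  exact: (energy_ge0_crossing n_gt0 gF s1 a0 r0 ur r0).
have [x xI|x /andP[cx xr]] := @mean_value R u1 (fun t : R => - v1 t) c r cr'.
  by apply: (sol_u s1); case/andP: xI => h _; exact: lt_le_trans h.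
rewrite (@energy_const_speed0 a u1 v1 c r) ?cx//; last by rewrite Ec Er.
by rewrite oppr0 mul0r u1c subr0 => e; move: ur; rewrite e ltxx.
Qed.

Lemma trichotomy : [\/ has_good n g F a, crosses n g a | loses_energy n g F a].
Proof.
have a0 : 0 < a by exact: lt_trans (shape_b_gt0 gF) b_lt_a.
have [u [v s]] := sol_exists n_gt0 (shape_cont gF) g_bound a.
have [G|NG] := pselect (has_good n g F a); first by constructor 1.
have [[r r0 ur]|up] := pselect (exists2 r : R, 0 < r & u r < 0).
  by constructor 2 => u2 v2 s2; exact: (crossing_transfer s s2 r0 ur).
constructor 3 => u2 v2 s2; apply: contrapT => N; apply: NG.
exists u2, v2; split=> // r r0; split.
- rewrite leNgt; apply/negP => ur.
  exact: up (crossing_transfer s2 s r0 ur).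
- by rewrite leNgt; apply/negP => Er; apply: N; exists r.
Qed.

End Trichotomy.
End Uniqueness.

(** * Steep ramps *)

Section Transforms.
Variables (R : realType) (n : nat).
Implicit Types (g u v : R -> R) (a c r : R).

Lemma sol_scale g a u v c : 0 < c -> sol n g a u v ->
  sol n (fun s => c ^+ 2 * g s) a (fun r => u (c * r)) (fun r => c * v (c * r)).
Proof.
move=> c0 s.
have dc r : is_derive r 1 (fun t : R => c * t) (c * 1) by exact: (deriv_mull c (deriv_id r)).
have lim0c : (c * x) @[x --> 0^'+] --> 0^'+.
  move=> A [d /= d0 dA]; exists (d / c); first by rewrite /= divr_gt0.
  move=> x; rewrite /ball_ /= sub0r normrN => xd x0.
  apply: dA; last by rewrite mulr_gt0.
  by rewrite /ball_ /= sub0r normrN normrM gtr0_norm// mulrC -ltr_pdivlMr.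
split=> [r r0|r r0||].
- have cr : 0 < c * r by exact: mulr_gt0.
  apply: (is_derive_eq (@deriv_comp R u (fun t : R => c * t) r _ _ (sol_u s cr) (dc r))).
  by rewrite mulr1; ring.
- have cr : 0 < c * r by exact: mulr_gt0.
  apply: (is_derive_eq (deriv_mull c (@deriv_comp R v (fun t : R => c * t) r _ _ (sol_v s cr) (dc r)))).
  by rewrite mulr1; field; rewrite !gt_eqF.
- exact: (cvg_comp _ _ lim0c (sol_u0 s)).
- have h : (v (c * x)) @[x --> 0^'+] --> (0 : R) by exact: (cvg_comp _ _ lim0c (sol_v0 s)).
  have : (c * v (c * x)) @[x --> 0^'+] --> c * 0 by apply: cvgMr.
  by rewrite mulr0.
Qed.

Lemma sol_affine g (a0 : R) u v a c : c != 0 -> sol n g a0 u v ->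
  sol n (fun s => g (a + c * s) / c) ((a0 - a) / c) (fun r => (u r - a) / c) (fun r => v r / c).
Proof.
move=> c0 s; split=> [r r0|r r0||].
- apply: (is_derive_eq (deriv_mul (deriv_sub (sol_u s r0) (deriv_cst a r)) (deriv_cst c^-1 r))).
  by ring.
- apply: (is_derive_eq (deriv_mul (sol_v s r0) (deriv_cst c^-1 r))).
  have -> : a + c * ((u r - a) / c) = u r by field.
  by field; rewrite c0 gt_eqF.
- apply: cvgMl; apply: cvgB; [exact: sol_u0 s|exact: cvg_cst].
- have : (v x / c) @[x --> 0^'+] --> 0 / c by apply: cvgMl; exact: sol_v0 s.
  by rewrite mul0r.
Qed.

End Transforms.

Section Profile.
Variables (R : realType) (n : nat).
Hypothesis n_gt1 : (1 < n)%N.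
Implicit Types (g u v : R -> R) (a c d r s t e kappa : R).

Let n_gt0 : (0 < n)%N. Proof. exact: ltn_trans n_gt1. Qed.

Definition clamp01 s : R := Num.max 0 (Num.min s 1).

Lemma clamp01_ge0 s : 0 <= clamp01 s. Proof. by rewrite le_max lexx. Qed.
Lemma clamp01_le1 s : clamp01 s <= 1.
Proof. by rewrite ge_max ler01 /= ge_min lexx orbT. Qed.
Lemma clamp01_id s : 0 <= s <= 1 -> clamp01 s = s.
Proof. by move=> /andP[s0 s1]; rewrite /clamp01 min_l// max_r. Qed.
Lemma clamp01_neg s : s <= 0 -> clamp01 s = 0.
Proof. by move=> s0; rewrite /clamp01 max_l// ge_min s0. Qed.
Lemma clamp01_big s : 1 <= s -> clamp01 s = 1.
Proof. by move=> s0; rewrite /clamp01 min_r// max_r. Qed.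
Lemma clamp01_cases s : [\/ s <= 0 /\ clamp01 s = 0,
  0 <= s <= 1 /\ clamp01 s = s | 1 <= s /\ clamp01 s = 1].
Proof.
have [s0|s0] := leP s 0; first by constructor 1; rewrite clamp01_neg.
have [s1|s1] := leP s 1; last by constructor 3; rewrite clamp01_big ?ltW.
by constructor 2; rewrite clamp01_id ?(ltW s0).
Qed.

Lemma clamp01_lip s t : `|clamp01 s - clamp01 t| <= `|s - t|.
Proof.
wlog st : s t / s <= t => [H|].
  have [|/ltW] := leP s t; first exact: H.
  by move=> ts; rewrite distrC [leRHS]distrC; exact: H.
rewrite distrC [leRHS]distrC [leRHS]ger0_norm ?subr_ge0//.
have [[s1 ->]|[/andP[s1 s2] ->]|[s1 ->]] := clamp01_cases s;
  have [[t1 ->]|[/andP[t1 t2] ->]|[t1 ->]] := clamp01_cases t;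
  rewrite ler_norml; apply/andP; split; lra.
Qed.

Lemma clamp01_cont : continuous clamp01.
Proof.
move=> x; apply/cvgrPdist_lt => e e0; exists e => //= y; rewrite /ball_ /=.
by move=> xy; apply: le_lt_trans (clamp01_lip _ _) xy.
Qed.

(* As long as [phi > 0] the quotient [w = phi / v] satisfies the Riccati equation
   [w' = - 1 - w ^+ 2 + n * w / r], so [w' <= - 3 / 4] for [r >= n]. *)
Lemma profile_hits0 phi v : sol n clamp01 1 phi v -> exists2 r : R, 0 < r & phi r <= 0.
Proof.
move=> s; apply: contrapT => N.
have pp r : 0 < r -> 0 < phi r.
  by move=> r0; rewrite ltNge; apply/negP => pr; apply: N; exists r.
have vp r : 0 < r -> 0 < v r.
  move=> r0; apply: (flux_pos n_gt0 s r0) => t /andP[/pp t0 _].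
  by rewrite /clamp01 lt_max lt_min t0 ltr01 orbT.
have p1 r : 0 < r -> phi r <= 1.
  by move=> r0; apply: (value_le_init s r0) => t /andP[/vp/ltW].
pose w r := phi r / v r.
have dw r : 0 < r -> is_derive r 1 w (- 1 - w r ^+ 2 + n%:R * w r / r).
  move=> r0; have vr := vp r r0.
  apply: (is_derive_eq (deriv_mul (sol_u s r0) (deriv_inv (lt0r_neq0 vr) (sol_v s r0)))).
  rewrite clamp01_id; last by rewrite (ltW (pp r r0)) p1.
  by rewrite /w; field; rewrite !gt_eqF.
have N0 : 0 < n%:R :> R by rewrite ltr0n.
have wp r : 0 < r -> 0 < w r by move=> r0; rewrite divr_gt0 ?pp ?vp.
pose T := n%:R + 2 * w n%:R.
have nT : n%:R < T by rewrite /T ltrDl mulr_gt0 ?wp.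
have [x /andP[x1 _]|c /andP[c1 c2] e] := @mean_value R w
  (fun r => - 1 - w r ^+ 2 + n%:R * w r / r) n%:R T nT.
  by apply: dw; exact: lt_le_trans x1.
have c0 : 0 < c by exact: lt_trans c1.
have h1 : n%:R * w c / c <= w c.
  by rewrite ler_pdivrMr// mulrC ler_wpM2l ?ltW ?wp.
have h2 : - 1 - w c ^+ 2 + n%:R * w c / c <= - (3 / 4).
  have := sqr_ge0 (w c - 1 / 2); nra.
have wT := wp T (lt_trans N0 nT).
have wn := wp _ N0.
have : w T - w n%:R <= - (3 / 4) * (2 * w n%:R).
  have eT : T - n%:R = 2 * w n%:R by rewrite /T; ring.
  by rewrite e eT ler_wpM2r// mulr_ge0// ltW.
lra.
Qed.

Lemma profile_tail : exists kappa phi v, [/\ 0 < kappa, sol n clamp01 1 phi v &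
  forall e, 0 < e -> exists2 S : R, 0 < S & `|phi S + kappa| < e /\ `|S * v S| < e].
Proof.
have [phi [v s]] : exists u v, sol n clamp01 1 u v.
  apply: (@sol_exists R n n_gt0 clamp01 1 clamp01_cont) => x.
  by rewrite ger0_norm ?clamp01_ge0// clamp01_le1.
have [r1 r10 pr1] := profile_hits0 s.
have pc t : 0 < t -> {for t, continuous phi} by move=> t0; exact: (deriv_cont (sol_u s t0)).
have /lim0P/(_ (1 / 2))[|d d0 dP] := sol_u0 s; first lra.
have early t : 0 < t < d -> 0 < phi t.
  by move=> /dP; rewrite ltr_norml => /andP[h _]; lra.
have dr : d / 2 < r1.
  rewrite ltNge; apply/negP => rd; have := early r1 ltac:(apply/andP; split; lra); lra.
have [||||rho /andP[drho _] [prho ppos]] := @first_zero R phi (d / 2) r1 => //.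
- by move=> x /andP[x1 _]; apply: pc; lra.
- by apply: early; apply/andP; split; lra.
have rho0 : 0 < rho by lra.
have ppos' t : 0 < t < rho -> 0 < phi t.
  move=> /andP[t0 tr]; case: (ltP t d) => td; first by apply: early; rewrite t0.
  by apply: ppos; rewrite tr andbT; lra.
have vrho : 0 < v rho.
  apply: (flux_pos n_gt0 s rho0) => t /ppos' t0.
  by rewrite /clamp01 lt_max lt_min t0 ltr01 orbT.
pose P := rho ^+ n * v rho.
have P0 : 0 < P by rewrite mulr_gt0 ?exprn_gt0.
have dflux t : 0 < t -> is_derive t 1 (fun t : R => t ^+ n * v t) (t ^+ n * clamp01 (phi t)).
  by move=> t0; exact: (flux_deriv n_gt0 t0 (sol_v s t0)).
have fluxP t : rho <= t -> P <= t ^+ n * v t.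
  move=> rt; apply: (@nondecr_of_deriv R (fun t : R => t ^+ n * v t)
    (fun t => t ^+ n * clamp01 (phi t))) => // x /andP[x1 _].
    by apply: dflux; exact: lt_le_trans x1.
  by rewrite mulr_ge0 ?clamp01_ge0// exprn_ge0// ltW// (lt_trans rho0).
have vpos t : rho <= t -> 0 < v t.
  move=> rt; have t0 := lt_le_trans rho0 rt.
  by rewrite -(pmulr_rgt0 _ (exprn_gt0 n t0)); exact: lt_le_trans (fluxP t rt).
have pneg t : rho <= t -> phi t <= 0.
  move=> rt; rewrite -prho; apply: (value_nonincr s rho0 rt) => x /andP[x1 _].
  by apply/ltW/vpos/ltW.
have fluxE t : rho <= t -> t ^+ n * v t = P.
  move=> rt; apply/eqP; rewrite eq_le fluxP// andbT.
  apply: (@nonincr_of_deriv R (fun t : R => t ^+ n * v t)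
    (fun t => t ^+ n * clamp01 (phi t))) => // x /andP[x1 _].
    by apply: dflux; exact: lt_le_trans x1.
  by rewrite clamp01_neg ?mulr0// pneg// ltW.
have n10 : n.-1%:R != 0 :> R by rewrite pnatr_eq0 -lt0n -ltnS prednK.
have nE : n.-1%:R + 1 = n%:R :> R by rewrite natr1 prednK.
pose kappa := P / (n.-1%:R * rho ^+ n.-1).
have n1pos : 0 < n.-1%:R :> R by rewrite ltr0n -ltnS prednK.
have kappa0 : 0 < kappa by rewrite divr_gt0// mulr_gt0// exprn_gt0.
have phiE t : rho < t -> phi t = - kappa + P / (n.-1%:R * t ^+ n.-1).
  move=> rt; have t0 := lt_trans rho0 rt.
  pose f x := phi x - P / n.-1%:R * (x ^+ n.-1)^-1.
  have df x : rho <= x <= t -> is_derive x 1 f ((fun=> 0) x).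
    move=> /andP[x1 _]; have x0 := lt_le_trans rho0 x1.
    have xn0 : x ^+ n.-1 != 0 by rewrite expf_neq0// gt_eqF.
    apply: (is_derive_eq (deriv_sub (sol_u s x0) (deriv_mull (P / n.-1%:R)
      (@deriv_inv R (fun x : R => x ^+ n.-1) x _ xn0 (deriv_expr n.-1 x))))).
    have -> : v x = P / x ^+ n.
      by rewrite -(fluxE x x1) mulrC mulKf// expf_neq0// gt_eqF.
    have -> : x ^+ n = x * (x * x ^+ n.-2).
      by rewrite -!exprS !prednK// -ltnS prednK.
    have -> : x ^+ n.-1 = x * x ^+ n.-2 by rewrite -exprS prednK// -ltnS prednK.
    have xm : x ^+ n.-2 != 0 by rewrite expf_neq0// gt_eqF.
    have xn : x != 0 by rewrite gt_eqF.
    by field; rewrite ?n10 ?xm ?xn.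
  have [c _ e] := mean_value rt df.
  have : f t = f rho by apply/eqP; rewrite -subr_eq0 e mul0r.
  rewrite /f prho sub0r => e2.
  have -> : phi t = P / n.-1%:R / t ^+ n.-1 - P / n.-1%:R / rho ^+ n.-1 by lra.
  rewrite /kappa; field; rewrite n10 !expf_neq0// gt_eqF//.
exists kappa, phi, v; split=> // e e0.
pose S := Num.max (rho + 1) (Num.max 1 (P / e + 1)).
have [S1 S2 S3] : [/\ rho + 1 <= S, 1 <= S & P / e + 1 <= S].
  by rewrite /S !le_max !lexx !orbT.
have S0 : 0 < S by lra.
have small : P / S ^+ n.-1 < e.
  rewrite ltr_pdivrMr ?exprn_gt0// mulrC -ltr_pdivrMr//.
  apply: (@lt_le_trans _ _ S); first lra.
  by apply: ler_eXnr => //; rewrite -ltnS prednK.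
have rS : rho < S by lra.
have sp : 0 < P / S ^+ n.-1 by rewrite divr_gt0// exprn_gt0.
exists S => //; split.
- rewrite phiE// addrAC addNr add0r ger0_norm; last first.
    by rewrite divr_ge0 ?mulr_ge0 ?exprn_ge0// ltW.
  apply: le_lt_trans small; rewrite invfM mulrA mulrAC ler_pdivrMr//.
  by rewrite ler_peMr ?(ltW sp)// ler1n -ltnS prednK.
- have -> : S * v S = P / S ^+ n.-1.
    rewrite -(fluxE S (ltW rS)) -[in X in _ = X](prednK n_gt0) exprS /=.
    by field; rewrite expf_neq0// gt_eqF.
  by rewrite gtr0_norm.
Qed.

End Profile.

Section Arrival.
Variables (R : realType) (n : nat).
Hypothesis n_gt1 : (1 < n)%N.
Implicit Types (g F u v phi pv : R -> R) (a b beta c d r t s e m M kappa rho : R).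

Let n_gt0 : (0 < n)%N. Proof. exact: ltn_trans n_gt1. Qed.

Lemma late_flux_bound (G : R -> R) v M rho r : 0 < rho -> rho < r ->
  (forall t, rho <= t <= r -> is_derive t 1 v (G t - n%:R * v t / t)) ->
  (forall t, rho <= t <= r -> `|G t| <= M) ->
  r ^+ n * `|v r| <= rho ^+ n * `|v rho| + M * r ^+ n.+1.
Proof.
move=> rho0 rr dv gM.
have M0 : 0 <= M by apply: le_trans (normr_ge0 _) (gM rho _); rewrite lexx ltW.
have key (sg : R) : `|sg| = 1 -> r ^+ n * (sg * v r) <= rho ^+ n * `|v rho| + M * r ^+ n.+1.
  move=> sg1.
  pose f t := sg * (t ^+ n * v t) - M * t ^+ n.+1.
  have f1 : f r <= f rho.
    apply: (@nonincr_of_deriv R f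
      (fun t => sg * (t ^+ n * G t) - M * (n.+1%:R * t ^+ n)) _ _ (ltW rr)).
      move=> x /[dup] xI /andP[x1 _]; have x0 := lt_le_trans rho0 x1.
      exact (deriv_sub (deriv_mull sg (flux_deriv n_gt0 x0 (dv x xI)))
        (deriv_mull M (deriv_expr n.+1 x))).
    move=> x /andP[x1 x2]; have x0 := lt_trans rho0 x1.
    rewrite subr_le0.
    have -> : sg * (x ^+ n * G x) = x ^+ n * (sg * G x) by ring.
    have -> : M * (n.+1%:R * x ^+ n) = x ^+ n * (M * n.+1%:R) by ring.
    rewrite ler_pM2l ?exprn_gt0//; apply: le_trans (ler_norm _) _.
    rewrite normrM sg1 mul1r; apply: le_trans (gM x _) _; first by rewrite !ltW.
    by rewrite ler_peMr// ler1n.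
  have f2 : f rho <= rho ^+ n * `|v rho|.
    rewrite /f; have h : 0 <= M * rho ^+ n.+1 by rewrite mulr_ge0// exprn_ge0// ltW.
    have h2 : sg * (rho ^+ n * v rho) <= rho ^+ n * `|v rho|.
      apply: le_trans (ler_norm _) _.
      by rewrite !normrM sg1 mul1r (gtr0_norm (exprn_gt0 n rho0)).
    by apply: le_trans h2; rewrite gerBl.
  rewrite -lerBlDr; apply: le_trans f2; apply: le_trans f1; rewrite /f.
  by rewrite le_eqVlt; apply/orP; left; apply/eqP; ring.
case: (leP 0 (v r)) => vr.
- by have := key 1 (normr1 _); rewrite mul1r (ger0_norm vr).
- by have := key (-1) _; rewrite normrN1 mulN1r (ltr0_norm vr) => /(_ erefl).
Qed.

Lemma late_value_bound g A u v M rho r : sol n g A u v -> 0 < rho -> rho < r ->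
  (forall t, rho <= t -> `|g (u t)| <= M) ->
  `|u r - u rho| <= `|rho * v rho| + M * r ^+ 2.
Proof.
move=> s rho0 rr gM.
have M0 : 0 <= M by exact: le_trans (normr_ge0 _) (gM rho (lexx _)).
have r0 := lt_trans rho0 rr.
pose K := rho ^+ n * `|v rho|.
have K0 : 0 <= K by rewrite mulr_ge0// exprn_ge0// ltW.
have key (sg : R) : `|sg| = 1 -> sg * (u r - u rho) <= `|rho * v rho| + M * r ^+ 2.
  move=> sg1.
  pose f t := sg * u t + K * (t ^+ n.-1)^-1 - M * t ^+ 2.
  have f1 : f r <= f rho.
    apply: (@nonincr_of_deriv R f (fun t => sg * - v t +
      K * (- (n.-1%:R * t ^+ n.-2) / (t ^+ n.-1) ^+ 2) - M * (2%:R * t ^+ 1)) _ _ (ltW rr)).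
      move=> x /andP[x1 _]; have x0 := lt_le_trans rho0 x1.
      have xn0 : x ^+ n.-1 != 0 by rewrite expf_neq0// gt_eqF.
      exact (deriv_sub (deriv_add (deriv_mull sg (sol_u s x0)) (deriv_mull K
        (@deriv_inv R (fun x : R => x ^+ n.-1) x _ xn0 (deriv_expr n.-1 x))))
        (deriv_mull M (deriv_expr 2 x))).
    move=> x /andP[x1 _]; have x0 := lt_trans rho0 x1.
    have h : x ^+ n * `|v x| <= K + M * x ^+ n.+1.
      apply: (@late_flux_bound (fun t => g (u t))) => // t /andP[t1 _].
        by apply: (sol_v s); exact: lt_le_trans t1.
      exact: gM.
    have xn := exprn_gt0 n x0.
    have h1 : sg * - v x <= K / x ^+ n + M * x.
      apply: le_trans (ler_norm _) _; rewrite normrM sg1 mul1r normrN.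
      rewrite -(ler_pM2l xn); apply: le_trans h _.
      by rewrite exprS le_eqVlt; apply/orP; left; apply/eqP; field; rewrite gt_eqF.
    have h2 : K * (- (n.-1%:R * x ^+ n.-2) / (x ^+ n.-1) ^+ 2) <= - (K / x ^+ n).
      have e1 : x ^+ n.-1 = x * x ^+ n.-2 by rewrite -exprS prednK// -ltnS prednK.
      have e2 : x ^+ n = x * (x * x ^+ n.-2) by rewrite -e1 -exprS prednK.
      have xm : x ^+ n.-2 != 0 by rewrite expf_neq0// gt_eqF.
      have xx : x != 0 by rewrite gt_eqF.
      have -> : K * (- (n.-1%:R * x ^+ n.-2) / (x ^+ n.-1) ^+ 2) =
          - (n.-1%:R * (K / x ^+ n)).
        by rewrite e1 e2; field; rewrite ?xm ?xx.
      rewrite lerN2 ler_peMl ?divr_ge0 ?(ltW xn)//.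
      by rewrite ler1n -ltnS prednK.
    have h3 : 0 <= M * x by rewrite mulr_ge0// ltW.
    by rewrite expr1; lra.
  have f2 : K * (rho ^+ n.-1)^-1 = `|rho * v rho|.
    rewrite /K -[in X in X * _](prednK n_gt0) exprSr normrM (gtr0_norm rho0).
    by field; rewrite expf_neq0// gt_eqF.
  have h1 : 0 <= K * (r ^+ n.-1)^-1 by rewrite mulr_ge0// invr_ge0 exprn_ge0// ltW.
  have h2 : 0 <= M * rho ^+ 2 by rewrite mulr_ge0// exprn_ge0// ltW.
  rewrite -f2; move: f1; rewrite /f; lra.
case: (leP 0 (u r - u rho)) => ur.
- by rewrite -[`|u r - u rho|]mul1r (ger0_norm ur); apply: key; rewrite normr1.
- by rewrite (ltr0_norm ur) -mulN1r; apply: key; rewrite normrN1.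
Qed.

Definition agree_below g F (g' F' : R -> R) a :=
  forall s, s <= a -> g' s = g s /\ F' s = F s.

Lemma arrival_limit g F b beta M a c : shape g F b beta ->
  (forall s, `|g s| <= M) -> beta < a -> c < a ->
  (forall e, 0 < e -> exists g' F' A u v rho,
     [/\ shape g' F' b beta, agree_below g F g' F' a, b < A & sol n g' A u v] /\
     [/\ forall r, 0 < r -> 0 <= energy F' u v r, 0 < rho < e,
         `|u rho - c| < e & `|rho * v rho| < e]) ->
  ~ loses_energy n g F c.
Proof.
move=> gF gM ba ca H PP.
have [U UF Uoo] := ultra_above.
have /choice[x xP] : forall k : nat, exists x : (R -> R) * (R -> R) * R,
    [/\ 0 < x.2 < k.+1%:R^-1, `|x.2 * x.1.2 x.2| < k.+1%:R^-1,
      `|x.1.1 x.2 - c| < k.+1%:R^-1 &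
      exists g' F' A, [/\ shape g' F' b beta, agree_below g F g' F' a, b < A,
        sol n g' A x.1.1 x.1.2 & forall r, 0 < r -> 0 <= energy F' x.1.1 x.1.2 r]
      /\ forall t, x.2 <= t -> x.1.1 t <= a].
  move=> k; pose e := Num.min (k.+1%:R^-1) (a - c).
  have e0 : 0 < e by rewrite lt_min invr_gt0 ltr0n subr_gt0.
  have [e1 e2] : e <= k.+1%:R^-1 /\ e <= a - c by rewrite /e !ge_min !lexx orbT.
  have [g' [F' [A [u [v [rho [[sh ag bA s] [E rr uc vc]]]]]]]] := H e e0.
  have /andP[rho0 rhoe] := rr.
  exists ((u, v), rho) => /=; split.
  - by rewrite rho0 (lt_le_trans rhoe e1).
  - exact: lt_le_trans vc e1.
  - exact: lt_le_trans uc e1.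
  - exists g', F', A; split=> // t rt.
    apply: (value_stays n_gt0 sh s bA (ltW ba) rho0 _ rt).
    by have := ler_norm (u rho - c); lra.
pose u_ k := (x k).1.1; pose v_ k := (x k).1.2; pose rho k := (x k).2.
have rho0 k : 0 < rho k by have [/andP[]] := xP k.
have xk k : rho k < k.+1%:R^-1 by have [/andP[]] := xP k.
have gE k t : rho k <= t -> exists g' F' A, sol n g' A (u_ k) (v_ k) /\
    (g' (u_ k t) = g (u_ k t) /\ F' (u_ k t) = F (u_ k t)).
  move=> rt; have [_ _ _ [g' [F' [A [[sh ag bA s E] ua]]]]] := xP k.
  by exists g', F', A; split=> //; apply: ag; exact: ua.
have inv1 k : (k.+1%:R^-1 : R) <= 1 by rewrite invf_le1 ?ltr0n// ler1n.
have bounds k r : rho k < r ->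
    r ^+ n * `|v_ k r| <= M * r ^+ n.+1 + k.+1%:R^-1 /\
    `|u_ k r - c| <= M * r ^+ 2 + 2 * k.+1%:R^-1.
  move=> rr; have [_ vc uc [g' [F' [A [[sh ag bA s E] ua]]]]] := xP k.
  have g'M t : rho k <= t -> `|g' (u_ k t)| <= M.
    by move=> rt; rewrite (ag _ (ua t rt)).1.
  have h1 : r ^+ n * `|v_ k r| <= rho k ^+ n * `|v_ k (rho k)| + M * r ^+ n.+1.
    apply: (@late_flux_bound (fun t => g' (u_ k t))) => // t /andP[t1 _].
      by apply: (sol_v s); exact: lt_le_trans t1.
    exact: g'M.
  have h2 := late_value_bound s (rho0 k) rr g'M.
  rewrite -/(rho k) -/(u_ k) -/(v_ k) in vc uc h1 h2.
  split.
    apply: le_trans h1 _; rewrite addrC lerD2l.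
    apply: (@le_trans _ _ `|rho k * v_ k (rho k)|); last exact: ltW.
    rewrite normrM (gtr0_norm (rho0 k)) ler_wpM2r//.
    rewrite -(prednK n_gt0) exprS ler_piMr ?(ltW (rho0 k))//.
    by apply: exprn_ile1; [exact: ltW|exact: le_trans (ltW (xk k)) (inv1 k)].
  have := ler_normD (u_ k r - u_ k (rho k)) (u_ k (rho k) - c).
  have -> : u_ k r - u_ k (rho k) + (u_ k (rho k) - c) = u_ k r - c by ring.
  move: vc uc h2; clear; move: (k.+1%:R^-1) => i; lra.
have kU : (k.+1%:R^-1 : R) @[k --> U] --> (0 : R) by exact: ultra_inv.
have kU' e : 0 < e -> \forall k \near U, k.+1%:R^-1 < e.
  by move=> e0; exact: cvgr_lt kU _ e0.
have [|||||||||u [v [s lim]]] := @limit_sol R n U n_gt0 UF g (fun=> g) u_ v_ c rho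
  (fun k => 2 * k.+1%:R^-1) M M (shape_cont gF).
- by move=> k; exact: ltW.
- apply/cvgrPdist_lt => e e0; near=> k; rewrite sub0r normrN gtr0_norm//.
  apply: lt_trans (xk k) _; near: k; exact: kU'.
- have h : (2 * k.+1%:R^-1 : R) @[k --> U] --> (2 * 0 : R) by apply: cvgMr.
  by rewrite mulr0 in h.
- by move=> e e0; near=> k => t; rewrite subrr normr0 ltW.
- move=> k r rr; have [g' [F' [A [s _]]]] := gE k r (ltW rr).
  by apply: (sol_u s); exact: lt_trans rr.
- move=> k r rr; have [g' [F' [A [s [e _]]]]] := gE k r (ltW rr).
  by rewrite -e; apply: (sol_v s); exact: lt_trans rr.
- by move=> k r rr; exact: gM.
- by move=> k r /bounds[].
- move=> k r /bounds[h _]; apply: le_trans h _; rewrite lerD2l.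
  by rewrite ler_peMl ?invr_ge0// ler1n.
have [r r0 Er] := PP u v s.
have [uU vU] := lim r r0.
have Fc : continuous F by move=> y; exact: (deriv_cont (shape_prim gF y)).
suff : 0 <= energy F u v r by lra.
apply: (cvgr_to_ge (energy_cvg Fc uU vU)); near=> k.
have [_ _ _ [g' [F' [A [[sh ag bA sk E] ua]]]]] := xP k.
have rk : rho k < r.
  by apply: lt_trans (xk k) _; near: k; exact: kU'.
by have := E r r0; rewrite /energy (ag _ (ua r (ltW rk))).2.
Unshelve. all: by end_near. Qed.

End Arrival.

Section Drop.
Variables (R : realType) (n : nat).
Hypothesis n_gt1 : (1 < n)%N.
Implicit Types (g F u v phi pv : R -> R) (a b beta c d r t s e m M kappa rho : R).

Let n_gt0 : (0 < n)%N. Proof. exact: ltn_trans n_gt1. Qed.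

Definition steep g F b beta a d m (g' F' : R -> R) :=
  [/\ shape g' F' b beta, agree_below g F g' F' a &
      forall s, a <= s -> g' s = g a + m * (Num.min s (a + d) - a)].

Lemma steep_scaled g F b beta a d m (g' F' : R -> R) M s : 0 < d -> 0 < m ->
  (forall s, `|g s| <= M) -> steep g F b beta a d m g' F' ->
  `|m^-1 * g' s - d * clamp01 ((s - a) / d)| <= M / m.
Proof.
move=> d0 m0 gM [sh ag st].
have bnd t : `|m^-1 * g t| <= M / m.
  rewrite normrM gtr0_norm ?invr_gt0// mulrC; apply: ler_wpM2r => //.
  by rewrite invr_ge0; exact: ltW.
case: (leP s a) => sa.
  rewrite (ag s sa).1 clamp01_neg; last first.
    by rewrite ler_pdivrMr// mul0r subr_le0.
  by rewrite mulr0 subr0.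
rewrite (st s (ltW sa)).
have -> : d * clamp01 ((s - a) / d) = Num.min s (a + d) - a.
  case: (leP s (a + d)) => sd.
    rewrite clamp01_id; first by field; rewrite gt_eqF.
    apply/andP; split; last by rewrite ler_pdivrMr// mul1r lerBlDl.
    by apply: divr_ge0; [rewrite subr_ge0; exact: ltW|exact: ltW].
  rewrite clamp01_big; last by rewrite ler_pdivlMr// mul1r lerBrDl ltW.
  by rewrite mulr1; ring.
have -> : m^-1 * (g a + m * (Num.min s (a + d) - a)) - (Num.min s (a + d) - a) = m^-1 * g a.
  by field; rewrite gt_eqF.
exact: bnd.
Qed.

Lemma drop g F b beta M a d kappa phi pv : shape g F b beta ->
  (forall s, `|g s| <= M) -> beta < a -> 0 < d -> 0 < kappa ->
  sol n (@clamp01 R) 1 phi pv ->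
  (forall e, 0 < e -> exists2 S : R, 0 < S & `|phi S + kappa| < e /\ `|S * pv S| < e) ->
  loses_energy n g F (a - kappa * d) ->
  exists2 m0 : R, 0 < m0 & forall m, m0 <= m -> forall g' F' : R -> R,
    steep g F b beta a d m g' F' -> loses_energy n g' F' (a + d).
Proof.
move=> gF gM ba d0 kappa0 sphi tail PP; apply: contrapT => H.
have M0 : 0 <= M by exact: le_trans (normr_ge0 _) (gM 0).
have bb := shape_b_beta gF.
have [U UF Uoo] := ultra_above.
have /choice[x xP] : forall k : nat,
    exists x : R * ((R -> R) * (R -> R)) * ((R -> R) * (R -> R)),
    [/\ k.+1%:R <= x.1.1, steep g F b beta a d x.1.1 x.1.2.1 x.1.2.2,
      sol n x.1.2.1 (a + d) x.2.1 x.2.2 &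
      forall r, 0 < r -> 0 <= energy x.1.2.2 x.2.1 x.2.2 r].
  move=> k; apply: contrapT => K; apply: H; exists k.+1%:R => // m km g' F' st u v s.
  apply: contrapT => N; apply: K; exists ((m, (g', F')), (u, v)); split=> //= r r0.
  by rewrite leNgt; apply/negP => Er; apply: N; exists r.
pose m_ k := (x k).1.1; pose g_ k := (x k).1.2.1; pose F_ k := (x k).1.2.2.
pose u_ k := (x k).2.1; pose v_ k := (x k).2.2.
have m1 k : k.+1%:R <= m_ k by have [] := xP k.
have m0 k : 0 < m_ k by apply: lt_le_trans (m1 k).
have st k : steep g F b beta a d (m_ k) (g_ k) (F_ k) by have [] := xP k.
have s_ k : sol n (g_ k) (a + d) (u_ k) (v_ k) by have [] := xP k.
have minv k : (m_ k)^-1 <= k.+1%:R^-1 by rewrite lef_pV2 ?posrE.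
have minv1 k : (m_ k)^-1 <= 1.
  by apply: le_trans (minv k) _; rewrite invf_le1 ?ltr0n// ler1n.
pose la k := Num.sqrt (m_ k)^-1.
have la0 k : 0 < la k by rewrite sqrtr_gt0 invr_gt0.
have la2 k : la k ^+ 2 = (m_ k)^-1 by rewrite sqr_sqrtr// invr_ge0 ltW.
pose w_ k r := u_ k (la k * r); pose z_ k r := la k * v_ k (la k * r).
pose h_ k s := la k ^+ 2 * g_ k s.
pose h s := d * clamp01 ((s - a) / d).
have sw k : sol n (h_ k) (a + d) (w_ k) (z_ k) := sol_scale (la0 k) (s_ k).
have hcont : continuous h.
  move=> y; apply: cvgMr; apply: (@cvg_comp _ _ _ (fun s : R => (s - a) / d) (@clamp01 R)).
    by apply: cvgMl; apply: cvgB; [exact: cvg_id|exact: cvg_cst].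
  exact: clamp01_cont.
have hh k s : `|h_ k s - h s| <= M / m_ k.
  by rewrite /h_ la2; exact: (steep_scaled s d0 (m0 k) gM (st k)).
have hM k s : `|h_ k s| <= M + d.
  have h1 := hh k s; have h2 : `|h s| <= d.
    by rewrite normrM (gtr0_norm d0) ger0_norm ?clamp01_ge0// ler_piMr ?clamp01_le1// ltW.
  have h3 : M / m_ k <= M by rewrite ler_piMr.
  have := ler_normD (h_ k s - h s) (h s); rewrite subrK; lra.
have invU : (k.+1%:R^-1 : R) @[k --> U] --> (0 : R) by exact: ultra_inv.
have invU' e : 0 < e -> \forall k \near U, k.+1%:R^-1 < e.
  by move=> e0; exact: cvgr_lt invU _ e0.
have [|||||||||w [z [sw' lim]]] := @limit_sol R n U n_gt0 UF h h_ w_ z_ (a + d) (fun=> 0)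
  (fun=> 0) (M + d) (M + d) hcont.
- by [].
- exact: cvg_cst.
- exact: cvg_cst.
- move=> e e0; near=> k => s; apply: le_trans (hh k s) _.
  apply: (@le_trans _ _ ((M + 1) * k.+1%:R^-1)).
    by apply: ler_pM => //; [rewrite invr_ge0 ltW|lra].
  rewrite mulrC -ler_pdivlMr; last lra.
  have : k.+1%:R^-1 < e / (M + 1).
    by near: k; apply: invU'; rewrite divr_gt0//; lra.
  exact: ltW.
- by move=> k r /= r0; exact: (sol_u (sw k) r0).
- by move=> k r /= r0; exact: (sol_v (sw k) r0).
- by move=> k r _; exact: hM.
- by move=> k r /= r0; rewrite addr0; exact: (value_bound n_gt0 (sw k) (hM k) r0).
- move=> k r /= r0; rewrite addr0.
  have q := speed_bound n_gt0 (sw k) (hM k) r0.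
  have -> : (M + d) * r ^+ n.+1 = r ^+ n * ((M + d) * r) by rewrite exprSr; ring.
  rewrite ler_pM2l ?exprn_gt0//; apply: le_trans q _.
  rewrite ler_pdivrMr ?ltr0n// ler_peMr ?ler1n// mulr_ge0// ?ltW//; lra.
have dne : d != 0 by rewrite gt_eqF.
have sw2 := @sol_affine R n h (a + d) w z a d dne sw'.
have sw3 : sol n (@clamp01 R) 1 (fun r => (w r - a) / d) (fun r => z r / d).
  have e1 : (a + d - a) / d = 1 by field.
  have e2 : (fun s => h (a + d * s) / d) = @clamp01 R.
    apply/funext => s; rewrite /h.
    have -> : (a + d * s - a) / d = s by field.
    by field.
  by rewrite e1 e2 in sw2.
have same S : 0 < S -> (w S = a + d * phi S) /\ z S = d * pv S.
  move=> S0; have [|||e1 e2] := @sol_unique R n (@clamp01 R) 1 _ _ phi pv 1 (S + 1) sw3 sphi _ _ S.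
  - exact: ler01.
  - by move=> t _; rewrite mul1r clamp01_lip.
  - by rewrite S0 ltrDl ltr01.
  by rewrite -e1 -e2; split; field.
apply: (@arrival_limit R n n_gt1 g F b beta M a (a - kappa * d) gF gM ba _ _ PP).
  by rewrite ltrBlDr ltrDl mulr_gt0.
move=> e e0.
have [|S S0 [t1 t2]] := tail (e / (2 * d)); first by rewrite divr_gt0// mulr_gt0.
have [wU zU] := lim S S0; have [wE zE] := same S S0.
have e20 : 0 < e / 2 by rewrite divr_gt0.
have e3 : e / (2 * d) = e / 2 / d by field.
have [k [k1 k2 k3]] : exists k, [/\ `|w_ k S - w S| < e / 2, `|z_ k S - z S| < e / 2 / S &
    k.+1%:R^-1 < (e / S) ^+ 2].
  apply: (@filter_ex _ U); near=> k; split; near: k.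
  - by move/cvgrPdistC_lt : wU; apply.
  - by move/cvgrPdistC_lt : zU; apply; rewrite divr_gt0.
  - by apply: invU'; rewrite exprn_gt0// divr_gt0.
have [sh ag _] := st k.
exists (g_ k), (F_ k), (a + d), (u_ k), (v_ k), (la k * S); split.
  by split=> //; rewrite (lt_trans bb)// (lt_trans ba)// ltrDl.
split.
- by have [] := xP k.
- rewrite mulr_gt0//= -ltr_pdivlMr//.
  rewrite -(ltr_pXn2r (n := 2))// ?nnegrE ?divr_ge0 ?ltW// la2.
  exact: le_lt_trans (minv k) k3.
- rewrite -/(w_ k S).
  have -> : w_ k S - (a - kappa * d) = (w_ k S - w S) + d * (phi S + kappa).
    by rewrite wE; ring.
  have : `|d * (phi S + kappa)| < e / 2.
    by rewrite normrM (gtr0_norm d0) mulrC -ltr_pdivlMr// -e3.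
  move=> q1; rewrite [e]splitr; apply: le_lt_trans (ler_normD _ _) _; exact: ltrD.
- have -> : la k * S * v_ k (la k * S) = S * (z_ k S - z S) + d * (S * pv S).
    by rewrite zE /z_; ring.
  have q1 : `|d * (S * pv S)| < e / 2.
    by rewrite normrM (gtr0_norm d0) mulrC -ltr_pdivlMr// -e3.
  have q2 : `|S * (z_ k S - z S)| < e / 2.
    by rewrite normrM (gtr0_norm S0) mulrC -ltr_pdivlMr.
  rewrite [e]splitr; apply: le_lt_trans (ler_normD _ _) _; exact: ltrD.
Unshelve. all: by end_near. Qed.

End Drop.

(** * Gentle ramps *)

Section SlowStart.
Variables (R : realType) (n : nat).
Hypothesis n_gt0 : (0 < n)%N.
Implicit Types (g F u v : R -> R) (a b beta c d r t s e q M L x y w : R).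

Lemma prim_affine_bound g F a c M : (forall s, is_derive s 1 F (g s)) -> a <= c ->
  (forall s, a <= s <= c -> g s <= M) -> F c <= F a + M * (c - a).
Proof.
move=> FP ac gM.
have := @nonincr_of_deriv R (fun s => F s - M * s) (fun s => g s - M * 1) a c ac.
move=> h; have : F c - M * c <= F a - M * a.
  apply: h => x /andP[x1 x2].
  by rewrite mulr1 subr_le0 gM// !ltW.
lra.
Qed.

(* Gronwall-type bound for the descent from a level [t] where [g] is at most [q]. *)
Lemma slow_descent g t u v q L r : sol n g t u v -> 0 < q -> 0 < L ->
  (forall s, s <= t -> g s <= q + L * (t - s)) -> 0 < r ->
  (forall x, 0 < x < r -> 0 <= v x) ->
  q + L * (t - u r) <= q * expR (L * r ^+ 2).
Proof.
move=> s q0 L0 gq r0 v0.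
pose y x := (q + L * (t - u x)) * expR (- (L * x ^+ 2)).
have dexp x : is_derive x 1 (fun x : R => expR (- (L * x ^+ 2)))
    (expR (- (L * x ^+ 2)) * - (L * (2%:R * x ^+ 1))).
  exact (@deriv_comp R expR (fun x : R => - (L * x ^+ 2)) x _ _
    (is_derive_expR _) (deriv_opp (deriv_mull L (deriv_expr 2 x)))).
pose dy x := (0 + L * (0 - - v x)) * expR (- (L * x ^+ 2)) +
  (q + L * (t - u x)) * (expR (- (L * x ^+ 2)) * - (L * (2%:R * x ^+ 1))).
have yd x : 0 < x -> is_derive x 1 y (dy x).
  move=> x0; exact (deriv_mul (deriv_add (deriv_cst q x)
    (deriv_mull L (deriv_sub (deriv_cst t x) (sol_u s x0)))) (dexp x)).
have ut x : 0 < x -> x <= r -> u x <= t.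
  move=> x0 xr; apply: (value_le_init s x0) => w /andP[w0 wx].
  by apply: v0; rewrite w0 (lt_le_trans wx xr).
have dy0 x : 0 < x < r -> dy x <= 0.
  move=> /andP[x0 xr].
  have vx : v x <= (q + L * (t - u x)) * x / n.+1%:R.
    apply: (flux_le n_gt0 s x0) => w /andP[w0 wx].
    have wr := lt_trans wx xr.
    apply: le_trans (gq _ (ut w w0 (ltW wr))) _.
    rewrite lerD2l ler_pM2l// lerD2l lerN2.
    apply: (value_nonincr s w0 (ltW wx)) => z /andP[z1 z2]; apply: v0.
    by rewrite (lt_trans w0 z1) (lt_trans z2 xr).
  have Q0 : 0 <= q + L * (t - u x).
    apply: addr_ge0; first exact: ltW.
    by apply: mulr_ge0; [exact: ltW|rewrite subr_ge0; apply: ut => //; exact: ltW].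
  have vx2 : v x <= (q + L * (t - u x)) * x.
    apply: le_trans vx _; rewrite ler_pdivrMr ?ltr0n// ler_peMr ?ler1n//.
    by rewrite mulr_ge0// ltW.
  have -> : dy x = (v x - 2 * ((q + L * (t - u x)) * x)) * (L * expR (- (L * x ^+ 2))).
    by rewrite /dy expr1; ring.
  apply: mulr_le0_ge0; last by rewrite mulr_ge0 ?expR_ge0// ltW.
  have : 0 <= (q + L * (t - u x)) * x by rewrite mulr_ge0// ltW.
  lra.
have ylim : y x @[x --> 0^'+] --> (q + L * (t - t)) * expR (- (L * 0 ^+ 2)).
  apply: cvgM; last by apply: cvg_at_right_filter; exact: (deriv_cont (dexp 0)).
  apply: cvgD; first exact: cvg_cst.
  apply: cvgMr; apply: cvgB; [exact: cvg_cst|exact: sol_u0 s].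
rewrite subrr mulr0 addr0 expr0n mulr0 oppr0 expR0 mulr1 in ylim.
have : y r <= q.
  apply: (lim0_ge r0 ylim) => x /andP[x0 xr].
  apply: (@nonincr_of_deriv R y dy _ _ (ltW xr)) => w /andP[w1 w2].
    by apply: yd; exact: lt_le_trans w1.
  by apply: dy0; rewrite (lt_trans x0 w1).
by rewrite /y expRN ler_pdivrMr ?expR_gt0.
Qed.

Lemma slow_start g F b beta M a e : shape g F b beta -> (forall s, `|g s| <= M) ->
  beta < a -> 0 < e ->
  exists2 q0 : R, 0 < q0 & forall q, 0 < q <= q0 -> forall g' F' : R -> R,
    shape g' F' b beta -> agree_below g F g' F' a ->
    (forall s, a <= s <= a + e -> g' s = g a + (s - a) / e * (q - g a)) ->
    crosses n g' (a + e).
Proof.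
move=> gF gM ba e0.
have b0 := shape_b_gt0 gF; have bb := shape_b_beta gF.
have ga : 0 < g a by apply: (shape_gtb gF); lra.
have M0 : 0 < M by apply: lt_le_trans ga _; exact: le_trans (ler_norm _) (gM a).
have Fa : 0 < F a by exact: (potential_gt gF).
have [B B0 FB] : exists2 B : R, 0 <= B & forall s, s <= a -> - B <= F s.
  have a0 : 0 <= a by lra.
  have [|m _ mP] := @EVT_min R F 0 a a0.
    by apply: continuous_subspaceT => x; exact: (deriv_cont (shape_prim gF x)).
  exists `|F m| => // s sa; have [s0|s0] := leP s 0.
    by rewrite (shape_F_le0 gF s0) oppr_le0.
  have := mP s; rewrite in_itv /= sa ltW// => /(_ isT).
  by have := ler_norm (- F m); rewrite normrN; lra.
pose t := a + e.
have t0 : 0 < t by rewrite /t; lra.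
pose C := 1 + 2 * (F a + e * M + B).
have C1 : 1 <= C.
  by rewrite /C lerDl mulr_ge0// addr_ge0// addr_ge0 ?ltW// mulr_gt0.
have C0 : 0 < C by lra.
have n0 : 0 < n%:R :> R by rewrite ltr0n.
pose S := 4 * n%:R * C * t / F a.
have S0 : 0 < S by rewrite divr_gt0// !mulr_gt0.
pose L := M / e.
have L0 : 0 < L by rewrite divr_gt0.
pose X := expR (L * S ^+ 2).
have X0 : 0 < X by rewrite expR_gt0.
pose q0 := Num.min M (F a * L / (4 * n%:R * M * X)).
have q00 : 0 < q0.
  rewrite lt_min M0 /=; apply: divr_gt0; first exact: mulr_gt0.
  by apply: mulr_gt0 => //; apply: mulr_gt0 => //; apply: mulr_gt0.
exists q0 => // q /andP[qpos qq0] g' F' sh ag aff u v s.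
have [qM qs] : q <= M /\ q <= F a * L / (4 * n%:R * M * X).
  by move: qq0; rewrite /q0 le_min => /andP[].
apply: contrapT => N.
have up r : 0 < r -> 0 <= u r.
  by move=> r0; rewrite leNgt; apply/negP => ur; apply: N; exists r.
have bt : b < t by rewrite /t; lra.
have ut r : 0 < r -> u r <= t by exact: (sol_le sh s (ltW bt)).
have g'aff x : a <= x <= t -> 0 <= (x - a) / e <= 1.
  move=> /andP[x1 x2]; apply/andP; split.
    by apply: divr_ge0; [rewrite subr_ge0|exact: ltW].
  by rewrite ler_pdivrMr// mul1r lerBlDl.
have gaM : g a <= M by exact: le_trans (ler_norm _) (gM a).
have g'M x : x <= t -> g' x <= M.
  move=> xt; case: (leP x a) => xa.
    by rewrite (ag x xa).1; exact: le_trans (ler_norm _) (gM x).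
  have xI : a <= x <= t by rewrite ltW.
  rewrite aff//; have /andP[l0 l1] := g'aff x xI; nra.
have g'L x : x <= t -> g' x <= q + L * (t - x).
  move=> xt; case: (leP x a) => xa.
    apply: le_trans (g'M x xt) _.
    have h : M <= L * (t - x).
      apply: (@le_trans _ _ (L * e)); first by rewrite /L divfK// gt_eqF.
      by rewrite ler_pM2l// /t; lra.
    lra.
  have xI : a <= x <= t by rewrite ltW.
  rewrite aff//; have /andP[l0 l1] := g'aff x xI.
  have -> : L * (t - x) = M * (1 - (x - a) / e).
    by rewrite /L /t; field; rewrite gt_eqF.
  nra.
have F't : F a <= F' t <= F a + e * M.
  have F'a : F' a = F a by have [] := ag a (lexx _).
  have at_ : a <= t by rewrite /t; lra.
  rewrite -F'a; apply/andP; split.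
    apply: (nondecr_of_deriv at_) => x /andP[x1 x2]; first exact: shape_prim sh x.
    by apply/ltW/(shape_gtb sh); lra.
  have := prim_affine_bound (shape_prim sh) at_ (M := M).
  have -> : M * (t - a) = e * M by rewrite /t; ring.
  by apply => x /andP[_ x2]; exact: g'M.
have F'B x : x <= t -> - B <= F' x.
  move=> xt; case: (leP x a) => xa; first by rewrite (ag x xa).2 FB.
  have : 0 < F' x by apply: (potential_gt sh); lra.
  lra.
have vC r : 0 < r -> `|v r| <= C.
  move=> r0; have h1 := energy_le (shape_prim sh) s r0.
  have h2 := F'B _ (ut r r0); have /andP[_ h3] := F't.
  rewrite -(ler_pXn2r (n := 2)) ?nnegrE ?(ltW C0)// real_normK ?num_real//.
  have h4 : v r ^+ 2 <= C.
    move: h1; rewrite /energy /C; move: h2 h3; clear.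
    move: (F' _) (F' _) (v r ^+ 2) (e * M) (F a) => *; lra.
  apply: le_trans h4 _; rewrite expr2 ler_peMr// ltW//.
have vM r : 0 < r -> v r <= M * r.
  move=> r0; apply: le_trans (flux_le n_gt0 s r0 (B := M) _) _.
    by move=> x /andP[x0 _]; apply: g'M; exact: ut.
  by rewrite ler_pdivrMr ?ltr0n// ler_peMr ?ler1n// mulr_ge0 ?ltW.
pose E := energy F' u v.
have dE x : 0 < x -> is_derive x 1 E (- (n%:R * v x ^+ 2 / x)).
  by move=> x0; exact: (energy_deriv (shape_prim sh) s x0).
have early r : 0 < r -> r <= S -> (forall x, 0 < x < r -> 0 <= v x) -> 3 / 4 * F a <= E r.
  move=> r0 rS v0.
  have z1 : q + L * (t - u r) <= q * expR (L * r ^+ 2).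
    exact: (slow_descent s qpos L0 g'L r0 v0).
  have z2 : L * (t - u r) <= q * X.
    have h : expR (L * r ^+ 2) <= X.
      by rewrite /X ler_expR ler_pM2l// lerXn2r// nnegrE ltW.
    have : q * expR (L * r ^+ 2) <= q * X by rewrite ler_pM2l.
    lra.
  have z3 : n%:R * M * (t - u r) <= F a / 4.
    have h : q * X <= F a * L / (4 * n%:R * M).
      rewrite -ler_pdivlMr//; apply: le_trans qs _.
      by rewrite le_eqVlt; apply/orP; left; apply/eqP; field; rewrite ?gt_eqF.
    have h2 := le_trans z2 h.
    rewrite mulrC -ler_pdivlMr ?mulr_gt0//.
    rewrite -(ler_pM2l L0); apply: le_trans h2 _.
    by rewrite le_eqVlt; apply/orP; left; apply/eqP; field; rewrite ?gt_eqF.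
  have key : F' t - n%:R * M * t <= E r - n%:R * M * u r.
    have lim : (E x - n%:R * M * u x) @[x --> 0^'+] --> F' t - n%:R * M * t.
      apply: cvgB; first exact: (energy_lim (shape_prim sh) s).
      by apply: cvgMr; exact: sol_u0 s.
    apply: (lim0_le r0 lim) => x /andP[x0 xr].
    apply: (@nondecr_of_deriv R (fun x => E x - n%:R * M * u x)
      (fun x => - (n%:R * v x ^+ 2 / x) - n%:R * M * - v x) _ _ (ltW xr)).
      move=> y /andP[y1 _]; have y0 := lt_le_trans x0 y1.
      exact (deriv_sub (dE y y0) (deriv_mull _ (sol_u s y0))).
    move=> y /andP[y1 y2]; have y0 := lt_trans x0 y1.
    have -> : - (n%:R * v y ^+ 2 / y) - n%:R * M * - v y = n%:R * v y * (M - v y / y).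
      by field; rewrite gt_eqF.
    apply: mulr_ge0; first by rewrite mulr_ge0// v0// y0.
    by rewrite subr_ge0 ler_pdivrMr// vM.
  have /andP[Ft _] := F't.
  have : n%:R * M * (t - u r) = n%:R * M * t - n%:R * M * u r by ring.
  move: z3 key Ft; clear; move: (E r) (F' t) => *; lra.
have all_r r : 0 < r -> (forall x, 0 < x < r -> 0 <= v x) -> F a / 2 <= E r.
  move=> r0 v0; case: (leP r S) => rS.
    by have := early r r0 rS v0; lra.
  have ES : 3 / 4 * F a <= E S.
    by apply: early => // x /andP[x0 xS]; apply: v0; rewrite x0 (lt_trans xS rS).
  have : E S - n%:R * C / S * u S <= E r - n%:R * C / S * u r.
    apply: (@nondecr_of_deriv R (fun x => E x - n%:R * C / S * u x)
      (fun x => - (n%:R * v x ^+ 2 / x) - n%:R * C / S * - v x) _ _ (ltW rS)).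
      move=> y /andP[y1 _]; have y0 := lt_le_trans S0 y1.
      exact (deriv_sub (dE y y0) (deriv_mull _ (sol_u s y0))).
    move=> y /andP[y1 y2]; have y0 := lt_trans S0 y1.
    have -> : - (n%:R * v y ^+ 2 / y) - n%:R * C / S * - v y = n%:R * v y * (C / S - v y / y).
      by field; rewrite !gt_eqF.
    apply: mulr_ge0; first by rewrite mulr_ge0// v0// y0.
    rewrite subr_ge0; apply: ler_pM.
    - by apply: v0; rewrite y0.
    - by rewrite invr_ge0 ltW.
    - exact: le_trans (ler_norm _) (vC y y0).
    - by rewrite lef_pV2 ?posrE// ltW.
  have K0 : 0 <= n%:R * C / S by apply/ltW; apply: divr_gt0 => //; exact: mulr_gt0.
  have h1 : n%:R * C / S * u S <= F a / 4.
    apply: (@le_trans _ _ (n%:R * C / S * t)).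
      by apply: ler_wpM2l => //; exact: ut.
    by rewrite /S le_eqVlt; apply/orP; left; apply/eqP; field; rewrite ?gt_eqF.
  have h2 : 0 <= n%:R * C / S * u r.
    by apply: mulr_ge0 => //; exact: up.
  move: ES h1 h2; clear; move: (E r) (E S) => *; lra.
have vpos r : 0 < r -> 0 < v r.
  move=> r0; rewrite ltNge; apply/negP => vr.
  have [r1 /andP[r10 _] [vr1 v1 ur1]] := turning_point n_gt0 sh s bt r0 vr.
  have : F a / 2 <= E r1 by apply: all_r => // x /v1/ltW.
  rewrite /E /energy vr1 expr0n mul0r add0r.
  have : F' (u r1) <= 0 by apply: (potential_le sh); lra.
  lra.
have [r1 r10 ur1] := reaches_below_beta n_gt0 sh s bt vpos up.
have m0 : 0 < Num.min 1 (F a) by rewrite lt_min ltr01.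
apply: (no_uniform_speed s m0 r10 up) => r rr.
have r0 := lt_le_trans r10 rr.
have h1 : F a / 2 <= E r by apply: all_r => // x /andP[/vpos/ltW].
have h2 : F' (u r) <= 0.
  apply: (potential_le sh); apply: ltW; apply: le_lt_trans ur1.
  by apply: (value_nonincr s r10 rr) => x /andP[x1 _]; apply/ltW/vpos/(lt_trans r10).
have h3 : F a <= v r ^+ 2 by move: h1; rewrite /E /energy; lra.
rewrite ge_min; case: (leP 1 (v r)) => //= v1.
apply: le_trans h3 _; rewrite expr2 ler_piMr ?ltW//; exact: vpos.
Qed.

End SlowStart.

(** * Gluing nonlinearities *)

Section Glue.
Variable R : realType.
Implicit Types (g F h : R -> R) (a b beta s t x y d Q T M : R).
Notation mu := (@lebesgue_measure R).

Lemma prim_exists g : continuous g -> (forall s, s <= 0 -> g s = 0) ->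
  exists2 F : R -> R, forall s, is_derive s 1 F (g s) & forall s, s <= 0 -> F s = 0.
Proof.
move=> gc g0.
pose H y := (\int[mu]_(t in `[(-1)%R, y]) g t)%R.
have dH x : -1 < x -> is_derive x 1 H (g x).
  move=> x1; have [||||d e] := @continuous_FTC1_closed R g (-1) x (x + 1).
  - by rewrite ltrDl.
  - apply: continuous_compact_integrable; first exact: segment_compact.
    exact: continuous_subspaceT.
  - exact: x1.
  - exact: gc.
  - exact (DeriveDef d (etrans (esym (derive1E H x)) e)).
have H0 y : -1 < y -> y <= 0 -> H y = H 0.
  move=> y1; rewrite le_eqVlt => /predU1P[-> //|y0].
  have [x /andP[x1 _]|c /andP[_ c0] e] := @mean_value R H g y 0 y0.
    by apply: dH; exact: lt_le_trans x1.
  by apply/eqP; rewrite eq_sym -subr_eq0 e g0 ?mul0r// ltW.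
pose F x := if x <= 0 then 0 else H x - H 0.
have FE y : -1 < y -> F y = H y - H 0.
  by move=> y1; rewrite /F; case: ifP => // y0; rewrite H0// subrr.
exists F => [s|s s0]; last by rewrite /F s0.
case: (ltP s 0) => s0.
  rewrite (g0 s (ltW s0)); apply: (@deriv_eq_near _ (fun=> 0) F s (- s) 0).
  - by rewrite oppr_gt0.
  - move=> y; rewrite ltr_norml => /andP[_ h]; rewrite /F.
    by have -> : y <= 0 by lra.
have d := dH s ltac:(lra).
have d2 : is_derive s 1 (fun y => H y - H 0) (g s - 0).
  exact (deriv_sub d (deriv_cst (H 0) s)).
rewrite subr0 in d2; apply: (deriv_eq_near (e := 1) _ _ d2) => // y.
by rewrite ltr_norml => /andP[h _]; rewrite FE//; lra.
Qed.

Lemma min_cst_cont a : continuous (fun s : R => Num.min s a).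
Proof. by move=> x; apply: continuous_min; [exact: cvg_id|exact: cvg_cst]. Qed.

Lemma max_cst_cont a : continuous (fun s : R => Num.max s a).
Proof. by move=> x; apply: continuous_max; [exact: cvg_id|exact: cvg_cst]. Qed.

Definition glue g a h s := if s <= a then g s else h s.

Lemma glue_le g a h s : s <= a -> glue g a h s = g s.
Proof. by rewrite /glue => ->. Qed.

Lemma glue_ge g a h s : h a = g a -> a <= s -> glue g a h s = h s.
Proof.
move=> ha; rewrite le_eqVlt => /predU1P[<-|sa]; first by rewrite /glue lexx.
by rewrite /glue leNgt sa.
Qed.

Lemma glue_cont g a h : continuous g -> continuous h -> h a = g a ->
  continuous (glue g a h).
Proof.
move=> gc hc ha.
have -> : glue g a h = (fun s => g (Num.min s a) + (h (Num.max s a) - h a)).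
  apply/funext => s; rewrite /glue; case: leP => sa.
    by rewrite subrr addr0.
  by rewrite ha addrCA subrr addr0.
move=> x; apply: cvgD.
  apply: (@cvg_comp _ _ _ (fun s => Num.min s a) g); last exact: gc.
  exact: min_cst_cont.
apply: cvgB; last exact: cvg_cst.
apply: (@cvg_comp _ _ _ (fun s => Num.max s a) h); last exact: hc.
exact: max_cst_cont.
Qed.

Lemma shape_glue g F b beta a h : shape g F b beta -> beta < a ->
  continuous h -> h a = g a -> (forall s, a <= s -> 0 < h s) ->
  exists2 F' : R -> R, shape (glue g a h) F' b beta & agree_below g F (glue g a h) F' a.
Proof.
move=> gF ba hc ha hpos.
have b0 := shape_b_gt0 gF; have bb := shape_b_beta gF.
have gc := glue_cont (shape_cont gF) hc ha.
have g0 s : s <= 0 -> glue g a h s = 0.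
  by move=> s0; rewrite glue_le ?(shape_le0 gF)//; lra.
have [F' F'P F'0] := prim_exists gc g0.
have FE s : s <= a -> F' s = F s.
  move=> sa; case: (leP s 0) => s0; first by rewrite F'0// (shape_F_le0 gF).
  have [x /andP[x1 x2]|c /andP[c1 c2] e] := @mean_value R (fun x => F' x - F x)
      (fun x => glue g a h x - g x) 0 s s0.
    exact (deriv_sub (F'P x) (shape_prim gF x)).
  move: e; rewrite glue_le; last by lra.
  rewrite subrr mul0r (F'0 0 (lexx 0)) (shape_F_le0 gF (lexx 0)) subrr subr0.
  by move/eqP; rewrite subr_eq0 => /eqP.
exists F'; last by move=> s sa; split; [rewrite glue_le|exact: FE].
split=> //.
- by move=> s sb; rewrite glue_le ?(shape_leb gF)//; lra.
- move=> s sb; case: (leP s a) => sa; first by rewrite glue_le// (shape_gtb gF).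
  by rewrite glue_ge ?hpos// ltW.
- by move=> s /[dup] sI /andP[_ sb]; rewrite FE ?(shape_F_lt gF)//; lra.
- by rewrite FE ?(shape_F_beta gF)// ltW.
Qed.

Definition ramp g a d Q := glue g a (fun s => g a + (Num.min s (a + d) - a) * ((Q - g a) / d)).

Lemma ramp_ge g a d Q s : 0 < d -> a <= s ->
  ramp g a d Q s = g a + (Num.min s (a + d) - a) * ((Q - g a) / d).
Proof.
move=> d0 sa; rewrite /ramp glue_ge//.
by rewrite min_l ?subrr ?mul0r ?addr0// lerDl ltW.
Qed.

Lemma ramp_end g a d Q s : 0 < d -> a + d <= s -> ramp g a d Q s = Q.
Proof.
move=> d0 sa; rewrite ramp_ge//; last by lra.
by rewrite min_r//; field; rewrite gt_eqF.
Qed.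

Lemma shape_ramp g F b beta a d Q : shape g F b beta -> beta < a -> 0 < d -> 0 < Q ->
  exists2 F' : R -> R, shape (ramp g a d Q) F' b beta & agree_below g F (ramp g a d Q) F' a.
Proof.
move=> gF ba d0 Q0.
have ga : 0 < g a by apply: (shape_gtb gF); exact: lt_trans (shape_b_beta gF) ba.
apply: shape_glue => //.
- move=> x; apply: cvgD; first exact: cvg_cst.
  apply: cvgMl; apply: cvgB; last exact: cvg_cst.
  exact: min_cst_cont.
- by rewrite min_l ?subrr ?mul0r ?addr0// lerDl ltW.
- move=> s sa; set w := Num.min _ _.
  have w1 : a <= w by rewrite /w le_min sa lerDl ltW.
  have w2 : w <= a + d by rewrite /w ge_min lexx orbT.
  have -> : g a + (w - a) * ((Q - g a) / d) = (1 - (w - a) / d) * g a + (w - a) / d * Q.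
    by field; rewrite gt_eqF.
  have l0 : 0 <= (w - a) / d by apply: divr_ge0; [rewrite subr_ge0|exact: ltW].
  have l1 : (w - a) / d <= 1 by rewrite ler_pdivrMr// mul1r; lra.
  case: (ltP ((w - a) / d) 1) => l2; last first.
    have -> : (w - a) / d = 1 by lra.
    by rewrite subrr mul0r add0r mul1r.
  by apply: ltr_wpDr; [rewrite mulr_ge0// ltW|rewrite mulr_gt0// subr_gt0].
Qed.

Lemma bounded_of_flat g T : continuous g -> (forall s, s <= 0 -> g s = 0) ->
  (forall s, T <= s -> g s = g T) -> exists M : R, forall s, `|g s| <= M.
Proof.
move=> gc g0 gT.
pose T' := Num.max 0 T.
have T'0 : 0 <= T' by rewrite le_max lexx.
have TT' : T <= T' by rewrite le_max lexx orbT.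
have [|c _ cP] := @EVT_max R (fun s => `|g s|) 0 T' T'0.
  by apply: continuous_subspaceT => x; apply: cvg_norm; exact: gc.
exists `|g c| => s; case: (leP s 0) => s0; first by rewrite g0// normr0.
case: (leP s T') => sT; first by apply: cP; rewrite in_itv /= sT ltW.
rewrite gT; last by exact: le_trans (ltW sT).
by rewrite -(gT T' TT'); apply: cP; rewrite in_itv /= T'0 lexx.
Qed.

Section Transfer.
Variable n : nat.
Variables (g F g' F' : R -> R) (b beta a : R).
Hypothesis gF : shape g F b beta.
Hypothesis ag : agree_below g F g' F' a.

Lemma sol_transfer x u v : b <= x -> x <= a -> sol n g x u v -> sol n g' x u v.
Proof.
move=> bx xa s; split.
- exact: sol_u s.
- move=> r r0; rewrite (ag _).1; first exact: sol_v s r r0.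
  exact: le_trans (sol_le gF s bx r0) xa.
- exact: sol_u0 s.
- exact: sol_v0 s.
Qed.

Lemma energy_transfer x u v r : b <= x -> x <= a -> sol n g x u v -> 0 < r ->
  energy F' u v r = energy F u v r.
Proof.
move=> bx xa s r0; rewrite /energy (ag _).2//.
exact: le_trans (sol_le gF s bx r0) xa.
Qed.

Lemma good_transfer x : b <= x -> x <= a -> has_good n g F x -> has_good n g' F' x.
Proof.
move=> bx xa [u [v [s H]]]; exists u, v; split; first exact: (sol_transfer bx xa s).
by move=> r r0; rewrite (energy_transfer bx xa s r0); exact: H.
Qed.

End Transfer.

Lemma agree_below_sym g F g' F' a : agree_below g F g' F' a -> agree_below g' F' g F a.
Proof. by move=> ag s sa; have [-> ->] := ag s sa. Qed.

Lemma crosses_transfer n g F g' F' b beta a x : shape g' F' b beta ->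
  agree_below g F g' F' a -> b <= x -> x <= a -> crosses n g x -> crosses n g' x.
Proof.
move=> sh ag bx xa c u v s; apply: c.
exact: (sol_transfer sh (agree_below_sym ag) bx xa s).
Qed.

Lemma loses_energy_transfer n g F g' F' b beta a x : shape g' F' b beta ->
  agree_below g F g' F' a -> b <= x -> x <= a ->
  loses_energy n g F x -> loses_energy n g' F' x.
Proof.
move=> sh ag bx xa c u v s.
have ag' := agree_below_sym ag.
have [r r0 Er] := c u v (sol_transfer sh ag' bx xa s).
by exists r => //; rewrite -(energy_transfer sh ag' bx xa s r0).
Qed.

End Glue.

(** * The ground state of the given nonlinearity *)

Section Base.
Variables (R : realType) (n : nat).
Hypothesis n_gt0 : (0 < n)%N.
Implicit Types (f g F u v w : R -> R) (a b beta c d e r s t x y L M T : R).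

Lemma continuous_comp_within (A : set R) f (c : R -> R) :
  {within A, continuous f} -> continuous c -> (forall s, A (c s)) ->
  continuous (fun s => f (c s)).
Proof.
move=> /subspace_continuousP fA cc cA x.
apply: (@cvg_comp _ _ _ c f _ (within A (nbhs (c x)))); last exact: fA.
move=> P /= wP; have := cc x _ wP; rewrite /= !nbhs_simpl /=.
by apply: filterS => y; apply; exact: cA.
Qed.

Definition ext0 f s := f (Num.max s 0).

Lemma ext0E f s : 0 <= s -> ext0 f s = f s.
Proof. by move=> s0; rewrite /ext0 max_l. Qed.

Section Shape.
Variables (f1 : R -> R) (b beta : R).
Hypothesis h1 : H1 f1 b beta.

Lemma ext0_cont : continuous (ext0 f1).
Proof.
have [fc _] := h1; apply: (continuous_comp_within fc); first exact: max_cst_cont.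
by move=> s; rewrite /= in_itv /= andbT le_max lexx orbT.
Qed.

Lemma shape_ext0 : exists F, shape (ext0 f1) F b beta.
Proof.
have [fc [_ [_ [f10 [b0 [fpos [fneg [[e0 e00 e0P] [bb [Fb _]]]]]]]]]] := h1.
have g0 s : s <= 0 -> ext0 f1 s = 0 by move=> s0; rewrite /ext0 max_r.
have [F FP F0] := prim_exists ext0_cont g0.
have bpos : 0 < b.
  rewrite lt_neqAle b0 andbT; apply/eqP => be.
  have h2 := e0P (e0 / 2) ltac:(apply/andP; split; lra).
  have h3 := fpos (e0 / 2) ltac:(lra); lra.
have gle s : s <= b -> ext0 f1 s <= 0.
  move=> sb; case: (leP s 0) => s0; first by rewrite g0.
  by rewrite ext0E; [apply: fneg; rewrite (ltW s0)|exact: ltW].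
have gpos s : b < s -> 0 < ext0 f1 s.
  by move=> bs; rewrite ext0E ?fpos//; lra.
have Fbeta : F beta = 0.
  move: Fb; rewrite /primF /Rintegral.
  have -> : (\int[lebesgue_measure]_(x in `[0%R, beta]) (f1 x)%:E =
      \int[lebesgue_measure]_(x in `[0%R, beta]) (ext0 f1 x)%:E)%E.
    apply: eq_integral => x /[!inE]/= /[!in_itv]/= /andP[x0 _].
    by rewrite ext0E.
  rewrite (@continuous_FTC2 R (ext0 f1) F); last 4 first.
  - lra.
  - by apply: continuous_subspaceT; exact: ext0_cont.
  - split.
    + by move=> x _; have [] := FP x.
    + by apply: cvg_at_right_filter; exact: (deriv_cont (FP 0)).
    + by apply: cvg_at_left_filter; exact: (deriv_cont (FP beta)).
  - by move=> x _; rewrite derive1E; have [_ ->] := FP x.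
  by rewrite (F0 0)// sube0 /=.
have Fneg_b s : 0 < s -> s <= b -> F s < 0.
  move=> s0 sb; pose m := Num.min s e0.
  have m0 : 0 < m by rewrite lt_min s0.
  have [ms me] : m <= s /\ m <= e0 by rewrite /m !ge_min !lexx orbT.
  have : F m < 0.
    rewrite -[X in _ < X](F0 0)// -ltrN2.
    apply: (@incr_of_deriv R (fun x => - F x) (fun x => - ext0 f1 x)) => //.
    move=> x /andP[x0 xm]; rewrite oppr_gt0 ext0E; last exact: ltW.
    by apply: e0P; rewrite x0 (lt_le_trans xm me).
  apply: le_lt_trans; apply: (nonincr_of_deriv ms) => x /andP[x1 x2].
  by apply: gle; lra.
exists F; split=> //.
- exact: ext0_cont.
- move=> s /andP[s0 sb]; case: (leP s b) => bs; first exact: Fneg_b.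
  rewrite -Fbeta; apply: (incr_of_deriv sb) => x /andP[x1 _].
  by apply: gpos; exact: lt_trans x1.
- rewrite lt_neqAle bb andbT; apply/eqP => be.
  by have := Fneg_b b bpos (lexx _); rewrite be Fbeta ltxx.
Qed.

Lemma ext0_lip d a : 0 < d -> exists2 L : R, 0 <= L & forall x y,
  d <= x <= a -> d <= y <= a -> `|ext0 f1 x - ext0 f1 y| <= L * `|x - y|.
Proof.
move=> d0; have [_ [fd [fdc _]]] := h1.
case: (leP d a) => da; last by exists 0 => // x y /andP[x1 x2]; lra.
have [|c _ cP] := @EVT_max R (fun x => `|derive1 f1 x|) d a da.
  have sub : `[d, a]%classic `<=` `]0, +oo[%classic.
    by move=> x /=; rewrite !in_itv /= andbT => /andP[x1 _]; exact: lt_le_trans x1.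
  apply: (continuous_subspaceW sub).
  by move=> x; apply: cvg_norm; exact: fdc.
exists `|derive1 f1 c| => // x y xI yI.
wlog xy : x y xI yI / y < x => [H|].
  case: (ltgtP x y) => [xy|xy|->]; last by rewrite !subrr normr0 mulr0.
    by rewrite distrC [`|x - y|]distrC; exact: H.
  exact: H.
have /andP[x1 x2] := xI; have /andP[y1 y2] := yI.
rewrite !ext0E; [|lra|lra].
have [t /andP[t1 t2]|t /andP[t1 t2] ->] := @mean_value R f1 (derive1 f1) y x xy.
  by apply: DeriveDef; [apply: fd; lra|rewrite derive1E].
rewrite normrM ler_wpM2r//; apply: cP; rewrite in_itv /=; apply/andP; split; lra.
Qed.

End Shape.

Section StationaryEnergy.
Variables (g F : R -> R) (b beta : R).
Hypothesis gF : shape g F b beta.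

Lemma zero_energy_constant a u v : sol n g a u v ->
  (forall r, 0 < r -> energy F u v r = 0) ->
  forall r, 0 < r -> u r = a /\ v r = 0.
Proof.
move=> s E0.
have v0 r : 0 < r -> v r = 0.
  move=> r0; apply: (@energy_const_speed0 R n n_gt0 g F b beta gF a u v (r / 2) (r + 1)) => //.
  - by rewrite divr_gt0.
  - by rewrite !E0// ?divr_gt0// addr_gt0.
  - by apply/andP; split; lra.
move=> r r0; split; last exact: v0.
apply/eqP; rewrite eq_le; apply/andP; split.
  by apply: (value_le_init s r0) => t /andP[/v0 ->].
apply: (lim0_le r0 (sol_u0 s)) => t /andP[t0 tr].
apply: (@nondecr_of_deriv R u (fun t => - v t) _ _ (ltW tr)).
  by move=> x /andP[x1 _]; apply: (sol_u s); exact: lt_le_trans x1.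
by move=> x /andP[x1 _]; rewrite v0 ?oppr0//; exact: lt_trans x1.
Qed.

Lemma loses_energy_beta : loses_energy n g F beta.
Proof.
move=> u v s; apply: contrapT => N.
have E0 r : 0 < r -> energy F u v r = 0.
  move=> r0; apply/eqP; rewrite eq_le -{1}(shape_F_beta gF).
  rewrite (energy_le (shape_prim gF) s r0) leNgt; apply/negP => Er.
  by apply: N; exists r.
have K := zero_energy_constant s E0.
have d1 := sol_v s (ltr01 : 0 < 1 :> R).
have d2 : is_derive (1 : R) 1 v (0 : R).
  apply: (@deriv_eq_near _ (fun=> 0) v 1 1 0) => // y.
  by rewrite ltr_norml => /andP[h _]; rewrite (K y _).2//; lra.
have := deriv_unique d1 d2; have [-> ->] := K 1 ltr01.
rewrite mulr0 mul0r subr0 => gb.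
by have := shape_gtb gF (shape_b_beta gF); rewrite gb ltxx.
Qed.

End StationaryEnergy.

Section FromH4.
Variables (f1 : R -> R) (b beta astar : R) (v : R -> R).
Hypothesis n_gt1 : (1 < n)%N.
Hypothesis h1 : H1 f1 b beta.
Hypothesis hv : radial_ivp_ground_state n.+1 f1 astar v.

Let w r := - derive1 v r.

Lemma ground_state_sol : sol n (ext0 f1) astar v w.
Proof.
have [vd [vdd [v0 [v'0 [eqv [vpos _]]]]]] := hv.
have dv r : 0 <= r -> is_derive r 1 v (- w r).
  by move=> r0; apply: DeriveDef; [exact: vd|rewrite /w opprK derive1E].
have dw r : 0 < r -> is_derive r 1 w (ext0 f1 (v r) - n%:R * w r / r).
  move=> r0.
  have d2 : is_derive r 1 (derive1 v) (derive1 (derive1 v) r).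
    by apply: DeriveDef; [exact: vdd|rewrite derive1E].
  apply: (is_derive_eq (deriv_opp d2)).
  rewrite ext0E; last by apply: vpos; exact: ltW.
  have := eqv r r0; rewrite -natr1 addrK /w => e.
  have -> : f1 (v r) = - (derive1 (derive1 v) r) - n%:R / r * derive1 v r by lra.
  by field; rewrite gt_eqF.
have vl : v x @[x --> 0^'+] --> astar.
  by rewrite -v0; apply: cvg_at_right_filter; exact: (deriv_cont (dv 0 (lexx _))).
split=> //; first by move=> r r0; apply: dv; exact: ltW.
have gl : ext0 f1 (v x) @[x --> 0^'+] --> ext0 f1 astar.
  by apply: continuous_cvg; [exact: (ext0_cont h1)|exact: vl].
have /lim0P/(_ 1 ltr01)[d d0 dP] := gl.
pose M := `|ext0 f1 astar| + 1.
have gM t : 0 < t < d -> `|ext0 f1 (v t)| <= M.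
  move=> /dP h; have := ler_normD (ext0 f1 (v t) - ext0 f1 astar) (ext0 f1 astar).
  by rewrite subrK /M; lra.
(* The derivative vanishes at the origin, so the mean value theorem provides
   arbitrarily small radii at which it is small. *)
have small e : 0 < e -> exists2 c : R, 0 < c < e & `|w c| <= 1.
  move=> e0.
  have := dv 0 (lexx _); rewrite {1}/w v'0 !oppr0 => /deriv_epsP/(_ (1 / 3)).
  case; first by lra.
  move=> x x0 xP; pose y := Num.min x e / 2.
  have m0 : 0 < Num.min x e by rewrite lt_min x0 e0.
  have [mx me] : Num.min x e <= x /\ Num.min x e <= e by rewrite !ge_min !lexx orbT.
  have y0 : 0 < y by rewrite /y; lra.
  have yx : y < x by rewrite /y; lra.
  have ye : y < e by rewrite /y; lra.
  have y20 : 0 < y / 2 by lra.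
  have [t /andP[t1 _]|c /andP[c1 c2] ec] := @mean_value R v (fun t => - w t) (y / 2) y ltac:(lra).
    by apply: dv; lra.
  exists c; first by apply/andP; split; lra.
  have := xP y; have := xP (y / 2).
  rewrite !subr0 !mulr0 !subr0 (gtr0_norm y0) (gtr0_norm y20) => p1 p2.
  have {}p1 := p1 ltac:(lra); have {}p2 := p2 yx.
  have h : `|v y - v (y / 2)| <= y / 2.
    have := ler_normB (v y - v 0) (v (y / 2) - v 0).
    have -> : v y - v 0 - (v (y / 2) - v 0) = v y - v (y / 2) by ring.
    by lra.
  move: h; rewrite ec normrM normrN gtr0_norm; last by lra.
  have -> : y - y / 2 = y / 2 by lra.
  by rewrite -{2}[y / 2]mul1r ler_pM2r.
have wb r : 0 < r < d -> `|w r| <= M * r.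
  move=> /andP[r0 rd].
  have rn0 := exprn_gt0 n r0.
  rewrite -(ler_pM2l rn0) (_ : _ * (M * r) = M * r ^+ n.+1); last by rewrite exprSr; ring.
  apply/ler_addgt0Pr => e e0.
  have [c /andP[c0 cm] wc] := small (Num.min (Num.min r 1) e) ltac:(by rewrite !lt_min r0 ltr01 e0).
  move: cm; rewrite !lt_min => /andP[/andP[cr c1] ce].
  have := @late_flux_bound R n n_gt1 (fun t => ext0 f1 (v t)) w M c r c0 cr _ _.
  move=> h; apply: le_trans (h _ _) _.
  - by move=> t /andP[t1 _]; apply: dw; exact: lt_le_trans t1.
  - by move=> t /andP[t1 t2]; apply: gM; rewrite (lt_le_trans c0 t1) (le_lt_trans t2 rd).
  rewrite addrC lerD2l; apply: le_trans (ltW ce).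
  have -> : c ^+ n = c * c ^+ n.-1 by rewrite -exprS prednK.
  rewrite -mulrA ler_piMr ?(ltW c0)//.
  rewrite -[X in _ <= X]mul1r; apply: ler_pM => //; first by rewrite exprn_ge0// ltW.
  by apply: exprn_ile1; exact: ltW.
apply/lim0P => e e0.
have M0 : 0 < M by rewrite /M ltr_wpDl.
exists (Num.min d (e / M)); first by rewrite lt_min d0 divr_gt0.
move=> r /andP[r0]; rewrite lt_min => /andP[rd re]; rewrite subr0.
apply: le_lt_trans (wb r _) _; first by rewrite r0.
by rewrite mulrC -ltr_pdivlMr.
Qed.

Lemma ground_state_good F : shape (ext0 f1) F b beta ->
  beta < astar /\ has_good n (ext0 f1) F astar.
Proof.
move=> gF; have s := ground_state_sol.
have [_ [_ [v0 [_ [_ [vpos [[r1 [r10 vr1]] vinf]]]]]]] := hv.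
have Epos r : 0 < r -> 0 <= energy F v w r.
  move=> r0; rewrite leNgt; apply/negP => Er.
  have Fc : {for 0, continuous F} by exact: (deriv_cont (shape_prim gF 0)).
  have Fl : F (v x) @[x --> +oo] --> F 0 by apply: continuous_cvg.
  suff : F 0 <= energy F v w r by rewrite (shape_F_le0 gF (lexx 0)); lra.
  apply: (cvgr_to_le Fl); near=> x.
  apply: le_trans (potential_le_energy F v w x) _.
  apply: (energy_nonincr (shape_prim gF) s r0).
  by near: x; apply: nbhs_pinfty_ge; exact: num_real.
split; last first.
  by exists v, w; split=> // r r0; split; [apply: vpos; exact: ltW|exact: Epos].
rewrite ltNge; apply/negP => ab.
have E0 r : 0 < r -> energy F v w r = 0.
  move=> r0; apply/eqP; rewrite eq_le Epos// andbT.
  exact: le_trans (energy_le (shape_prim gF) s r0) (potential_le gF ab).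
have K := zero_energy_constant gF s E0.
have a0 : astar = 0.
  have cl : v x @[x --> +oo] --> astar.
    apply: cvg_near_cst; near=> x.
    have x0 : 0 < x by near: x; apply: nbhs_pinfty_gt; exact: num_real.
    by rewrite (K x x0).1.
  exact: (cvg_unique _ cl vinf).
move: r10; rewrite le_eqVlt => /predU1P[r1e|r1p].
  by move: vr1; rewrite -r1e v0 a0 eqxx.
by move: vr1; rewrite (K r1 r1p).1 a0 eqxx.
Unshelve. all: by end_near. Qed.

End FromH4.
End Base.

(** * Adding one ramp *)

Section Steps.
Variables (R : realType) (n : nat).
Hypothesis n_gt1 : (1 < n)%N.
Implicit Types (g F h u v f : R -> R) (a b beta c d e r s t tau x y z L M T Q Gamma : R).

Let n_gt0 : (0 < n)%N. Proof. exact: ltn_trans n_gt1. Qed.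

Definition drop_ratio (kappa : R) := 0 < kappa /\
  exists phi pv : R -> R, sol n (@clamp01 R) 1 phi pv /\
  forall e, 0 < e -> exists2 S : R, 0 < S & `|phi S + kappa| < e /\ `|S * pv S| < e.

Lemma drop_ratio_exists : exists kappa, drop_ratio kappa.
Proof.
have [kappa [phi [pv [k0 s tail]]]] := profile_tail R n_gt1.
by exists kappa; split=> //; exists phi, pv.
Qed.

Variable kappa : R.
Hypothesis kappaP : drop_ratio kappa.

Let kappa_gt0 : 0 < kappa. Proof. by case: kappaP. Qed.

Lemma ramp_drop g F b beta M a d : shape g F b beta -> (forall s, `|g s| <= M) ->
  beta < a -> 0 < d -> loses_energy n g F (a - kappa * d) ->
  exists2 Q : R, 0 < Q & exists F', [/\ shape (ramp g a d Q) F' b beta,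
    agree_below g F (ramp g a d Q) F' a & loses_energy n (ramp g a d Q) F' (a + d)].
Proof.
move=> gF gM ba d0 le; have [k0 [phi [pv [sphi tail]]]] := kappaP.
have [m m0 mP] := drop n_gt1 gF gM ba d0 k0 sphi tail le.
have ga : 0 < g a by apply: (shape_gtb gF); exact: lt_trans (shape_b_beta gF) ba.
have Q0 : 0 < g a + m * d by rewrite addr_gt0// mulr_gt0.
exists (g a + m * d) => //.
have [F' sh ag] := shape_ramp gF ba d0 Q0.
exists F'; split=> //; apply: (mP m (lexx _)); split=> // s sa.
rewrite ramp_ge//; congr (_ + _).
by field; rewrite gt_eqF.
Qed.

Lemma ramp_slow g F b beta M a d : shape g F b beta -> (forall s, `|g s| <= M) ->
  beta < a -> 0 < d ->
  exists2 Q : R, 0 < Q & exists F', [/\ shape (ramp g a d Q) F' b beta,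
    agree_below g F (ramp g a d Q) F' a & crosses n (ramp g a d Q) (a + d)].
Proof.
move=> gF gM ba d0.
have [q0 q00 qP] := slow_start n_gt0 gF gM ba d0.
exists q0 => //; have [F' sh ag] := shape_ramp gF ba d0 q00.
exists F'; split=> //; apply: (qP q0 _ _ F' sh ag); first by rewrite q00 lexx.
move=> s /andP[sa sd]; rewrite ramp_ge// min_l//; congr (_ + _).
by field; rewrite gt_eqF.
Qed.

Lemma agree_below_trans g F (g1 F1 g2 F2 : R -> R) a c : a <= c ->
  agree_below g F g1 F1 a -> agree_below g1 F1 g2 F2 c -> agree_below g F g2 F2 a.
Proof.
move=> ac h1 h2 s sa; have [<- <-] := h1 s sa; exact: h2 (le_trans sa ac).
Qed.

Lemma crosses_loses_excl g F b beta M a : shape g F b beta -> (forall s, `|g s| <= M) ->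
  0 < a -> crosses n g a -> ~ loses_energy n g F a.
Proof.
move=> gF gM a0 c l; have [u [v s]] := sol_exists n_gt0 (shape_cont gF) gM a.
have [T T0 uT] := c u v s; have [r r0 Er] := l u v s.
by have := energy_ge0_crossing n_gt0 gF s a0 T0 uT r0; lra.
Qed.

(* The second alternative asks for enough room below [Gamma] to drop back to [c]. *)
Definition shooting_state g F beta Gamma tau := loses_energy n g F tau \/
  (crosses n g tau /\ exists c, [/\ beta < c < tau, loses_energy n g F c &
     tau + (tau - c) / kappa < Gamma]).

Lemma ramp_bounded g F b beta a d Q : shape (ramp g a d Q) F b beta -> 0 < d ->
  exists M : R, forall s, `|ramp g a d Q s| <= M.
Proof.
move=> sh d0; apply: (@bounded_of_flat R _ (a + d) (shape_cont sh)).
- by move=> s s0; exact: (shape_le0 sh s0).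
- by move=> s sa; rewrite !ramp_end.
Qed.

Lemma next_step g F b beta Gamma tau h : shape g F b beta -> beta < tau -> tau < Gamma ->
  shooting_state g F beta Gamma tau ->
  {within [set s | tau <= s /\ s < Gamma], continuous h} ->
  (forall s, tau <= s -> s < Gamma -> 0 < h s) -> h tau = g tau ->
  exists a d Q g1 g' F',
    [/\ [/\ tau < a, 0 < d, a + d < Gamma & 0 < Q],
      [/\ g' = ramp g1 a d Q, forall s, s <= tau -> g1 s = g s &
          forall s, tau <= s -> s <= a -> g1 s = h s],
      shape g' F' b beta /\ agree_below g F g' F' tau,
      shooting_state g' F' beta Gamma (a + d) &
      exists2 z : R, tau < z < a + d & has_good n g' F' z].
Proof.
move=> gF btau tauG st hc hpos htau.
have b0 := shape_b_gt0 gF; have bb := shape_b_beta gF.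
have ki0 : 0 < kappa^-1 by rewrite invr_gt0.
have extend a : tau < a -> a < Gamma -> exists g1 F1 M,
    [/\ shape g1 F1 b beta, agree_below g F g1 F1 tau, forall s, `|g1 s| <= M &
        forall s, tau <= s -> s <= a -> g1 s = h s].
  move=> ta aG; pose h' s := h (Num.max (Num.min s a) tau).
  have h'c : continuous h'.
    apply: (continuous_comp_within hc) => [x|s /=].
      apply: (@cvg_comp _ _ _ (fun s : R => Num.min s a) (fun s : R => Num.max s tau)).
        exact: min_cst_cont.
      exact: max_cst_cont.
    rewrite le_max lexx orbT; split=> //; rewrite gt_max tauG andbT.
    by rewrite gt_min aG orbT.
  have h'E s : tau <= s -> s <= a -> h' s = h s.
    by move=> ts sa; rewrite /h' (min_l sa) (max_l ts).
  have h'tau : h' tau = g tau by rewrite h'E// ltW.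
  have h'pos s : tau <= s -> 0 < h' s.
    move=> ts; apply: hpos; first by rewrite le_max lexx orbT.
    by rewrite gt_max tauG andbT gt_min aG orbT.
  have [F1 sh ag] := shape_glue gF btau h'c h'tau h'pos.
  have [||M gM] := @bounded_of_flat R (glue g tau h') a (shape_cont sh).
  - by move=> s; exact: (shape_le0 sh).
  - move=> s sa; rewrite !glue_ge ?(ltW ta)//; last exact: le_trans (ltW ta) sa.
    by rewrite /h' minxx min_r.
  exists (glue g tau h'), F1, M; split=> // s ts sa.
  by rewrite glue_ge// h'E.
case: st => [le|[cr [c [/andP[bc ct] lc room]]]].
- pose e := (Gamma - tau) / (4 * (1 + kappa^-1)).
  have k1 : 0 < 1 + kappa^-1 by rewrite addr_gt0.
  have e0 : 0 < e by rewrite divr_gt0 ?subr_gt0// mulr_gt0.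
  have eE : 4 * (e + e / kappa) = Gamma - tau.
    rewrite /e; field; rewrite !gt_eqF//.
    by rewrite addr_gt0.
  have ek : 0 < e / kappa by rewrite divr_gt0.
  pose a := tau + e.
  have ta : tau < a by rewrite /a; lra.
  have [g1 [F1 [M [sh1 ag1 g1M g1h]]]] := extend a ta ltac:(rewrite /a; lra).
  have ba : beta < a by lra.
  have [Q Q0 [F' [sh ag cr]]] := ramp_slow sh1 g1M ba e0.
  have [M' g'M] := ramp_bounded sh e0.
  have ag' := agree_below_trans (ltW ta) ag1 ag.
  have le' : loses_energy n (ramp g1 a e Q) F' tau.
    by apply: (loses_energy_transfer sh ag' _ (lexx _) le); lra.
  have tae : tau < a + e by lra.
  have [||z zP gz] := good_between n_gt0 sh g'M _ _ cr le'; [lra|lra|].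
  exists a, e, Q, g1, (ramp g1 a e Q), F'; split=> //.
  + by split=> //; rewrite /a; lra.
  + by split=> // s /ag1[].
  + right; split=> //; exists tau; split=> //; first by rewrite btau.
    have -> : (a + e - tau) / kappa = 2 * (e / kappa) by rewrite /a; field; rewrite gt_eqF.
    by rewrite /a; lra.
  + by exists z => //; move: zP; rewrite min_r ?max_l// ltW.
- pose e := (Gamma - (tau + (tau - c) / kappa)) / (2 * (1 + kappa^-1)).
  have k1 : 0 < 1 + kappa^-1 by rewrite addr_gt0.
  have e0 : 0 < e by rewrite divr_gt0 ?subr_gt0// mulr_gt0.
  have eE : 2 * (e + e / kappa) = Gamma - (tau + (tau - c) / kappa).
    rewrite /e; field; rewrite !gt_eqF//.
    by rewrite addr_gt0.
  have ek : 0 < e / kappa by rewrite divr_gt0.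
  pose a := tau + e; pose d := (a - c) / kappa.
  have ta : tau < a by rewrite /a; lra.
  have dE : d = (tau - c) / kappa + e / kappa by rewrite /d /a; field; rewrite gt_eqF.
  have d0 : 0 < d by rewrite divr_gt0//; lra.
  have adG : a + d < Gamma by rewrite dE /a; lra.
  have [g1 [F1 [M [sh1 ag1 g1M g1h]]]] := extend a ta ltac:(lra).
  have ba : beta < a by lra.
  have lc1 : loses_energy n g1 F1 (a - kappa * d).
    have -> : a - kappa * d = c by rewrite /d; field; rewrite gt_eqF.
    by apply: (loses_energy_transfer sh1 ag1 _ _ lc); lra.
  have [Q Q0 [F' [sh ag le]]] := ramp_drop sh1 g1M ba d0 lc1.
  have [M' g'M] := ramp_bounded sh d0.
  have ag' := agree_below_trans (ltW ta) ag1 ag.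
  have cr' : crosses n (ramp g1 a d Q) tau.
    by apply: (crosses_transfer sh ag' _ (lexx _) cr); lra.
  have tad : tau < a + d by lra.
  have [||z zP gz] := good_between n_gt0 sh g'M _ _ cr' le; [lra|lra|].
  exists a, d, Q, g1, (ramp g1 a d Q), F'; split=> //.
  + by split=> // s /ag1[].
  + by left.
  + by exists z => //; move: zP; rewrite min_l ?max_r// ltW.
Qed.

Lemma first_step f1 b beta astar Gamma : H1 f1 b beta -> H4 n.+1 f1 astar ->
  astar < Gamma -> exists a d Q g1 g' F',
    [/\ [/\ beta < a, 0 < d, astar < a + d < Gamma & 0 < Q],
      g' = ramp g1 a d Q /\ (forall s, 0 <= s -> s <= a -> g1 s = f1 s),
      shape g' F' b beta, shooting_state g' F' beta Gamma (a + d) &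
      exists z0 z1, [/\ beta < z0, z0 < z1, z1 <= a + d, has_good n g' F' z0 &
        has_good n g' F' z1]].
Proof.
move=> h1 [v0 hv0] aG.
have [F0 sh0] := shape_ext0 h1.
have [ba ga0] := ground_state_good n_gt0 n_gt1 h1 hv0 sh0.
have b0 := shape_b_gt0 sh0; have bb := shape_b_beta sh0.
have bG : beta < Gamma by lra.
have extG : 0 < ext0 f1 Gamma by apply: (shape_gtb sh0); lra.
have [F gF ag0] := @shape_glue R (ext0 f1) F0 b beta Gamma (fun=> ext0 f1 Gamma) sh0 bG
  (fun=> cvg_cst _) erefl (fun _ _ => extG).
set g := glue _ _ _ in gF ag0.
have gE s : 0 <= s -> s <= Gamma -> g s = f1 s.
  by move=> s0 sG; rewrite /g glue_le// ext0E.
have [||M gM] := @bounded_of_flat R g Gamma (shape_cont gF).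
- by move=> s; exact: (shape_le0 gF).
- by move=> s sG; rewrite /g !glue_ge.
have gast : has_good n g F astar.
  by apply: (good_transfer sh0 ag0 _ _ ga0); lra.
have Fc : continuous F by move=> x; exact: (deriv_cont (shape_prim gF x)).
have tri x : b < x -> x <= Gamma -> [\/ has_good n g F x, crosses n g x | loses_energy n g F x].
  move=> bx xG; apply: (trichotomy n_gt0 gF gM bx) => d d0.
  have [L L0 LP] := ext0_lip h1 x d0; exists L => // y z yI zI.
  rewrite /g !glue_le; first exact: LP.
  - by case/andP: zI => _ h; exact: le_trans h xG.
  - by case/andP: yI => _ h; exact: le_trans h xG.
have open_l x : loses_energy n g F x ->
    exists2 e : R, 0 < e & forall y, `|y - x| < e -> loses_energy n g F y.
  move=> lx; apply: contrapT => K.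
  apply: (loses_energy_open n_gt0 (shape_cont gF) gM Fc _ lx) => e e0.
  apply: contrapT => K2; apply: K; exists e => // y yx; apply: contrapT => ny.
  by apply: K2; exists y.
have open_c x : crosses n g x ->
    exists2 e : R, 0 < e & forall y, `|y - x| < e -> crosses n g y.
  move=> lx; apply: contrapT => K.
  apply: (crosses_open n_gt0 (shape_cont gF) gM _ lx) => e e0.
  apply: contrapT => K2; apply: K; exists e => // y yx; apply: contrapT => ny.
  by apply: K2; exists y.
pose S := [set c | beta <= c /\ c < astar /\ loses_energy n g F c].
have Sbeta : S beta by split=> //; split=> //; exact: (loses_energy_beta n_gt0 gF).
have Sub : ubound S astar by move=> c [_ [/ltW]].
have Ssup : has_sup S by split; [exists beta|exists astar].
pose al0 := sup S.
have al0a : al0 <= astar by exact: (ge_sup Ssup.1 Sub).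
have S_le c : S c -> c <= al0 by move=> Sc; exact: (ub_le_sup Ssup.2 Sc).
have above x : beta <= x -> x < astar -> loses_energy n g F x -> x < al0.
  move=> bx xa lx; have [e e0 eP] := open_l x lx.
  pose y := Num.min (x + e / 2) ((x + astar) / 2).
  have [y1 y2] : y <= x + e / 2 /\ y <= (x + astar) / 2 by rewrite /y !ge_min !lexx orbT.
  have xy : x < y by rewrite lt_min; apply/andP; split; lra.
  apply: (lt_le_trans xy); apply: S_le; split; first lra.
  by split; [lra|apply: eP; rewrite gtr0_norm; lra].
have bal0 : beta < al0 by apply: above => //; exact: (loses_energy_beta n_gt0 gF).
have gal0 : has_good n g F al0.
  case: (ltgtP al0 astar) al0a => // [lt _|-> //].
  have [//|cr|le] := tri al0 ltac:(lra) ltac:(lra).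
  - have [e e0 eP] := open_c al0 cr.
    have [c Sc ce] := sup_adherent e0 Ssup.
    have cc := S_le c Sc.
    case: (crosses_loses_excl gF gM _ (eP c _) Sc.2.2); first by case: Sc; lra.
    by rewrite ler0_norm; rewrite -/al0 in ce; lra.
  - by have := above al0 (ltW bal0) lt le; rewrite ltxx.
have ki0 : 0 < kappa^-1 by rewrite invr_gt0.
pose e := (Gamma - astar) / (2 * (1 + kappa^-1)).
have k1 : 0 < 1 + kappa^-1 by rewrite addr_gt0.
have e0 : 0 < e by rewrite divr_gt0 ?subr_gt0// mulr_gt0.
have eE : 2 * (e + e / kappa) = Gamma - astar.
  rewrite /e; field; rewrite !gt_eqF//.
  by rewrite addr_gt0.
have ek : 0 < e / kappa by rewrite divr_gt0.
pose t := astar + e.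
have at_ : astar < t by rewrite /t; lra.
have [c Sc cal] := sup_adherent (mulr_gt0 kappa_gt0 (ltac:(lra) : 0 < t - al0)) Ssup.
rewrite -/al0 in cal; have cc := S_le c Sc.
have kk : 0 < 1 + kappa by rewrite addr_gt0.
pose a := (c + kappa * t) / (1 + kappa); pose d := t - a.
have aE : a * (1 + kappa) = c + kappa * t by rewrite /a divfK// gt_eqF.
have al0_a : al0 < a by rewrite -(ltr_pM2r kk) aE; lra.
have a_t : a < t by rewrite -(ltr_pM2r kk) aE; lra.
have d0 : 0 < d by rewrite /d; lra.
have ad : a + d = t by rewrite /d; lra.
have dk : a - kappa * d = c by rewrite /d; lra.
have ba1 : beta < a by lra.
have tG : t < Gamma by rewrite /t; lra.
have gEa s : 0 <= s -> s <= a -> g s = f1 s by move=> s0 sa; apply: gE; lra.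
have concl Q F' : 0 < Q -> shape (ramp g a d Q) F' b beta ->
    agree_below g F (ramp g a d Q) F' a ->
    shooting_state (ramp g a d Q) F' beta Gamma (a + d) ->
    (exists2 z1 : R, a <= z1 <= a + d & has_good n (ramp g a d Q) F' z1) ->
    exists a d Q g1 g' F',
    [/\ [/\ beta < a, 0 < d, astar < a + d < Gamma & 0 < Q],
      g' = ramp g1 a d Q /\ (forall s, 0 <= s -> s <= a -> g1 s = f1 s),
      shape g' F' b beta, shooting_state g' F' beta Gamma (a + d) &
      exists z0 z1, [/\ beta < z0, z0 < z1, z1 <= a + d, has_good n g' F' z0 &
        has_good n g' F' z1]].
  move=> Q0 sh ag st [z1 /andP[z1a z1d] gz1].
  exists a, d, Q, g, (ramp g a d Q), F'; split=> //.
  - by split=> //; rewrite ad at_ tG.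
  - exists al0, z1; split=> //; first exact: lt_le_trans z1a.
    by apply: (good_transfer gF ag _ _ gal0); lra.
have lc : loses_energy n g F (a - kappa * d) by rewrite dk; case: Sc => _ [].
have [|//|G1|C1|L1] := tri a; [lra|lra|..].
- have [Q Q0 [F' [sh ag le]]] := ramp_drop gF gM ba1 d0 lc.
  apply: (concl Q F') => //; first by left.
  exists a; first by rewrite lexx lerDl ltW.
  by apply: (good_transfer gF ag _ _ G1); lra.
- have [Q Q0 [F' [sh ag le]]] := ramp_drop gF gM ba1 d0 lc.
  have [M' g'M] := ramp_bounded sh d0.
  apply: (concl Q F') => //; first by left.
  have cr' : crosses n (ramp g a d Q) a.
    by apply: (crosses_transfer sh ag _ (lexx _) C1); lra.
  have [||z zP gz] := good_between n_gt0 sh g'M _ _ cr' le; [lra|lra|].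
  exists z => //; move: zP; rewrite min_l ?max_r ?lerDl ?(ltW d0)//.
  by move=> /andP[/ltW-> /ltW->].
- have aa : astar < a.
    case: (ltgtP astar a) => // [lt|eq].
      by have := above a (ltW ba1) lt L1; lra.
    by case: (loses_energy_not_good L1); rewrite -eq.
  have [Q Q0 [F' [sh ag cr]]] := ramp_slow gF gM ba1 d0.
  have [M' g'M] := ramp_bounded sh d0.
  have le' : loses_energy n (ramp g a d Q) F' a.
    by apply: (loses_energy_transfer sh ag _ (lexx _) L1); lra.
  apply: (concl Q F') => //.
    right; split=> //; exists a; split=> //; first by rewrite ba1 ltrDl.
    rewrite ad; apply: (@le_lt_trans _ _ (t + (t - astar) / kappa)).
      by rewrite lerD2l ler_pM2r// lerD2l lerN2 ltW.
    have -> : (t - astar) / kappa = e / kappa by rewrite /t; field; rewrite gt_eqF.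
    by rewrite /t; lra.
  have [||z zP gz] := good_between n_gt0 sh g'M _ _ cr le'; [lra|lra|].
  exists z => //; move: zP; rewrite min_r ?max_l ?lerDl ?(ltW d0)//.
  by move=> /andP[/ltW-> /ltW->].
Qed.

End Steps.

Section Stages.
Variables (R : realType) (n : nat).
Hypothesis n_gt1 : (1 < n)%N.
Variables (kappa : R) (f1 : R -> R) (b beta astar Gamma : R) (f : nat -> R -> R).
Hypothesis kappaP : drop_ratio n kappa.
Hypothesis f1P : H1 f1 b beta.
Hypothesis ground : H4 n.+1 f1 astar.
Hypothesis astarG : astar < Gamma.
Implicit Types (eps A alpha z : nat -> R) (g F : R -> R) (i j : nat) (s : R).

Record stage j eps A alpha z g F : Prop := Stage {
  stage_eps : forall i, (1 <= i <= j)%N -> 0 < eps i;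
  stage_A : forall i, (2 <= i <= j.+1)%N -> 0 < A i;
  stage_alpha1 : beta < alpha 1%N;
  stage_gap : forall i, (2 <= i <= j)%N -> alpha i.-1 + eps i.-1 < alpha i;
  stage_astar : forall i, (1 <= i <= j)%N -> astar < alpha i + eps i;
  stage_Gamma : alpha j + eps j < Gamma;
  stage_shape : shape g F b beta;
  stage_left : forall s, 0 <= s <= alpha 1%N -> g s = f1 s;
  stage_affine : forall i s, (1 <= i <= j)%N -> alpha i < s <= alpha i + eps i ->
    g s = Laff f1 f A alpha eps i s;
  stage_middle : forall i s, (2 <= i <= j)%N -> alpha i.-1 + eps i.-1 < s <= alpha i ->
    g s = A i ^+ 2 * f i s;
  stage_end : g (alpha j + eps j) = A j.+1 ^+ 2 * f j.+1 (alpha j + eps j);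
  stage_bounded : exists M : R, forall s, `|g s| <= M;
  stage_state : shooting_state n kappa g F beta Gamma (alpha j + eps j);
  stage_good : forall i, (i <= j)%N ->
    beta < z i <= alpha j + eps j /\ has_good n g F (z i);
  stage_incr : forall i, (i < j)%N -> z i < z i.+1 }.

Lemma ramp_le g a d Q s : s <= a -> ramp g a d Q s = g s.
Proof. exact: glue_le. Qed.

Lemma Laff_ramp g a d Q j A alpha eps s : 0 < d -> a < s <= a + d ->
  alpha j = a -> eps j = d -> Lleft f1 f A alpha j = g a ->
  A j.+1 ^+ 2 * f j.+1 (a + d) = Q ->
  ramp g a d Q s = Laff f1 f A alpha eps j s.
Proof.
move=> d0 /andP[sa sd] aE dE lE QE.
by rewrite ramp_ge ?(ltW sa)// min_l// /Laff lE aE dE QE.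
Qed.

Lemma sqrt_ratio (Q y : R) : 0 < Q -> 0 < y ->
  0 < Num.sqrt (Q / y) /\ Num.sqrt (Q / y) ^+ 2 * y = Q.
Proof.
move=> Q0 y0; have Qy : 0 < Q / y by rewrite divr_gt0.
by rewrite sqrtr_gt0 Qy sqr_sqrtr ?ltW// divfK// gt_eqF.
Qed.

Lemma stage_base : (forall s, astar <= s -> s < Gamma -> 0 < f 2%N s) ->
  exists eps A alpha z g F, stage 1 eps A alpha z g F.
Proof.
move=> fpos.
have [a [d [Q [g1 [g [F [[ba d0 /andP[adl adr] Q0] [gE g1E] sh st
  [z0 [z1 [bz0 z01 z1ad G0 G1]]]]]]]]]] := first_step n_gt1 kappaP f1P ground astarG.
have [A0 AE] := sqrt_ratio Q0 (fpos _ (ltW adl) adr).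
have b0 := shape_b_gt0 sh; have bb := shape_b_beta sh.
have shr : shape (ramp g1 a d Q) F b beta by rewrite -gE.
exists (fun=> d), (fun=> Num.sqrt (Q / f 2%N (a + d))), (fun=> a),
  (fun i => if i == 0%N then z0 else z1), g, F; split=> //.
- by case=> [|[|i]].
- move=> s /andP[s0 sa]; rewrite gE ramp_le//; exact: g1E.
- move=> [|[|i]]// s _ sI; rewrite gE; apply: Laff_ramp => //.
  by rewrite /Lleft eqxx g1E//; lra.
- case=> [|[|i]]//.
- by rewrite gE ramp_end// AE.
- by rewrite gE; exact: ramp_bounded shr d0.
- case=> [|i] /= _; first by split=> //; rewrite bz0; apply/ltW/(lt_le_trans z01).
  by split=> //; rewrite z1ad (lt_trans bz0 z01).
- by case.
Qed.

Definition update (j : nat) (x : R) (s : nat -> R) i := if i == j then x else s i.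

Lemma update_eq j x (s : nat -> R) : update j x s j = x.
Proof. by rewrite /update eqxx. Qed.

Lemma update_le j x (s : nat -> R) i : (i < j)%N -> update j x s i = s i.
Proof. by move=> ij; rewrite /update ltn_eqF. Qed.

Lemma stage_mono j eps A alpha z g F : stage j eps A alpha z g F ->
  forall i i', (1 <= i)%N -> (i <= i')%N -> (i' <= j)%N ->
  alpha i + eps i <= alpha i' + eps i'.
Proof.
move=> st i i' i1; elim: i' => [|i' IH]; first by case: i i1.
rewrite leq_eqVlt => /predU1P[->//|]; rewrite ltnS => ii' i'j.
apply: (le_trans (IH ii' (ltnW i'j))).
have i'1 := leq_trans i1 ii'.
have h1 := stage_gap st (i := i'.+1); have h2 := stage_eps st (i := i'.+1).
by rewrite /= !ltnS i'1 i'j in h1 h2; have := h1 isT; have := h2 isT; lra.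
Qed.

Lemma stage_step j eps A alpha z g F : (1 <= j)%N -> stage j eps A alpha z g F ->
  {within [set s | astar <= s /\ s < Gamma], continuous (f j.+1)} ->
  (forall s, astar <= s -> s < Gamma -> 0 < f j.+1 s) ->
  (forall s, astar <= s -> s < Gamma -> 0 < f j.+2 s) ->
  exists eps A alpha z g F, stage j.+1 eps A alpha z g F.
Proof.
move=> j1 st fc fpos fpos2.
set tau := alpha j + eps j.
have mono := stage_mono st.
have tauG : tau < Gamma := stage_Gamma st.
have asttau : astar < tau by apply: (stage_astar st); rewrite j1 leqnn.
have atau i : (1 <= i <= j)%N -> alpha i < tau.
  move=> ij; have := stage_eps st ij; have /andP[i1 ij'] := ij.
  by have := mono _ _ i1 ij' (leqnn _); rewrite -/tau; lra.
have btau : beta < tau.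
  by have := stage_alpha1 st; have := atau 1%N j1; lra.
have Aj0 : 0 < A j.+1 by apply: (stage_A st); rewrite !ltnS j1 leqnn.
have [|||a [d [Q [g1 [g' [F' [[ta d0 adG Q0] [gE g1g g1h] [sh ag] st' [z' z'P G']]]]]]]] :=
  next_step (h := fun s => A j.+1 ^+ 2 * f j.+1 s) n_gt1 kappaP (stage_shape st) btau tauG
  (stage_state st).
- have cf : {within [set s | tau <= s /\ s < Gamma], continuous (f j.+1)}.
    apply: continuous_subspaceW fc => s /= [h1 h2]; split=> //.
    by apply: le_trans h1; exact: ltW.
  by move=> x; apply: cvgM; [exact: cvg_cst|exact: cf].
- move=> s ts sG; rewrite mulr_gt0 ?exprn_gt0//; apply: fpos => //.
  by apply: le_trans ts; exact: ltW.
- by rewrite (stage_end st).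
have adl : astar < a + d by lra.
have [A0 AE] := sqrt_ratio Q0 (fpos2 _ (ltW adl) adG).
have shr : shape (ramp g1 a d Q) F' b beta by rewrite -gE.
have b0 := shape_b_gt0 sh; have bb := shape_b_beta sh.
have g'g s : s <= tau -> g' s = g s by move=> /ag[].
have jE i : (i <= j.+1)%N -> i = j.+1 \/ (i <= j)%N.
  by rewrite leq_eqVlt ltnS => /predU1P; case; [left|right].
exists (update j.+1 d eps), (update j.+2 (Num.sqrt (Q / f j.+2 (a + d))) A),
  (update j.+1 a alpha), (update j.+1 z' z), g', F'.
have aE i : (i <= j)%N -> update j.+1 a alpha i = alpha i by move=> ij; rewrite update_le.
have eE i : (i <= j)%N -> update j.+1 d eps i = eps i by move=> ij; rewrite update_le.
have AE' i : (i <= j.+1)%N ->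
  update j.+2 (Num.sqrt (Q / f j.+2 (a + d))) A i = A i by move=> ij; rewrite update_le.
split=> //.
- move=> i /andP[i1 /jE[->|ij]]; first by rewrite update_eq.
  by rewrite eE//; apply: (stage_eps st); rewrite i1.
- move=> i /andP[i1]; rewrite leq_eqVlt ltnS => /predU1P[->|ij]; first by rewrite update_eq.
  by rewrite AE'//; apply: (stage_A st); rewrite i1.
- by rewrite aE// (stage_alpha1 st).
- move=> i /andP[i1 /jE[->|ij]]; first by rewrite /= update_eq aE// eE.
  rewrite !aE ?eE//; try exact: leq_trans (leq_pred _) ij.
  by apply: (stage_gap st); rewrite i1.
- move=> i /andP[i1 /jE[->|ij]]; first by rewrite !update_eq.
  by rewrite eE// aE//; apply: (stage_astar st); rewrite i1.
- by rewrite !update_eq.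
- move=> s; rewrite aE// => /andP[s0 s1]; rewrite g'g; last first.
    by apply: (le_trans s1); apply: ltW; apply: atau.
  by apply: (stage_left st); rewrite s0.
- move=> i s /andP[i1 /jE[->|ij]].
    rewrite !update_eq => sI; rewrite gE; apply: Laff_ramp; rewrite ?update_eq//.
    rewrite /Lleft eqSS -[j == 0%N]negbK -lt0n j1 /= update_eq AE'//.
    by rewrite g1h ?lexx// ltW.
  rewrite !aE// !eE// => sI; rewrite g'g; last first.
    by case/andP: sI => _ /le_trans; apply; apply: mono.
  rewrite (stage_affine st (i := i)) ?i1//.
  by rewrite /Laff /Lleft !aE// !eE// !AE'// ltnW.
- move=> i s /andP[i1 /jE[->|ij]].
    rewrite /= update_eq aE// eE// AE'// => /andP[s0 s1].
    by rewrite gE ramp_le// g1h// ltW.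
  have ip : (i.-1 <= j)%N by exact: leq_trans (leq_pred _) ij.
  rewrite !aE// eE// AE' ?(leq_trans ij)// => sI; rewrite g'g; last first.
    case/andP: sI => _ /le_trans; apply; apply: ltW; apply: atau.
    by rewrite ij andbT ltnW.
  by rewrite (stage_middle st (i := i))// i1.
- by rewrite !update_eq gE ramp_end// AE.
- by rewrite gE; exact: ramp_bounded shr d0.
- by rewrite !update_eq.
- move=> i /jE[->|ij]; rewrite !update_eq.
    by split=> //; move: z'P => /andP[h1 /ltW->]; rewrite (lt_trans btau).
  rewrite update_le//; have [/andP[h1 h2] h3] := stage_good st ij.
  split; first by rewrite h1 (le_trans h2)//; apply/ltW/(lt_trans ta); rewrite ltrDl.
  by apply: (good_transfer (stage_shape st) ag _ h2 h3); lra.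
- move=> i; rewrite ltnS => /[dup] ij; rewrite leq_eqVlt => /predU1P[iE|ij'].
    rewrite iE update_eq update_le//; have [/andP[_ h] _] := stage_good st (leqnn j).
    by case/andP: z'P => h' _; exact: le_lt_trans h h'.
  by rewrite !update_le//; exact: (stage_incr st).
Qed.

Lemma fseg_stage k eps A alpha z g F : stage k eps A alpha z g F ->
  forall fuel i s, (2 <= i <= k.+1)%N -> (k.+1 < i + fuel)%N ->
  alpha i.-1 < s <= alpha k + eps k -> fseg k.+1 f1 f A alpha eps fuel i s = g s.
Proof.
move=> st; elim=> [|m IH] i s /andP[i2 ik] im /andP[s1 s2].
  by move: im; rewrite addn0 ltnNge ik.
have i1 : (1 <= i.-1 <= k)%N by case: i i2 ik {im s1} => [|[|i]].
rewrite /=; case: leP => st1.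
  by rewrite (stage_affine st (i := i.-1))// s1.
case: ltnP => ik'; last first.
  have iE : i = k.+1 by apply/eqP; rewrite eqn_leq ik.
  by move: st1 s2; rewrite iE /=; lra.
case: leP => s3; first by rewrite (stage_middle st (i := i)) ?st1 ?i2.
by apply: IH; rewrite ?s3 ?s2// ?addSn -?addnS// ltnS ik' andbT ltnW.
Qed.

Lemma fnl_stage k eps A alpha z g F s : stage k eps A alpha z g F -> (1 <= k)%N ->
  0 <= s <= alpha k + eps k -> fnl k.+1 f1 f A alpha eps s = g s.
Proof.
move=> st k1 /andP[s0 s1]; rewrite /fnl s0 /fpos; case: leP => sa.
  by rewrite (stage_left st)// s0.
by apply: (fseg_stage st); rewrite ?sa ?s1// ltnS addnC addn2.
Qed.

End Stages.

(** * From radial profiles to the equation in space *)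

Section Profile.
Variables (R : realType) (n : nat).
Hypothesis n_gt0 : (0 < n)%N.
Implicit Types (g u v h k : R -> R) (a c e l r s t : R).

Lemma const_of_deriv0 (D : R -> R) l r : (forall t, 0 < t -> is_derive t 1 D 0) ->
  D x @[x --> 0^'+] --> l -> 0 < r -> D r = l.
Proof.
move=> Dd Dl r0; apply: le_anti; apply/andP; split.
- apply: (lim0_ge r0 Dl) => t /andP[t0 tr].
  apply: (@nonincr_of_deriv _ D (fun=> 0) _ _ (ltW tr)).
    by move=> x /andP[tx _]; apply: Dd; exact: lt_le_trans tx.
  by move=> *; exact: lexx.
- apply: (lim0_le r0 Dl) => t /andP[t0 tr].
  apply: (@nondecr_of_deriv _ D (fun=> 0) _ _ (ltW tr)).
    by move=> x /andP[tx _]; apply: Dd; exact: lt_le_trans tx.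
  by move=> *; exact: lexx.
Qed.

(* [h] and [k] are [u] and [v r / r] as functions of [r ^+ 2]; extended by an
   affine, resp. constant, function to negative arguments they are as regular at
   [0] as elsewhere. *)
Lemma radial_profile g a u v : continuous g -> sol n g a u v ->
  exists h k : R -> R, [/\ h 0 = a, forall r, 0 < r -> h (r ^+ 2) = u r,
    forall s, is_derive s 1 h (- k s / 2), {for 0, continuous k} /\ k 0 = g a / n.+1%:R &
    forall s, 0 < s -> is_derive s 1 k ((g (h s) - n.+1%:R * k s) / (2 * s))].
Proof.
move=> gc su; pose c := g a / n.+1%:R.
pose psi (r : R) := v r / r.
pose k (s : R) := if s <= 0 then c else psi (Num.sqrt s).
have N0 : 0 < n.+1%:R :> R by rewrite ltr0n.
have k0 : k 0 = c by rewrite /k lexx.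
have kpos s : 0 < s -> k s = psi (Num.sqrt s) by rewrite /k leNgt => ->.
have psi_lim : forall e : R, 0 < e -> exists2 d : R, 0 < d & forall r : R, 0 < r < d -> `|psi r - c| <= e.
  move=> e e0; have gu : (g (u x)) @[x --> 0^'+] --> g a.
    by apply: continuous_cvg; [exact: gc|exact: sol_u0 su].
  have en0 : 0 < e * n.+1%:R by rewrite mulr_gt0.
  have [d d0 dP] := (lim0P _ _).1 gu _ en0; exists d => // r /andP[r0 rd].
  have near_ga (t : R) : 0 < t < r -> g a - e * n.+1%:R <= g (u t) <= g a + e * n.+1%:R.
    move=> /andP[t0 tr]; have := dP t; rewrite t0 (lt_trans tr rd) => /(_ isT).
    by move=> /ltW; rewrite ler_norml => /andP[h1 h2]; apply/andP; split; lra.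
  have le := flux_le (B := g a + e * n.+1%:R) n_gt0 su r0 (fun t tr => (andP (near_ga t tr)).2).
  have ge := flux_ge (B := g a - e * n.+1%:R) n_gt0 su r0 (fun t tr => (andP (near_ga t tr)).1).
  have E1 : (g a + e * n.+1%:R) * r / n.+1%:R = (c + e) * r.
    by rewrite /c; field; rewrite gt_eqF.
  have E2 : (g a - e * n.+1%:R) * r / n.+1%:R = (c - e) * r.
    by rewrite /c; field; rewrite gt_eqF.
  rewrite E1 in le; rewrite E2 in ge.
  have psir : psi r * r = v r by rewrite /psi divfK// gt_eqF.
  move: le ge; rewrite -psir !(ler_pM2r r0) ler_norml => h1 h2.
  by apply/andP; split; lra.
have kd s : 0 < s -> is_derive s 1 k
    ((g (u (Num.sqrt s)) - n.+1%:R * k s) / (2 * s)).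
  move=> s0; have q0 : 0 < Num.sqrt s by rewrite sqrtr_gt0.
  have d1 : is_derive s 1 (fun t : R => psi (Num.sqrt t))
      ((g (u (Num.sqrt s)) - n.+1%:R * k s) / (2 * s)).
    apply: (is_derive_eq (deriv_comp (f := psi) (deriv_mul (sol_v su q0)
      (deriv_inv _ (deriv_id _))) (is_derive1_sqrt s0))); first by rewrite gt_eqF.
    have -> : 2 * s = 2 * Num.sqrt s ^+ 2 by rewrite sqr_sqrtr// ltW.
    rewrite kpos// /psi -natr1.
    by field; rewrite gt_eqF.
  apply: (@deriv_eq_near _ _ _ s s _ s0 _ d1) => y ys.
  by rewrite kpos//; move: ys; rewrite ltr_norml; lra.
have kc0 : {for 0, continuous k}.
  apply/cvgrPdist_le => e e0; have [d d0 dP] := psi_lim e e0.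
  have d20 : 0 < d ^+ 2 by rewrite exprn_gt0.
  exists (d ^+ 2) => //= y; rewrite /ball_ /= sub0r normrN k0 => yd.
  have [y0|y0] := leP y 0; first by rewrite /k y0 subrr normr0 ltW.
  rewrite distrC kpos//; apply: dP; rewrite sqrtr_gt0 y0 /=.
  by rewrite -(ltr_pXn2r (n := 2)) ?nnegrE ?sqrtr_ge0 ?ltW// sqr_sqrtr ?ltW// -(gtr0_norm y0).
have kc : continuous k.
  move=> s; case: (ltgtP s 0) => [s0|s0|->//]; last exact: (deriv_cont (kd s s0)).
  have s1 : 0 < - s by rewrite oppr_gt0.
  have : is_derive s 1 k 0.
    apply: (@deriv_eq_near _ (fun=> c) _ s (- s) _ s1 _ (deriv_cst c s)) => y.
    by rewrite ltr_norml => /andP[_ ys]; rewrite /k; case: leP => // y0; lra.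
  exact: deriv_cont.
have [||K Kd K0] := @prim_exists R (fun s => k s - c).
- by move=> s; apply: cvgB; [exact: kc|exact: cvg_cst].
- by move=> s s0; rewrite /k s0 subrr.
pose h s := a - (K s + c * s) / 2.
have hd s : is_derive s 1 h (- k s / 2).
  apply: (is_derive_eq (deriv_sub (deriv_cst a s) (deriv_mul
    (deriv_add (Kd s) (deriv_mull c (deriv_id s))) (deriv_cst 2^-1 s)))).
  by field.
have h0 : h 0 = a by rewrite /h K0//; field.
have hu r : 0 < r -> h (r ^+ 2) = u r.
  pose D r := h (r ^+ 2) - u r.
  have Dd t : 0 < t -> is_derive t 1 D 0.
    move=> t0.
    have d1 : is_derive t 1 (fun w : R => h (w ^+ 2)) (- k (t ^+ 2) / 2 * (2%:R * t ^+ 1)).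
      exact: (deriv_comp (f := h) (g := fun w : R => w ^+ 2) (hd (t ^+ 2)) (deriv_expr 2 t)).
    apply: (is_derive_eq (deriv_sub d1 (sol_u su t0))).
    rewrite kpos ?exprn_gt0// sqrtr_sqr gtr0_norm// /psi /=.
    by field; rewrite gt_eqF.
  have Dl : D x @[x --> 0^'+] --> (0 : R).
    have hl : h (x ^+ 2) @[x --> 0^'+] --> h 0.
      by apply: continuous_cvg; [exact: (deriv_cont (hd 0))|exact: lim0_expr].
    have Dl : D x @[x --> 0^'+] --> h 0 - a by apply: cvgB hl (sol_u0 su).
    by rewrite h0 subrr in Dl.
  by move=> r0; apply/eqP; rewrite -subr_eq0; apply/eqP/(const_of_deriv0 Dd Dl r0).
exists h, k; split=> // s s0.
have -> : h s = u (Num.sqrt s) by rewrite -hu ?sqrtr_gt0// sqr_sqrtr ?ltW.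
exact: kd.
Qed.

End Profile.

Section Laplace.
Variables (R : realType) (N : nat).
Implicit Types (x y : 'rV[R]_N) (i : 'I_N) (H K : R -> R) (l : R).

Lemma coord_le_norm x i : `|x 0 i| <= `|x|.
Proof. by rewrite [leRHS]/Num.Def.normr /= mx_normrE; apply/bigmax_geP; right => /=; exists (0, i). Qed.

Lemma coord_diff x i : is_diff x (fun y : 'rV[R]_N => y 0 i) (fun y : 'rV[R]_N => y 0 i).
Proof.
have @c : {linear 'rV[R]_N -> R}.
  by exists (fun y : 'rV[R]_N => y 0 i); do 2![eexists]; do ?[constructor];
     rewrite ?mxE// => ? *; rewrite ?mxE//; move=> ?; rewrite !mxE.
have cE : (fun y : 'rV[R]_N => y 0 i) = c by [].
rewrite cE; apply: DiffDef; first exact/linear_differentiable/coord_continuous.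
by rewrite diff_lin//; exact: coord_continuous.
Qed.

Lemma coord_derive x v i : 'D_v (fun y : 'rV[R]_N => y 0 i) x = v 0 i.
Proof.
by have [d e] := coord_diff x i; rewrite deriveE// e.
Qed.

Definition sqnorm x := \sum_i x 0 i ^+ 2.

Lemma sqnorm_ge0 x : 0 <= sqnorm x.
Proof. by apply: sumr_ge0 => i _; exact: sqr_ge0. Qed.

Lemma sqnorm0 : sqnorm 0 = 0.
Proof. by rewrite /sqnorm big1// => i _; rewrite mxE expr0n. Qed.

Lemma coord_sq_le x i : x 0 i ^+ 2 <= sqnorm x.
Proof.
by rewrite /sqnorm (bigD1 i)//= lerDl; apply: sumr_ge0 => j _; exact: sqr_ge0.
Qed.

Lemma sqnorm_eq0 x : sqnorm x = 0 -> x = 0.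
Proof.
move=> x0; apply/rowP => i; rewrite mxE; apply/eqP; rewrite -sqrf_eq0 eq_le sqr_ge0.
by rewrite -x0 coord_sq_le.
Qed.

Lemma sqnorm_gt0 x : x != 0 -> 0 < sqnorm x.
Proof.
move=> x0; rewrite lt_neqAle sqnorm_ge0 andbT eq_sym.
by apply: contraNneq x0 => /sqnorm_eq0->.
Qed.

Lemma norm_sq_le x : `|x| ^+ 2 <= sqnorm x.
Proof.
rewrite -[leRHS](sqr_sqrtr (sqnorm_ge0 x)) ler_pXn2r ?nnegrE ?sqrtr_ge0//.
rewrite [leLHS]/Num.Def.normr /= mx_normrE bigmax_le ?sqrtr_ge0// => -[j i] _ /=.
by rewrite (ord1 j) -sqrtr_sqr ler_wsqrtr// coord_sq_le.
Qed.

Lemma sqnorm_differentiable x : differentiable sqnorm x.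
Proof.
rewrite (_ : sqnorm = \sum_i (fun y : 'rV[R]_N => y 0 i) ^+ 2); last first.
  by apply/funext => y; rewrite fct_sumE /sqnorm; apply: eq_bigr => i _.
by apply: differentiable_sum => i; apply: differentiableX; exact: differentiable_coord.
Qed.

Lemma sqnorm_derive x i : 'D_(delta_mx 0 i) sqnorm x = 2 * x 0 i.
Proof.
rewrite (_ : sqnorm = \sum_i (fun y : 'rV[R]_N => y 0 i) ^+ 2); last first.
  by apply/funext => y; rewrite fct_sumE /sqnorm; apply: eq_bigr => j _.
have cd j : derivable (fun y : 'rV[R]_N => y 0 j) x (delta_mx 0 i).
  by apply: diff_derivable; exact: differentiable_coord.
rewrite derive_sum => [|j]; last exact: derivableX.
rewrite (bigD1 i)//= big1 => [|j ji]; rewrite deriveX// coord_derive mxE ?eqxx.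
  by rewrite addr0 /= expr1 [LHS]mulr1.
by rewrite (negbTE ji) andbF scaler0.
Qed.

Lemma comp_sqnorm_differentiable H l x : is_derive (sqnorm x) 1 H l ->
  differentiable (fun y => H (sqnorm y)) x.
Proof.
move=> Hl; apply: (@differentiable_comp _ _ _ _ sqnorm H).
  exact: sqnorm_differentiable.
by apply/derivable1_diffP; exact: ex_derive.
Qed.

Lemma comp_sqnorm_derive H l x i : is_derive (sqnorm x) 1 H l ->
  'D_(delta_mx 0 i) (fun y => H (sqnorm y)) x = 2 * x 0 i * l.
Proof.
move=> Hl; rewrite deriveE; last exact: comp_sqnorm_differentiable Hl.
have dH : derivable H (sqnorm x) 1 by exact: ex_derive.
rewrite (@diff_comp _ _ _ _ sqnorm H); last exact/derivable1_diffP.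
  rewrite /= deriv1E// derive1E (@derive_val _ _ _ _ _ _ _ Hl) -deriveE.
    by rewrite sqnorm_derive.
  exact: sqnorm_differentiable.
exact: sqnorm_differentiable.
Qed.

Lemma diff_small (f : 'rV[R]_N -> R) : f 0 = 0 ->
  (forall e : R, 0 < e -> exists2 d : R, 0 < d & forall y, `|y| < d -> `|f y| <= e * `|y|) ->
  is_diff (0 : 'rV[R]_N) f 0.
Proof.
move=> f0 fe.
have o : f \o shift 0 = cst (f 0) + 0 +o_ (0 : 'rV[R]_N) id.
  apply/eqaddoP => e e0; have [d d0 dP] := fe e e0.
  apply/nbhs_ballP; exists d => //= y; rewrite -ball_normE /ball_ /= sub0r normrN => yd.
  by rewrite /cst /= !fctE f0 /= !addr0 subr0 dP.
have [z0 _] := dcst (0 : R) (0 : 'rV[R]_N).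
have E : 'd f (0 : 'rV[R]_N) = 0 :> ('rV[R]_N -> R) by apply/diff_unique.
by apply: DiffDef => //; apply/diff_locallyP; rewrite E.
Qed.

Lemma coord_mul_diff0 K i : {for 0, continuous K} ->
  is_diff (0 : 'rV[R]_N) (fun y => K (sqnorm y) * y 0 i) (fun y => K 0 * y 0 i).
Proof.
move=> Kc.
have h1 : is_diff (0 : 'rV[R]_N) (fun y => (K (sqnorm y) - K 0) * y 0 i) 0.
  apply: diff_small => [|e e0]; first by rewrite mxE mulr0.
  have Kq : {for (0 : 'rV[R]_N), continuous (fun y => K (sqnorm y))}.
    apply: (@continuous_comp _ _ _ sqnorm K); last by rewrite sqnorm0.
    exact/differentiable_continuous/sqnorm_differentiable.
  move/cvgrPdist_le : Kq => /(_ e e0) /nbhs_ballP[d /= d0 dP]; exists d => // y yd.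
  rewrite normrM ler_pM// ?coord_le_norm// distrC.
  by have := dP y; rewrite /= sqnorm0 -ball_normE; apply; rewrite /ball_ /= sub0r normrN.
have h2 : is_diff (0 : 'rV[R]_N) (K 0 \*: (fun y : 'rV[R]_N => y 0 i)) (K 0 \*: (fun y : 'rV[R]_N => y 0 i)).
  exact: is_diffZ (coord_diff 0 i).
have -> : (fun y => K (sqnorm y) * y 0 i) =
    (fun y => (K (sqnorm y) - K 0) * y 0 i) + (K 0 \*: (fun y : 'rV[R]_N => y 0 i)).
  by apply/funext => y; rewrite !fctE /= /GRing.scale /= -mulrDl subrK.
by apply: (is_diff_eq (is_diffD h1 h2)); rewrite add0r; apply/funext.
Qed.


Section Radial.
Variables (h k G : R -> R).
Hypothesis hd : forall s : R, is_derive s 1 h (- k s / 2).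
Hypothesis k0 : {for 0, continuous k}.
Hypothesis kd : forall s : R, 0 < s -> is_derive s 1 k ((G (h s) - N%:R * k s) / (2 * s)).
Hypothesis kG : N%:R * k 0 = G (h 0).

Let U x := h (sqnorm x).

Lemma radial_differentiable x : differentiable U x.
Proof. exact: comp_sqnorm_differentiable (hd _). Qed.

Lemma radial_partial i : partial i U = fun x => - (k (sqnorm x) * x 0 i).
Proof.
apply/funext => x; rewrite /partial (comp_sqnorm_derive i (hd (sqnorm x))).
by field.
Qed.

Let partial_neq0 i x : x != 0 ->
  differentiable (fun y => k (sqnorm y) * y 0 i) x /\
  'D_(delta_mx 0 i) (fun y => k (sqnorm y) * y 0 i) x =
    k (sqnorm x) + x 0 i ^+ 2 * ((G (U x) - N%:R * k (sqnorm x)) / sqnorm x).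
Proof.
move=> /sqnorm_gt0 q0.
have dk := comp_sqnorm_differentiable (kd q0).
have dc : differentiable (fun y : 'rV[R]_N => y 0 i) x by exact: differentiable_coord.
split; first exact: (differentiableM dk dc).
have dk' : derivable (fun y => k (sqnorm y)) x (delta_mx 0 i) by exact: diff_derivable.
have dc' : derivable (fun y : 'rV[R]_N => y 0 i) x (delta_mx 0 i) by exact: diff_derivable.
rewrite (deriveM dk' dc').
rewrite coord_derive (comp_sqnorm_derive i (kd q0)) mxE !eqxx /GRing.scale /= /U.
by field; rewrite gt_eqF.
Qed.

Let partial_eq0 i :
  differentiable (fun y => k (sqnorm y) * y 0 i) 0 /\
  'D_(delta_mx 0 i) (fun y => k (sqnorm y) * y 0 i) 0 = k 0.
Proof.
have [d e] := coord_mul_diff0 i k0; split=> //.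
by rewrite deriveE// e mxE !eqxx mulr1.
Qed.

Let partial_differentiable i x : differentiable (fun y => k (sqnorm y) * y 0 i) x.
Proof.
have [->|x0] := eqVneq x 0; first by case: (partial_eq0 i).
by case: (partial_neq0 i x0).
Qed.

Lemma radial_partial_differentiable i x : differentiable (partial i U) x.
Proof. rewrite radial_partial; exact: differentiableN (partial_differentiable i x). Qed.

Lemma radial_laplacian x : laplacian U x = - G (U x).
Proof.
have E i : partial i (partial i U) x = - 'D_(delta_mx 0 i) (fun y => k (sqnorm y) * y 0 i) x.
  rewrite radial_partial /partial; apply: deriveN.
  exact: diff_derivable (partial_differentiable i x).
rewrite /laplacian (eq_bigr _ (fun i _ => E i)) sumrN; congr (- _).
have [->|x0] := eqVneq x 0.
  rewrite (eq_bigr (fun=> k 0)) => [|i _]; last by case: (partial_eq0 i).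
  by rewrite sumr_const card_ord -mulr_natl kG /U sqnorm0.
rewrite (eq_bigr _ (fun i _ => (partial_neq0 i x0).2)) big_split /=.
rewrite sumr_const card_ord -mulr_suml -/(sqnorm x).
rewrite [sqnorm x * _]mulrC divfK; first by rewrite mulr_natl subrKC.
by rewrite gt_eqF ?sqnorm_gt0.
Qed.

End Radial.

End Laplace.

Section GroundStates.
Variables (R : realType) (n : nat).
Hypothesis n_gt0 : (0 < n)%N.
Implicit Types (g F u v : R -> R) (a b beta r : R).

Lemma pde_ground_state_ext (f g : R -> R) (gamma : \bar R) a (U : 'rV[R]_n.+1 -> R) :
  (forall s, 0 <= s <= a -> f s = g s) -> (forall x, 0 <= U x <= a) ->
  pde_ground_state g gamma U -> pde_ground_state f gamma U.
Proof.
move=> fg Ua [h1 [h2 [h3 h4]]]; split=> //; split=> //; split=> // x.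
by rewrite fg.
Qed.

Lemma good_ground_state g F b beta a (gamma : \bar R) : shape g F b beta -> b < a ->
  (a%:E < gamma)%E -> has_good n g F a ->
  exists U : 'rV[R]_n.+1 -> R,
    [/\ pde_ground_state g gamma U, U 0 = a & forall x, 0 <= U x <= a].
Proof.
move=> gF ba aG [u [v [s ue]]].
have a0 : 0 < a := lt_trans (shape_b_gt0 gF) ba.
have [||vpos udec] := good_decays n_gt0 gF s ba.
- by move=> r /ue[].
- by move=> r /ue[].
have [h [k [h0 hu hd [kc k0] kd]]] := radial_profile n_gt0 (shape_cont gF) s.
pose U (x : 'rV[R]_n.+1) := h (sqnorm x).
have kG : n.+1%:R * k 0 = g (h 0) by rewrite k0 h0 mulrC divfK// pnatr_eq0.
have Uu x : x != 0 -> 0 < Num.sqrt (sqnorm x) /\ U x = u (Num.sqrt (sqnorm x)).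
  move=> /sqnorm_gt0 q0.
  by rewrite sqrtr_gt0 q0 -hu ?sqrtr_gt0// sqr_sqrtr// ltW.
have Ua x : 0 <= U x <= a.
  have [->|x0] := eqVneq x 0; first by rewrite /U sqnorm0 h0 lexx ltW.
  have [r0 ->] := Uu x x0; have [-> _] := ue _ r0; rewrite (value_le_init s r0)//.
  by move=> t /andP[t0 _]; exact: vpos.
have U0 : U 0 = a by rewrite /U sqnorm0.
exists U; split=> //; split; first exact: (radial_differentiable (N := n.+1) hd).
split; first exact: (radial_partial_differentiable hd kc kd).
split; first by move=> x; rewrite (radial_laplacian hd kc kd kG) addNr.
split.
  move=> x; have /andP[-> Ux] := Ua x; split=> //.
  by apply: le_lt_trans aG; rewrite lee_fin.
split; first by exists 0; rewrite U0 gt_eqF.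
move=> e e0; have [r1 r10 r1P] := udec e e0; exists r1 => x xr.
have x0 : x != 0 by rewrite -normr_gt0; exact: lt_trans xr.
have [r0 UE] := Uu x x0; rewrite UE ger0_norm; last by have [] := ue _ r0.
apply: r1P; apply: (le_trans (ltW xr)).
by rewrite -(ler_pXn2r (n := 2)) ?nnegrE ?sqrtr_ge0// sqr_sqrtr ?sqnorm_ge0// norm_sq_le.
Qed.

End GroundStates.

Theorem theorem4p4 (R : realType) (N k : nat) (f1 : R -> R) (astar b beta : R)
  (f : nat -> R -> R) (gamma : \bar R) :
  (2 < N)%N -> (2 <= k)%N ->
  H1 f1 b beta -> H2 N f1 beta -> H3 f1 b -> H4 N f1 astar ->
  (astar%:E < gamma)%E ->
  (forall i, (2 <= i <= k)%N ->
     {within [set s | astar <= s /\ (s%:E < gamma)%E], continuous (f i)} /\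
     (forall s, astar <= s -> (s%:E < gamma)%E -> 0 < f i s)) ->
  exists (eps A alpha : nat -> R),
    (forall i, (1 <= i <= k.-1)%N -> 0 < eps i) /\
    (forall i, (2 <= i <= k)%N -> 0 < A i) /\
    0 < alpha 1 /\
    (forall i, (2 <= i <= k.-1)%N ->
       astar < alpha i.-1 + eps i.-1 < alpha i) /\
    astar < alpha k.-1 + eps k.-1 /\
    ((alpha k.-1 + eps k.-1)%:E < gamma)%E /\
    exists u : nat -> 'rV[R]_N -> R,
          (forall j, (j < k)%N ->
             pde_ground_state (fnl k f1 f A alpha eps) gamma (u j)) /\
          (forall i j, (i < k)%N -> (j < k)%N -> i <> j ->
             forall a : 'rV[R]_N, u i <> (fun x => u j (x + a))).
Proof.
case: N => // n; case: k => [//|k]; rewrite !ltnS => n1 k1 h1 _ _ h4 ag fP.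
have n0 : (0 < n)%N := ltn_trans (ltn0Sn _) n1.
have [Gamma aG Gg] : exists2 Gamma : R, astar < Gamma & (Gamma%:E <= gamma)%E.
  case: gamma ag {fP} => [r| |] //; first by rewrite lte_fin => ar; exists r.
  by move=> _; exists (astar + 1); rewrite ?ltrDl// leey.
have {}fP i : (2 <= i <= k.+1)%N ->
     {within [set s | astar <= s /\ s < Gamma], continuous (f i)} /\
     (forall s, astar <= s -> s < Gamma -> 0 < f i s).
  have lt s : s < Gamma -> (s%:E < gamma)%E.
    by move=> sG; apply: lt_le_trans Gg; rewrite lte_fin.
  move=> /fP[fc fpos]; split; last by move=> s s0 /lt; exact: fpos.
  by apply: continuous_subspaceW fc => s [s0 /lt].
have [kappa kappaP] := drop_ratio_exists R n1.
have [eps [A [alpha [z [g [F st]]]]]] : exists eps A alpha z g F,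
    stage n kappa f1 b beta astar Gamma f k eps A alpha z g F.
  elim: k k1 fP => [//|[_ _ fP|k IH _ fP]].
    by apply: (stage_base n1 kappaP h1 h4 aG); exact: (fP 2%N _).2.
  have [|i /andP[i2 ik]|eps [A [alpha [z [g [F st]]]]]] := IH _ _ => //.
    by apply: fP; rewrite i2 ltnW.
  have [c p] := fP k.+2 ltac:(by rewrite !ltnS leqnSn).
  have [_ p'] := fP k.+3 ltac:(by rewrite !ltnS leqnn).
  exact: (stage_step n1 kappaP _ st c p p').
exists eps, A, alpha; rewrite /=.
have sh := stage_shape st; have b0 := shape_b_gt0 sh; have bb := shape_b_beta sh.
split; first exact: stage_eps st.
split; first exact: stage_A st.
split; first by have := stage_alpha1 st; lra.
split.
  move=> i /andP[i2 ik]; rewrite (stage_gap st) ?i2// andbT.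
  by apply: (stage_astar st); case: i i2 ik => [|[|i]]// _ ik; rewrite /= ltnW.
split; first by apply: (stage_astar st); rewrite k1 leqnn.
have tauG : ((alpha k + eps k)%:E < gamma)%E.
  by apply: lt_le_trans Gg; rewrite lte_fin (stage_Gamma st).
split=> //.
have sols j : exists U : 'rV[R]_n.+1 -> R, (j <= k)%N ->
    [/\ pde_ground_state (fnl k.+1 f1 f A alpha eps) gamma U, U 0 = z j &
        forall x, U x <= z j].
  have [jk|] := leqP j k; last by exists (fun=> 0).
  have [/andP[bz zt] gz] := stage_good st jk.
  have zG : ((z j)%:E < gamma)%E by apply: le_lt_trans tauG; rewrite lee_fin.
  have [U [Ug U0 Uz]] := good_ground_state n0 sh (lt_trans bb bz) zG gz.
  exists U => _; split=> //; last by move=> x; have /andP[] := Uz x.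
  apply: (pde_ground_state_ext _ Uz Ug) => s /andP[s0 sz].
  by apply: (fnl_stage st k1); rewrite s0 (le_trans sz).
have [u uP] := choice sols.
exists u; split; first by move=> j; rewrite ltnS => /uP[].
have z_mono i j : (i < j)%N -> (j <= k)%N -> z i < z j.
  elim: j => // j IH; rewrite ltnS leq_eqVlt => /predU1P[->|ij] jk.
    exact: (stage_incr st).
  by apply: (lt_trans (IH ij (ltnW jk))); exact: (stage_incr st).
move=> i j; rewrite !ltnS => ik jk ij a uE.
have [_ i0 ile] := uP i ik; have [_ j0 jle] := uP j jk.
have zij : z i <= z j by rewrite -i0 uE; exact: jle.
have zji : z j <= z i by rewrite -j0 -(addNr a) -[u j _]/((fun x => u j (x + a)) (- a)) -uE.
have [lt|lt|//] := ltngtP i j.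
- by have := z_mono i j lt jk; rewrite ltNge zji.
- by have := z_mono j i lt ik; rewrite ltNge zij.
Qed.
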